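(* In the setting below, fix $0\le k\le g$ with $N_k>1$, and let $B_0:=(0,\dots,0,N_k)\in\mathcal{B}$. Then the boundary polynomial $\bar H_k$ of $H_k$ (w.r.t. its Newton polygon $\mathcal{N}(H_k)$) equals $$\bar H_k=\sum_{(i,w_i)\in\mathcal{N}(H_k)}\Big(\sum_{B\in\mathcal{B}(i,w_i+v_k(F))}f_B\Lambda^{B-B_0}\Big)x^{w_i}y^i.$$
   Context: Setting. $\mathbb{K}$ perfect, $F\in\mathbb{K}[[x]][y]$ monic of degree $d$, $\mathrm{char}\,\mathbb{K}=0$ or $>d$. Newton polygon of $H=\sum h_i(x)y^i$: lower convex hull of $(i,\mathrm{val}_x h_i)$; principal Newton polygon: its edges of negative slope; boundary polynomial: sum of terms $h_{ij}x^jy^i$ with $(i,j)$ on the polygon. $H$ degenerated: polygon straight of slope $-m/q$ ($\gcd(q,m)=1$, $q>0$) and boundary polynomial $c(P(y^q/x^m)x^{\varepsilon m\deg P})^N$ with $c\ne0$, $P$ monic irreducible, $\varepsilon=1$ if $m\ge0$, else $0$; edge data $(q,m,P,N)$, $\ell=\deg P$. Procedure: $\mathbb{K}_0=\mathbb{K}$, $N_0=d$, $\tau_0(x,y)=(x,y-a_{d-1}(x)/d)$ ($a_{d-1}$ coefficient of $y^{d-1}$), $H_0=F\circ\tau_0$. For $k\ge0$: if $N_k=1$ or $H_k$ not degenerated over $\mathbb{K}_k$ (w.r.t. Newton polygon if $k=0$, principal Newton polygon if $k\ge1$), stop with $g=k$; else with edge data $(q_{k+1},m_{k+1},P_{k+1},N_{k+1})$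 let $\mathbb{K}_{k+1}=\mathbb{K}_k[Z]/(P_{k+1})$, $z_{k+1}$ the class of $Z$, $q_{k+1}s_{k+1}-m_{k+1}t_{k+1}=1$, $0\le t_{k+1}<q_{k+1}$, $\sigma_{k+1}(x,y)=(z_{k+1}^{t_{k+1}}x^{q_{k+1}},x^{m_{k+1}}(y+z_{k+1}^{s_{k+1}}))$, write $H_k\circ\sigma_{k+1}=x^aUG$ ($U(0,0)\ne0$, $G$ Weierstrass of degree $N_{k+1}$), $\tau_{k+1}(x,y)=(x,y+c_{k+1}(x))$ with $c_{k+1}=-(\text{coefficient of }y^{N_{k+1}-1}\text{ in }G)/N_{k+1}$, $H_{k+1}=G\circ\tau_{k+1}$. $\pi_0=\tau_0$, $\pi_k=\pi_{k-1}\circ\sigma_k\circ\tau_k$, so $\pi_k(x,y)=(\mu_kx^{e_k},\alpha_kx^{r_k}y+S_k(x))$ with $\mu_k,\alpha_k\in\mathbb{K}_k^\times$, $e_k=q_1\cdots q_k$; $f_k=\ell_1\cdots\ell_k$. $\phi_i$ ($0\le i\le g$) is the unique monic irreducible polynomial in $\mathbb{K}[[x]][y]$ with $\phi_i(\mu_ix^{e_i},S_i(x))=0$; $\phi_{-1}=x$. For $H\in\mathbb{K}[[x]][y]$: $v_k(H)=\mathrm{val}_x(H\circ\pi_k)$ and $\lambda_k(H)\in\mathbb{K}_k$ is the trailing coefficient in $y$ of $\big((H\circ\pi_k)/x^{v_k(H)}\big)|_{x=0}$ ($\lambda_k(0)=0$). $\Phi=(\phi_{-1},\dots,\phi_k)$,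 $\mathcal{B}=\{B\in\mathbb{N}^{k+2}: b_{i-1}<q_i\ell_i,\ 1\le i\le k\}$, $\Phi^B=\prod\phi_i^{b_i}$; $F=\sum_{B\in\mathcal{B}}f_B\Phi^B$ uniquely with $f_B\in\mathbb{K}$. $V=(v_k(\phi_i))_{i=-1}^k$, $\Lambda=(\lambda_k(\phi_i))_{i=-1}^k$ (nonzero, invertible entries), $\Lambda^B=\prod\lambda_k(\phi_i)^{b_i}$ (for integer vectors). $\mathcal{B}(i,w)=\{B\in\mathcal{B}: b_k=i,\ \langle B,V\rangle=w\}$, empty for $w=\infty$. $w_i=\min\{\langle B,V\rangle: b_k=i,\ f_B\ne0\}-v_k(F)$ ($\infty$ if empty). *)

(* Defs.v *)
From HB Require Import structures.
From mathcomp Require Import all_boot all_algebra.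
Set Implicit Arguments. Unset Strict Implicit. Unset Printing Implicit Defensive.
Import GRing.Theory.
Local Open Scope ring_scope.

(* Formal power series in x (coefficient functions) and polynomials in  *)
(* y with power-series coefficients, i.e. elements of R[[x]][y].        *)
Section Series.
Variable R : comNzRingType.

Definition ser := nat -> R.
Definition s0 : ser := fun _ => 0.
Definition sconst (c : R) : ser := fun j => if j == 0%N then c else 0.
Definition sX (n : nat) : ser := fun j => if j == n then 1 else 0.
Definition sadd (S T : ser) : ser := fun j => S j + T j.
Definition sscale (c : R) (S : ser) : ser := fun j => c * S j.
Definition smul (S T : ser) : ser := fun j => \sum_(a < j.+1) S a * T (j - a)%N.
Definition spow (S : ser) (n : nat) : ser := iter n (smul S) (sconst 1).
(* S(c x^e), for e > 0 *)
Definition ssubst (c : R) (e : nat) (S : ser) : ser :=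
  fun j => if (0 < e)%N && (e %| j)%N then c ^+ (j %/ e) * S (j %/ e)%N else 0.

(* H = sum_i (nth H i)(x) y^i ; bco H i j = coefficient of x^j y^i *)
Definition bpol := seq ser.
Definition bco (H : bpol) (i j : nat) : R := nth s0 H i j.
Definition beq (H1 H2 : bpol) := forall i j, bco H1 i j = bco H2 i j.
Definition bone : bpol := [:: sconst 1].
Definition bxpow (n : nat) : bpol := [:: sX n].
Definition bmul (H1 H2 : bpol) : bpol :=
  mkseq (fun n => fun j =>
     \sum_(a < n.+1) smul (nth s0 H1 a) (nth s0 H2 (n - a)%N) j)
     (size H1 + size H2).-1.
Definition bpow (H : bpol) (n : nat) : bpol := iter n (bmul H) bone.

Definition bmonic_deg (H : bpol) (n : nat) :=
  (forall j, bco H n j = (j == 0%N)%:R) /\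
  (forall i j, (n < i)%N -> bco H i j = 0).
Definition bmonic (H : bpol) := exists n, bmonic_deg H n.
Definition bunit (A : bpol) := exists B, beq (bmul A B) bone.
Definition birr (phi : bpol) :=
  ~ bunit phi /\ ~ beq phi [::] /\
  forall A B, beq phi (bmul A B) -> bunit A \/ bunit B.
Definition weierstrass (G : bpol) (n : nat) :=
  bmonic_deg G n /\ forall i, (i < n)%N -> bco G i 0 = 0.

(* "affine" substitution maps (x,y) |-> (mu x^e, al x^r y + S(x)) *)
Record amap := AMap { am_mu : R; am_e : nat; am_al : R; am_r : nat; am_S : ser }.

(* H o f, i.e. H(mu x^e, al x^r y + S(x)) *)
Definition bsubst (H : bpol) (f : amap) : bpol :=
  mkseq (fun k => fun j => \sum_(i < size H)
     smul (ssubst (am_mu f) (am_e f) (nth s0 H i))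
          (sscale ('C(i, k)%:R * am_al f ^+ k)
                  (smul (sX (am_r f * k)) (spow (am_S f) (i - k)))) j)
     (size H).

(* composition of maps: (acomp f g)(x,y) = f(g(x,y)) *)
Definition acomp (f g : amap) : amap :=
  AMap (am_mu f * am_mu g ^+ am_e f) (am_e f * am_e g)
       (am_al f * am_mu g ^+ am_r f * am_al g)
       (am_e g * am_r f + am_r g)
       (sadd (sscale (am_al f * am_mu g ^+ am_r f)
                     (smul (sX (am_e g * am_r f)) (am_S g)))
             (ssubst (am_mu g) (am_e g) (am_S f))).

Definition tau (c : ser) : amap := AMap 1 1 1 0 c.
End Series.

Section Newton.
Variable L : fieldType.

Definition npts (H : bpol L) (i j : nat) : Prop :=
  bco H i j != 0 /\ forall j', (j' < j)%N -> bco H i j' = 0.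

Definition lin (a b : int) (i j : nat) : int := a * i%:Z + b * j%:Z.

(* (i,j) lies on the Newton polygon (lower convex hull boundary) *)
Definition onNP (H : bpol L) (i j : nat) : Prop :=
  exists a b : int, 0 < b /\
   (exists i1 j1 i2 j2, npts H i1 j1 /\ npts H i2 j2 /\ (i1 <= i <= i2)%N /\
       lin a b i1 j1 = lin a b i j /\ lin a b i2 j2 = lin a b i j) /\
   forall i' j', npts H i' j' -> lin a b i j <= lin a b i' j'.

(* (i,j) lies on an edge of negative slope -a/b of the Newton polygon *)
Definition onPNP (H : bpol L) (i j : nat) : Prop :=
  exists a b : int, 0 < a /\ 0 < b /\
   (exists i1 j1 i2 j2, npts H i1 j1 /\ npts H i2 j2 /\ (i1 < i2)%N /\
       (i1 <= i <= i2)%N /\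
       lin a b i1 j1 = lin a b i j /\ lin a b i2 j2 = lin a b i j) /\
   forall i' j', npts H i' j' -> lin a b i j <= lin a b i' j'.

(* Hb (outer variable y, inner variable x) is the boundary polynomial of H
   w.r.t. the polygon whose lattice points are given by [on] *)
Definition is_bnd (on : nat -> nat -> Prop) (H : bpol L) (Hb : {poly {poly L}}) :=
  forall i j, (on i j -> Hb`_i`_j = bco H i j) /\ (~ on i j -> Hb`_i`_j = 0).

(* P(y^q/x^m) x^(eps m deg P) *)
Definition Pqm (P : {poly L}) (q : nat) (m : int) : {poly {poly L}} :=
  \sum_(r < size P)
     (P`_r *: 'X^(if 0 <= m then (absz m * ((size P).-1 - r))%N
                  else (absz m * r)%N))%:P * 'X^(q * r).

Definition poly_over (S : L -> Prop) (p : {poly L}) := forall i, S p`_i.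
Definition irr_over (S : L -> Prop) (p : {poly L}) :=
  (1 < size p)%N /\
  forall q : {poly L}, poly_over S q -> size q != 1%N -> q %| p -> q %= p.

Definition straight (on : nat -> nat -> Prop) (q : nat) (m : int) :=
  (exists c0 : int, forall i j, on i j -> m * i%:Z + q%:Z * j%:Z = c0) /\
  (exists i1 j1 i2 j2, on i1 j1 /\ on i2 j2 /\ (i1 < i2)%N).

Definition degen (on : nat -> nat -> Prop) (S : L -> Prop) (H : bpol L)
   (q : nat) (m : int) (P : {poly L}) (N : nat) :=
  (0 < q)%N /\ coprime q (absz m) /\ straight on q m /\
  P \is monic /\ poly_over S P /\ irr_over S P /\
  exists c : L, c != 0 /\ is_bnd on H (c%:P%:P * Pqm P q m ^+ N).

Definition bval_is (H : bpol L) (v : nat) :=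
  (exists i, bco H i v != 0) /\ forall i j, (j < v)%N -> bco H i j = 0.
(* val_x H = v and lam is the trailing y-coefficient of (H/x^v)|_{x=0} *)
Definition vlam (H : bpol L) (v : nat) (lam : L) :=
  bval_is H v /\
  exists i, bco H i v = lam /\ lam != 0 /\ forall i', (i' < i)%N -> bco H i' v = 0.
End Newton.

Definition perfect_field (K : fieldType) :=
  forall p, p \in [pchar K] -> forall a : K, exists b : K, b ^+ p = a.

Record rdata (L : fieldType) := RData {
  r_g : nat; r_N : nat -> nat; r_q : nat -> nat; r_m : nat -> nat;
  r_P : nat -> {poly L}; r_z : nat -> L; r_s : nat -> int; r_t : nat -> nat;
  r_c : nat -> ser L; r_G : nat -> bpol L; r_H : nat -> bpol L }.

Section Run.
Variables (K L : fieldType) (iota : {rmorphism K -> L}).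

Definition smapK (h : ser K) : ser L := fun j => iota (h j).
Definition bmapK (H : bpol K) : bpol L := map smapK H.

(* K_0 = K, K_{k+1} = K_k(z_{k+1}), as subfields of L *)
Fixpoint Kfld (z : nat -> L) (k : nat) : L -> Prop :=
  match k with
  | 0 => fun a => exists b, a = iota b
  | k'.+1 => fun a => exists p : {poly L}, poly_over (Kfld z k') p /\ a = p.[z k'.+1]
  end.

Definition polyg (k : nat) (H : bpol L) : nat -> nat -> Prop :=
  if k == 0%N then onNP H else onPNP H.

Definition tau0 (F : bpol K) (d : nat) : amap L :=
  tau (sscale (- (d%:R)^-1) (smapK (nth (s0 K) F d.-1))).

Definition sigma (q m : nat) (z : L) (s : int) (t : nat) : amap L :=
  AMap (z ^+ t) q 1 m (sscale (z ^ s) (sX L m)).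

Variables (F : bpol K) (d : nat) (D : rdata L).

Fixpoint pimap (k : nat) : amap L :=
  match k with
  | 0 => tau0 F d
  | k'.+1 => acomp (acomp (pimap k')
               (sigma (r_q D k) (r_m D k) (r_z D k) (r_s D k) (r_t D k)))
               (tau (r_c D k))
  end.

Definition run_step (k : nat) :=
  let q := r_q D k.+1 in let m := r_m D k.+1 in let P := r_P D k.+1 in
  let N' := r_N D k.+1 in let z := r_z D k.+1 in let s := r_s D k.+1 in
  let t := r_t D k.+1 in let G := r_G D k.+1 in
  r_N D k != 1%N /\
  degen (polyg k (r_H D k)) (Kfld (r_z D) k) (r_H D k) q m%:Z P N' /\
  root P z /\ q%:Z * s - m%:Z * t%:Z = 1 /\ (t < q)%N /\
  weierstrass G N' /\
  (exists (a : nat) (U : bpol L), bco U 0 0 != 0 /\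
      beq (bsubst (r_H D k) (sigma q m z s t)) (bmul (bxpow L a) (bmul U G))) /\
  r_c D k.+1 = sscale (- (N'%:R)^-1) (nth (s0 L) G N'.-1) /\
  r_H D k.+1 = bsubst G (tau (r_c D k.+1)).

Definition is_run :=
  r_N D 0 = d /\ r_H D 0 = bsubst (bmapK F) (tau0 F d) /\
  (forall k, (k < r_g D)%N -> run_step k) /\
  (r_N D (r_g D) = 1%N \/
   ~ exists (q : nat) (m : int) (P : {poly L}) (N' : nat),
       degen (polyg (r_g D) (r_H D (r_g D))) (Kfld (r_z D) (r_g D))
             (r_H D (r_g D)) q m P N').

(* phi is the monic irreducible element of K[[x]][y] vanishing at
   (mu_i x^{e_i}, S_i(x)) *)
Definition is_phi (i : nat) (phi : bpol K) :=
  bmonic phi /\ birr phi /\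
  beq (bsubst (bmapK phi) (AMap (am_mu (pimap i)) (am_e (pimap i)) 0 0 (am_S (pimap i)))) [::].
End Run.

Section Expansion.
Variables (K : fieldType) (k : nat) (Phi : 'I_k.+2 -> bpol K)
          (inB : pred {ffun 'I_k.+2 -> nat}) (f : {ffun 'I_k.+2 -> nat} -> K).

Definition ffnat (M : nat) (Bb : {ffun 'I_k.+2 -> 'I_M}) : {ffun 'I_k.+2 -> nat} :=
  [ffun l => nat_of_ord (Bb l)].

Definition PhiB (B : {ffun 'I_k.+2 -> nat}) : bpol K :=
  foldr (fun l acc => bmul (bpow (Phi l) (B l)) acc) (bone K) (enum 'I_k.+2).

Definition bounded_by (M n : nat) :=
  forall B, inB B -> f B != 0 -> (B ord0 <= n)%N -> forall l, (B l < M)%N.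

(* the (x-adically convergent) sum over B in inB of f_B Phi^B equals F *)
Definition expands (F : bpol K) :=
  (forall n, exists M, bounded_by M n) /\
  forall i j M, bounded_by M j ->
    bco F i j = \sum_(Bb : {ffun 'I_k.+2 -> 'I_M} | inB (ffnat Bb))
                   f (ffnat Bb) * bco (PhiB (ffnat Bb)) i j.
End Expansion.

Definition dotBV (k : nat) (B : {ffun 'I_k.+2 -> nat}) (V : 'I_k.+2 -> nat) : nat :=
  (\sum_(l < k.+2) B l * V l)%N.

(* Main.v *)
(* Put D_l = deg phi_l.  The D_l are products of the radices q_i l_i, so every n has mixed-radix
   digits with respect to them, and Psi_n = prod_l phi_l^(digit l of n) is monic of degree n.
   Hence the expansion of F is a finite sum F = sum_(n <= d) C_n Psi_n with C_n in K[[x]].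

   Composed with pi_k, phi_l becomes x^(v_l) (lambda_l + ...) for l < k and
   x^(v_k) y (lambda_k + ...) for l = k, so the monomial x^a Psi_n has the leading term
   Lambda^B x^<B,V> y^(b_k) for every weight positive in x and y.  The products Lambda^B with b_k
   and <B,V> fixed are linearly independent over K: along one edge the exponents of z_k run
   through an interval of length l_k, and z_k has degree l_k over K_(k-1).  Therefore leading terms
   cannot cancel, and the part of F o pi_k on a minimal line is read off the f_B.  As
   F o pi_k = x^(v_k(F)) U H_k, it is also U(0,0) times the part of H_k, and the vertex (N_k, 0)
   gives U(0,0) = Lambda^(B_0).

   The leading terms are obtained by induction on k.  A nonzero polynomial of degree at most
   D_(k+1) that vanishes at the parametrization (mu x^e, S) of level k+1 has, on the edge of slope
   -m/q at level k, an associated univariate polynomial of degree at most l over K_k with root z,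
   that is, a multiple of P_(k+1).  So its degree is exactly D_(k+1), and since P_(k+1) is
   separable the root y = 0 is simple.  A monic polynomial of that degree vanishing there exists
   by Cayley-Hamilton, as K_(k+1)[[x]] is generated by D_(k+1) elements over K[[x]]; by division
   it is phi_(k+1). *)
Require Import Defs.
From HB Require Import structures.
From mathcomp Require Import all_boot all_algebra.
From mathcomp Require Import boolp zify ring.
Set Implicit Arguments. Unset Strict Implicit. Unset Printing Implicit Defensive.
Import GRing.Theory.
Local Open Scope ring_scope.

(** * Formal power series *)

(** The relation q s - m t = 1 is what makes the exponents of z consecutive: on a line m i + q j = c
    the abscissa i moves in steps of q while j drops by m, and z^(t j + s i) gains exactly one
    factor z. Above level 0 the Weierstrass shape of H_k makes all slopes negative. The degree of
    phi_(k+1) is not part of its definition, and Cayley-Hamilton applies only once S_(k+1) is known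
    to have coefficients in K_(k+1); hence the induction also carries the field of definition of
    H_k. The assumption on the characteristic enters through q and l: both divide d, so neither
    vanishes in L. Finally, the expansion of F converges only x-adically and its indices are bounded
    separately for each power of x, so its finiteness in y has to be proved. *)

Record fps (R : Type) := Fps { fc : nat -> R }.

Lemma fpsP (R : Type) (S T : fps R) : (forall j, fc S j = fc T j) -> S = T.
Proof. by case: S T => [S] [T] /= /funext ->. Qed.

(** The wrapper lets series carry their own ring structure; decidable equality and choice are
    classical. *)
HB.instance Definition _ (R : Type) := gen_eqMixin (fps R).
HB.instance Definition _ (R : Type) := gen_choiceMixin (fps R).

Section FpsRing.
Variable R : comNzRingType.
Implicit Types S T U : fps R.

Definition fps_add S T : fps R := Fps (sadd (fc S) (fc T)).
Definition fps_opp S : fps R := Fps (fun j => - fc S j).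
Definition fps_mul S T : fps R := Fps (smul (fc S) (fc T)).
Definition fpsC (c : R) : fps R := Fps (sconst c).

Fact fps_addA : associative fps_add.
Proof. by move=> S T U; apply: fpsP => j; apply: addrA. Qed.
Fact fps_addC : commutative fps_add.
Proof. by move=> S T; apply: fpsP => j; apply: addrC. Qed.
Fact fps_add0 : left_id (Fps (@s0 R)) fps_add.
Proof. by move=> S; apply: fpsP => j; apply: add0r. Qed.
Fact fps_addN : left_inverse (Fps (@s0 R)) fps_opp fps_add.
Proof. by move=> S; apply: fpsP => j; apply: addNr. Qed.

HB.instance Definition _ :=
  GRing.isZmodule.Build (fps R) fps_addA fps_addC fps_add0 fps_addN.

Definition ftrunc n S : {poly R} := \poly_(i < n) fc S i.

(** A coefficient of a product depends on finitely many coefficients of the factors, so the ring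
    laws are inherited from polynomials by truncation. *)
Lemma fps_mul_trunc n S T j : (j < n)%N ->
  fc (fps_mul S T) j = (ftrunc n S * ftrunc n T)`_j.
Proof.
move=> jn; rewrite coefM /= /smul; apply: eq_bigr => a _.
by rewrite !coef_poly (leq_trans (ltn_ord a)) // (leq_ltn_trans (leq_subr _ _)).
Qed.

Fact fps_mulC : commutative fps_mul.
Proof.
by move=> S T; apply: fpsP => j; rewrite !(@fps_mul_trunc j.+1) // mulrC.
Qed.

Fact fps_mulE S T j : fc (fps_mul S T) j = \sum_(a < j.+1) fc S a * fc T (j - a).
Proof. by []. Qed.

Fact fps_mulA : associative fps_mul.
Proof.
move=> S T U; apply: fpsP => j.
transitivity ((ftrunc j.+1 S * ftrunc j.+1 T * ftrunc j.+1 U)`_j).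
- rewrite -mulrA coefM fps_mulE; apply: eq_bigr => a _.
  rewrite (@fps_mul_trunc j.+1) ?ltnS ?leq_subr //.
  by rewrite coef_poly (leq_trans (ltn_ord a)).
- rewrite coefM fps_mulE; apply: eq_bigr => a _.
  rewrite -(@fps_mul_trunc j.+1) ?ltn_ord //.
  by rewrite coef_poly ltnS leq_subr.
Qed.

Fact fps_mul1 : left_id (fpsC 1) fps_mul.
Proof.
move=> S; apply: fpsP => j /=; rewrite /smul big_ord_recl /= big1 => [|a _].
  by rewrite addr0 /sconst eqxx mul1r subn0.
by rewrite /sconst /= mul0r.
Qed.

Fact fps_mulDl : left_distributive fps_mul +%R.
Proof.
move=> S T U; apply: fpsP => j /=; rewrite /smul /sadd -big_split /=.
by apply: eq_bigr => a _; rewrite mulrDl.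
Qed.

Fact fps_1neq0 : fpsC 1 != 0.
Proof.
by apply/eqP => /(congr1 (fun S => fc S 0)) /eqP; rewrite /= /sconst /s0 eqxx oner_eq0.
Qed.

HB.instance Definition _ :=
  GRing.Zmodule_isComNzRing.Build (fps R) fps_mulA fps_mulC fps_mul1 fps_mulDl
    fps_1neq0.

Lemma fc0 j : fc (0 : fps R) j = 0. Proof. by []. Qed.
Lemma fc1 j : fc (1 : fps R) j = (j == 0%N)%:R.
Proof. by rewrite /= /sconst; case: eqP. Qed.
Lemma fcC c j : fc (fpsC c) j = if j == 0%N then c else 0. Proof. by []. Qed.
Lemma fcD S T j : fc (S + T) j = fc S j + fc T j. Proof. by []. Qed.
Lemma fcB S T j : fc (S - T) j = fc S j - fc T j. Proof. by []. Qed.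
Lemma fcM S T j : fc (S * T) j = \sum_(a < j.+1) fc S a * fc T (j - a).
Proof. by []. Qed.

Definition fcf j S := fc S j.
Lemma fcf_is_additive j : zmod_morphism (fcf j). Proof. by []. Qed.
HB.instance Definition _ j :=
  GRing.isZmodMorphism.Build (fps R) R (fcf j) (fcf_is_additive j).

Lemma fc_sum I (r : seq I) (P : pred I) (E : I -> fps R) j :
  fc (\sum_(i <- r | P i) E i) j = \sum_(i <- r | P i) fc (E i) j.
Proof. exact: (raddf_sum (fcf j)). Qed.

Definition ev0 S := fc S 0.
Lemma ev0_is_additive : zmod_morphism ev0. Proof. by []. Qed.
Lemma ev0_is_multiplicative : monoid_morphism ev0.
Proof.
by split=> [|S T]; rewrite /ev0 //= /smul big_ord1.
Qed.
HB.instance Definition _ :=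
  GRing.isZmodMorphism.Build (fps R) R ev0 ev0_is_additive.
HB.instance Definition _ :=
  GRing.isMonoidMorphism.Build (fps R) R ev0 ev0_is_multiplicative.

Lemma fcCM c S j : fc (fpsC c * S) j = c * fc S j.
Proof.
rewrite fcM big_ord_recl /= big1 ?addr0 => [|a _]; last by rewrite /sconst mul0r.
by rewrite /sconst eqxx subn0.
Qed.

Lemma fpsC_is_additive : zmod_morphism fpsC.
Proof.
by move=> a b; apply: fpsP => j; rewrite fcB !fcC; case: eqP; rewrite ?subr0.
Qed.
Lemma fpsC_is_multiplicative : monoid_morphism fpsC.
Proof.
split=> [|a b] //; apply: fpsP => j.
by rewrite fcCM !fcC; case: eqP => _; rewrite ?mulr0.
Qed.
HB.instance Definition _ :=
  GRing.isZmodMorphism.Build R (fps R) fpsC fpsC_is_additive.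
HB.instance Definition _ :=
  GRing.isMonoidMorphism.Build R (fps R) fpsC fpsC_is_multiplicative.

Definition xp : fps R := Fps (sX R 1).

Lemma fcXM n S j : fc (Fps (sX R n) * S) j = if (n <= j)%N then fc S (j - n) else 0.
Proof.
rewrite fcM /= /sX; case: leqP => nj.
  have nj' : (n < j.+1)%N by [].
  rewrite (bigD1 (Ordinal nj')) //= eqxx mul1r big1 ?addr0 // => a.
  by rewrite -val_eqE /= => /negPf ->; rewrite mul0r.
rewrite big1 // => a _; case: eqP => [E|_]; last by rewrite mul0r.
by have := ltn_ord a; rewrite ltnS E leqNgt nj.
Qed.

Lemma xpE n : xp ^+ n = Fps (sX R n).
Proof.
elim: n => [|n IH].
  by rewrite expr0; apply: fpsP => j; rewrite fc1 /= /sX; case: eqP.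
rewrite exprS IH; apply: fpsP => j; rewrite fcXM /= /sX.
by case: j => [|j] //=; rewrite subn1.
Qed.

Lemma fcxpM n S j : fc (xp ^+ n * S) j = if (n <= j)%N then fc S (j - n) else 0.
Proof. by rewrite xpE fcXM. Qed.

Lemma fcxp n j : fc (xp ^+ n) j = (j == n)%:R.
Proof. by rewrite xpE /= /sX; case: eqP. Qed.

Lemma fcxpMD n S j : fc (xp ^+ n * S) (n + j) = fc S j.
Proof. by rewrite fcxpM leq_addr addKn. Qed.

Lemma xp_div n S : (forall j, (j < n)%N -> fc S j = 0) ->
  S = xp ^+ n * Fps (fun j => fc S (n + j)).
Proof.
move=> H; apply: fpsP => j; rewrite fcxpM /=; case: leqP => nj; first by rewrite subnKC.
exact: H.
Qed.

(* The exponent is e.-1.+1 so that this is a ring morphism for every e; it is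
   the substitution x |-> c x^e only when e > 0. *)
Definition fsub (c : R) (e : nat) S : fps R := Fps (ssubst c e.-1.+1 (fc S)).

Lemma fcsub c e S j : (0 < e)%N ->
  fc (fsub c e S) j = if (e %| j)%N then c ^+ (j %/ e) * fc S (j %/ e) else 0.
Proof. by move=> e0; rewrite /= /ssubst prednK // e0. Qed.

Lemma fsub_is_additive c e : zmod_morphism (fsub c e).
Proof.
by move=> S T; apply: fpsP => j; rewrite fcB /= /ssubst; case: ifP; rewrite ?mulrBr ?subr0.
Qed.

Lemma sum_dvd (G : nat -> R) e n : (0 < e)%N ->
  (forall a, ~~ (e %| a)%N -> G a = 0) ->
  \sum_(a < (e * n).+1) G a = \sum_(b < n.+1) G (e * b)%N.
Proof.
move=> e0 H.
rewrite -(big_mkord xpredT G) -(big_mkord xpredT (fun b => G (e * b)%N)).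
elim: n => [|n IH]; first by rewrite muln0 !big_nat1 muln0.
rewrite [RHS]big_nat_recr //= -IH (big_cat_nat (n := (e * n).+1)) //=; last first.
  by rewrite ltnS leq_mul2l leqnSn orbT.
congr (_ + _); have lt : (e * n < e * n.+1)%N by rewrite ltn_pmul2l.
rewrite big_nat_recr //= big_nat big1 ?add0r // => a /andP[a1 a2].
apply: H; apply/negP => /dvdnP[u ua]; move: a1 a2; rewrite ua [(u * e)%N]mulnC.
by rewrite !ltn_pmul2l // => a1; rewrite ltnNge a1.
Qed.

Lemma fsub_is_multiplicative c e : monoid_morphism (fsub c e).
Proof.
split=> [|S T]; apply: fpsP => j.
  rewrite !fc1 /= /ssubst /=; case: ifP => [|/negP] dv; last by case: j dv => // [] [].
  case: j dv => [|j] dv; first by rewrite div0n expr0 /sconst mul1r.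
  by rewrite /sconst -[_ == _]negbK -lt0n divn_gt0 // dvdn_leq //= mulr0.
rewrite fcM /= /ssubst; set E := e.-1.+1; have E0: (0 < E)%N by [].
case: ifP => /= [/dvdnP[n ->]|dv].
  rewrite mulnK // mulnC.
  pose g S a := if (E %| a)%N then c ^+ (a %/ E) * fc S (a %/ E) else 0.
  symmetry; transitivity (\sum_(a < (E * n).+1) (g S a * g T (E * n - a)%N)) => //.
  rewrite (sum_dvd (G := fun a => g S a * g T (E * n - a)%N)) //; last first.
    by move=> a /negPf da; rewrite /g da mul0r.
  rewrite mulr_sumr; apply: eq_bigr => b _.
  have bn : (b <= n)%N by rewrite -ltnS.
  rewrite /g -mulnBr !dvdn_mulr // !mulKn //.
  by rewrite mulrACA -exprD subnKC.
rewrite big1 // => a _; case: ifP => da; last by rewrite mul0r.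
rewrite [X in _ * X]ifF ?mulr0 //; apply/negP => db.
by move: dv; rewrite -(subnKC (ltn_ord a : (a <= j)%N)) dvdn_add.
Qed.

HB.instance Definition _ c e :=
  GRing.isZmodMorphism.Build (fps R) (fps R) (fsub c e) (fsub_is_additive c e).
HB.instance Definition _ c e :=
  GRing.isMonoidMorphism.Build (fps R) (fps R) (fsub c e) (fsub_is_multiplicative c e).

Lemma fsubC c e a : fsub c e (fpsC a) = fpsC a.
Proof.
apply: fpsP => j; rewrite /= /ssubst /sconst /=.
case: j => [|j]; first by rewrite dvdn0 div0n expr0 mul1r.
case: ifP => // dv; rewrite -[_ == _]negbK -lt0n divn_gt0 // dvdn_leq //= mulr0 //.
Qed.

Lemma fsub_xp c e n : (0 < e)%N -> fsub c e (xp ^+ n) = fpsC (c ^+ n) * xp ^+ (e * n).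
Proof.
move=> e0; apply: fpsP => j; rewrite fcCM fcsub // !fcxp.
case: ifP => [/dvdnP[u ->]|dv].
  by rewrite mulnK // mulnC eqn_pmul2l //; case: eqP => [->|]; rewrite ?mulr0.
case: eqP => [E|]; last by rewrite mulr0.
by move: dv; rewrite E dvdn_mulr.
Qed.

Lemma fsub_comp c e c' e' S : (0 < e)%N -> (0 < e')%N ->
  fsub c' e' (fsub c e S) = fsub (c * c' ^+ e) (e * e') S.
Proof.
move=> e0 e'0; apply: fpsP => j; rewrite fcsub // fcsub // fcsub ?muln_gt0 ?e0 //.
case: (boolP (e' %| j)%N) => [/dvdnP[u ->]|dv]; last first.
  by rewrite ifF //; apply/negP => H; move: dv; rewrite (dvdn_trans _ H) // dvdn_mull.
rewrite mulnK // dvdn_pmul2r //; case: ifP => [/dvdnP[v ->]|]; last by rewrite mulr0.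
rewrite mulnK // divnMr // mulnK // mulrA; congr (_ * _).
by rewrite exprMn -exprM mulrC (mulnC v).
Qed.

Lemma fsub1 S : fsub 1 1 S = S.
Proof. by apply: fpsP => j; rewrite fcsub // dvd1n divn1 expr1n mul1r. Qed.

Lemma ev0_fsub c e S : ev0 (fsub c e S) = ev0 S.
Proof. by rewrite /ev0 /= /ssubst dvdn0 div0n expr0 mul1r. Qed.

End FpsRing.
Arguments xp {R}.

Definition fmap (R R' : comNzRingType) (h : {rmorphism R -> R'}) (S : fps R) : fps R' :=
  Fps (fun j => h (fc S j)).

Section Fmap.
Variables (R R' : comNzRingType) (h : {rmorphism R -> R'}).
Lemma fmap_is_additive : zmod_morphism (fmap h).
Proof. by move=> S T; apply: fpsP => j; exact: rmorphB. Qed.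
Lemma fmap_is_multiplicative : monoid_morphism (fmap h).
Proof.
split=> [|S T]; apply: fpsP => j; first by rewrite fc1 -(rmorph_nat h) -fc1.
rewrite fcM [LHS]rmorph_sum; apply: eq_bigr => a _; exact: rmorphM.
Qed.
HB.instance Definition _ :=
  GRing.isZmodMorphism.Build (fps R) (fps R') (fmap h) fmap_is_additive.
HB.instance Definition _ :=
  GRing.isMonoidMorphism.Build (fps R) (fps R') (fmap h) fmap_is_multiplicative.
End Fmap.

(** * Polynomials in y over power series, and substitutions *)

(** The right-hand side is the expression from which [bsubst] is built. *)
Lemma coef_affX (R : comNzRingType) (a b : R) i k :
  ((a *: 'X + b%:P) ^+ i)`_k = 'C(i, k)%:R * a ^+ k * b ^+ (i - k).
Proof.
rewrite addrC exprDn coef_sum.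
have term (l : nat) : ((b%:P ^+ (i - l) * (a *: 'X) ^+ l) *+ 'C(i, l))`_k
   = (k == l)%:R * ('C(i, k)%:R * a ^+ k * b ^+ (i - k)).
  rewrite coefMn -polyC_exp coefCM exprZn coefZ coefXn; case: eqP => [->|_].
    by rewrite mulr1 mul1r -mulr_natl; ring.
  by rewrite !mulr0 mul0r mul0rn.
under eq_bigr do rewrite term.
case: (leqP k i) => ki; last first.
  rewrite bin_small // mul0r mul0r big1 // => l _.
  by rewrite mulr0.
have ki' : (k < i.+1)%N by [].
rewrite (bigD1 (Ordinal ki')) //= eqxx mul1r big1 ?addr0 // => l.
by rewrite -val_eqE /= eq_sym => /negPf ->; rewrite mul0r.
Qed.

Section Bivariate.
Variable R : comNzRingType.
Implicit Types (H : bpol R) (p : {poly fps R}) (f g : amap R).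

Definition toP H : {poly fps R} := \poly_(i < size H) Fps (nth (@s0 R) H i).
Definition ofP p : bpol R := map (@fc R) p.

Lemma coef_toP H i : (toP H)`_i = Fps (nth (@s0 R) H i).
Proof.
by rewrite coef_poly; case: ltnP => // h; rewrite nth_default.
Qed.

Lemma fc_toP H i j : fc (toP H)`_i j = bco H i j.
Proof. by rewrite coef_toP. Qed.

Lemma beqE H1 H2 : beq H1 H2 <-> toP H1 = toP H2.
Proof.
split=> [E|E i j]; last by rewrite -!fc_toP E.
by apply/polyP => i; rewrite !coef_toP; apply: fpsP => j; apply: E.
Qed.

Lemma ofPK p : toP (ofP p) = p.
Proof.
apply/polyP => i; rewrite coef_toP; apply: fpsP => j /=.
case: (ltnP i (size p)) => h; first by rewrite (nth_map 0).
by rewrite !nth_default ?size_map.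
Qed.

Lemma toP_nil : toP [::] = 0.
Proof. by apply/polyP => i; rewrite coef_toP nth_nil coef0. Qed.

Lemma toP_bone : toP (bone R) = 1.
Proof.
apply/polyP => i; rewrite coef_toP coef1; case: i => [|i] //=.
by rewrite nth_nil.
Qed.

Lemma toP_bxpow n : toP (bxpow R n) = (xp ^+ n)%:P.
Proof.
apply/polyP => i; rewrite coef_toP coefC xpE; case: i => [|i] //=.
by rewrite nth_nil.
Qed.

Lemma size_toP H : (size (toP H) <= size H)%N.
Proof. exact: size_poly. Qed.

Lemma toP_bmul H1 H2 : toP (bmul H1 H2) = toP H1 * toP H2.
Proof.
apply/polyP => i; rewrite coef_toP /bmul.
case: (ltnP i (size H1 + size H2).-1) => h; last first.
  rewrite nth_default ?size_mkseq // [RHS]nth_default //.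
  apply: leq_trans (size_polyMleq _ _) (leq_trans _ h).
  by have := size_toP H1; have := size_toP H2; lia.
rewrite nth_mkseq // coefM; apply: fpsP => j; rewrite fc_sum /=.
by apply: eq_bigr => a _; rewrite !coef_toP.
Qed.

Lemma toP_bpow H n : toP (bpow H n) = toP H ^+ n.
Proof.
by elim: n => [|n IH]; rewrite ?toP_bone // exprS -IH -toP_bmul.
Qed.

Lemma bmonic_degE H n : bmonic_deg H n <-> toP H \is monic /\ size (toP H) = n.+1.
Proof.
split=> [[H1 H2]|[mH sH]].
  have cn : (toP H)`_n = 1.
    by rewrite coef_toP; apply: fpsP => j; rewrite fc1 -H1.
  have sz : size (toP H) = n.+1.
    apply/eqP; rewrite eqn_leq; apply/andP; split.
      apply/leq_sizeP => i ni; rewrite coef_toP; apply: fpsP => j; exact: H2.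
    by rewrite ltnNge; apply/negP => /leq_sizeP /(_ n (leqnn n)) /eqP; rewrite cn oner_eq0.
  by split=> //; rewrite monicE lead_coefE sz /= cn.
split=> [j|i j ni]; rewrite -fc_toP.
  by move: mH; rewrite monicE lead_coefE sH /= => /eqP ->; rewrite fc1.
by rewrite nth_default // sH.
Qed.

Definition aff f : {poly fps R} :=
  (fpsC (am_al f) * xp ^+ am_r f) *: 'X + (Fps (am_S f))%:P.

(** As a composite of ring morphisms, x |-> mu x^e in the coefficients and then y |-> al x^r y + S,
    the substitution is multiplicative by construction. *)
Definition psub f p : {poly fps R} :=
  (comp_poly (aff f) \o map_poly (fsub (am_mu f) (am_e f))) p.

HB.instance Definition _ f := GRing.RMorphism.copy (psub f)
  (comp_poly (aff f) \o map_poly (fsub (am_mu f) (am_e f))).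

Arguments psub : simpl never.

Lemma psubC f c : psub f c%:P = (fsub (am_mu f) (am_e f) c)%:P.
Proof. by rewrite /psub /= map_polyC comp_polyC. Qed.

Lemma psubX f : psub f 'X = aff f.
Proof. by rewrite /psub /= map_polyX comp_polyX. Qed.

Lemma psubZ f c p : psub f (c *: p) = fsub (am_mu f) (am_e f) c *: psub f p.
Proof. by rewrite /psub /= map_polyZ comp_polyZ. Qed.

Lemma smulE (S T : ser R) : Fps (smul S T) = Fps S * Fps T :> fps R.
Proof. by []. Qed.

Lemma spowE (S : ser R) n : Fps (spow S n) = Fps S ^+ n :> fps R.
Proof. by elim: n => [|n IH] //; rewrite exprS -IH. Qed.

Lemma sscaleE (c : R) (S : ser R) : Fps (sscale c S) = fpsC c * Fps S :> fps R.
Proof. by apply: fpsP => j; rewrite fcCM. Qed.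

Lemma saddE (S T : ser R) : Fps (sadd S T) = Fps S + Fps T :> fps R.
Proof. by []. Qed.

Lemma ssubstE (c : R) e (S : ser R) : (0 < e)%N -> Fps (ssubst c e S) = fsub c e (Fps S : fps R).
Proof. by move=> e0; apply: fpsP => j; rewrite fcsub //= /ssubst e0. Qed.

Lemma psub_sum f p :
  psub f p = \sum_(i < size p) fsub (am_mu f) (am_e f) p`_i *: aff f ^+ i.
Proof.
rewrite -[in LHS](coefK p) poly_def (rmorph_sum (psub f)); apply: eq_bigr => i _.
by rewrite /= psubZ (rmorphXn (psub f)) /= psubX.
Qed.

Lemma toP_bsubst H f : (0 < am_e f)%N -> toP (bsubst H f) = psub f (toP H).
Proof.
move=> e0; rewrite /toP [in RHS]poly_def (rmorph_sum (psub f)).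
apply/polyP => k; rewrite -/(toP _) coef_toP coef_sum.
have -> : nth (@s0 R) (bsubst H f) k = fun j => \sum_(i < size H)
     smul (ssubst (am_mu f) (am_e f) (nth (@s0 R) H i))
          (sscale ('C(i, k)%:R * am_al f ^+ k)
                  (smul (sX R (am_r f * k)) (spow (am_S f) (i - k)))) j.
  rewrite /bsubst; case: (ltnP k (size H)) => h; first by rewrite nth_mkseq.
  rewrite nth_default ?size_mkseq //; apply: funext => j.
  rewrite big1 // => i _.
  have -> : 'C(i, k) = 0%N by rewrite bin_small // (leq_trans (ltn_ord i)).
  rewrite mul0r /smul big1 // => a _.
  by rewrite /sscale mul0r mulr0.
apply: fpsP => j; rewrite fc_sum; apply: eq_bigr => i _.
rewrite /= psubZ (rmorphXn (psub f)) /= psubX coefZ coef_affX.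
transitivity (fc (Fps (smul (ssubst (am_mu f) (am_e f) (nth (@s0 R) H i))
          (sscale ('C(i, k)%:R * am_al f ^+ k)
                  (smul (sX R (am_r f * k)) (spow (am_S f) (i - k)))))) j) => //.
congr (fc _ j).
rewrite smulE sscaleE smulE spowE ssubstE // -xpE rmorphM rmorphXn /= rmorph_nat.
rewrite exprMn -exprM; ring.
Qed.

Lemma psub_acomp f g p : (0 < am_e f)%N -> (0 < am_e g)%N ->
  psub (acomp f g) p = psub g (psub f p).
Proof.
move=> f0 g0; rewrite psub_sum [psub f p]psub_sum (rmorph_sum (psub g)).
apply: eq_bigr => i _; rewrite /= psubZ fsub_comp // (rmorphXn (psub g)) /=; congr (_ *: _ ^+ _).
rewrite [in RHS]/aff (rmorphD (psub g)) /= psubZ psubX psubC rmorphM /= fsubC fsub_xp //.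
rewrite /aff /= saddE sscaleE smulE -xpE ssubstE //.
rewrite scalerDr scalerA -[_ *: _%:P]mul_polyC -polyCM -addrA -polyCD; congr (_ *: 'X + _%:P).
  by rewrite exprD !rmorphM /= !rmorphXn /=; ring.
rewrite rmorphM /=. by congr (_ + _); ring.
Qed.

(** Vanishing at a parametrization becomes vanishing of the constant term in y. Neither [am_al] nor
    [am_r] occurs on the right, so the map of [is_phi], where both are 0, gives the same constant
    term as [pimap]. *)
Lemma psub_eval f p : (psub f p)`_0 = (map_poly (fsub (am_mu f) (am_e f)) p).[Fps (am_S f)].
Proof.
rewrite psub_sum coef_sum horner_coef.
rewrite [RHS](big_ord_widen (size p) (fun i => (map_poly (fsub (am_mu f) (am_e f)) p)`_i * Fps (am_S f) ^+ i)).
  rewrite [RHS]big_mkcond /=; apply: eq_bigr => i _.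
  rewrite coefZ /aff coef_affX bin0 expr0 !mul1r subn0 coef_map.
  case: ifP => //; rewrite ltnNge => /negbFE h.
  move/(nth_default 0): (h); rewrite coef_map => ->; by rewrite mul0r.
exact: size_poly.
Qed.

End Bivariate.

Lemma toP_bmapK (K L : fieldType) (iota : {rmorphism K -> L}) (H : bpol K) :
  toP (bmapK iota H) = map_poly (fmap iota) (toP H).
Proof.
apply/polyP => i; rewrite coef_map /= !coef_toP; apply: fpsP => j /=.
case: (ltnP i (size H)) => h; first by rewrite (nth_map (@s0 K)).
by rewrite !nth_default ?size_map //= rmorph0.
Qed.

(** * Subfields and edge polynomials *)

Section Subfield.
Variable L : fieldType.

(** The fields K_k are predicates on the one field L, so no change of type accompanies an
    extension. *)
Record subfld (S : L -> Prop) : Prop := Subfld {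
  subfld1 : S 1;
  subfldB : forall a b, S a -> S b -> S (a - b);
  subfldM : forall a b, S a -> S b -> S (a * b);
  subfldV : forall a, S a -> S a^-1 }.

Variable S : L -> Prop.
Hypothesis HS : subfld S.

Lemma subfld0 : S 0. Proof. by rewrite -(subrr 1); apply: (subfldB HS); apply: (subfld1 HS). Qed.
Lemma subfldN a : S a -> S (- a).
Proof. by move=> Sa; rewrite -sub0r; apply: (subfldB HS) => //; apply: subfld0. Qed.
Lemma subfldD a b : S a -> S b -> S (a + b).
Proof. by move=> Sa Sb; rewrite -[b]opprK; apply: (subfldB HS) => //; apply: subfldN. Qed.
Lemma subfld_sum I (r : seq I) (P : pred I) (E : I -> L) :
  (forall i, P i -> S (E i)) -> S (\sum_(i <- r | P i) E i).
Proof. move=> h; apply: big_ind => //; [exact: subfld0 | exact: subfldD]. Qed.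
Lemma subfld_prod I (r : seq I) (P : pred I) (E : I -> L) :
  (forall i, P i -> S (E i)) -> S (\prod_(i <- r | P i) E i).
Proof. move=> h; apply: big_ind => //; [exact: (subfld1 HS) | exact: (subfldM HS)]. Qed.
Lemma subfldX a n : S a -> S (a ^+ n).
Proof.
by move=> Sa; elim: n => [|n IH]; [apply: (subfld1 HS) | rewrite exprS; apply: (subfldM HS)].
Qed.
Lemma subfldXz a (n : int) : S a -> S (a ^ n).
Proof.
by case: n => n Sa; [apply: subfldX | apply: (subfldV HS); apply: subfldX].
Qed.
Lemma subfld_nat n : S n%:R.
Proof. by elim: n => [|n IH]; [apply: subfld0 | rewrite -natr1; apply: subfldD => //; apply: (subfld1 HS)]. Qed.

Lemma pover0 : poly_over S 0. Proof. by move=> i; rewrite coef0; apply: subfld0. Qed.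
Lemma poverD p q : poly_over S p -> poly_over S q -> poly_over S (p + q).
Proof. by move=> h1 h2 i; rewrite coefD; apply: subfldD. Qed.
Lemma poverN p : poly_over S p -> poly_over S (- p).
Proof. by move=> h1 i; rewrite coefN; apply: subfldN. Qed.
Lemma poverM p q : poly_over S p -> poly_over S q -> poly_over S (p * q).
Proof. by move=> h1 h2 i; rewrite coefM; apply: subfld_sum => j _; apply: (subfldM HS). Qed.
Lemma poverC c : S c -> poly_over S c%:P.
Proof. by move=> h i; rewrite coefC; case: eqP => // _; apply: subfld0. Qed.
Lemma poverXn n : poly_over S 'X^n.
Proof. by move=> i; rewrite coefXn; case: eqP => _; [apply: (subfld1 HS) | apply: subfld0]. Qed.
Lemma poverZ c p : S c -> poly_over S p -> poly_over S (c *: p).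
Proof. by move=> h hp i; rewrite coefZ; apply: (subfldM HS). Qed.
Lemma pover_poly n (E : nat -> L) : (forall i, (i < n)%N -> S (E i)) ->
  poly_over S (\poly_(i < n) E i).
Proof. by move=> h i; rewrite coef_poly; case: ltnP => // hi; [apply: h | apply: subfld0]. Qed.
Lemma pover_deriv p : poly_over S p -> poly_over S p^`().
Proof. by move=> h i; rewrite coef_deriv -mulr_natr; apply: (subfldM HS) => //; apply: subfld_nat. Qed.

(** Long division that tracks membership of all coefficients in S, which is only a predicate on
    L. *)
Lemma pdiv_over p g : poly_over S p -> poly_over S g -> g != 0 ->
  exists u r, [/\ poly_over S u, poly_over S r, p = u * g + r & (size r < size g)%N].
Proof.
move=> Sp Sg g0; have [n] := ubnP (size p); elim: n p Sp => // n IH p Sp spn.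
case: (ltnP (size p) (size g)) => h.
  by exists 0, p; split=> //; [apply: pover0 | rewrite mul0r add0r].
have sg : (0 < size g)%N by rewrite size_poly_gt0.
pose c := lead_coef p / lead_coef g.
pose k := (size p - size g)%N.
pose p1 := p - c *: 'X^k * g.
have Sc : S c by apply: (subfldM HS); [apply: Sp | apply: (subfldV HS); apply: Sg].
have Sm : poly_over S (c *: 'X^k) by apply: poverZ => //; apply: poverXn.
have Sp1 : poly_over S p1 by apply: poverD => //; apply: poverN; apply: poverM.
have sp1 : (size p1 < size p)%N.
  suff : (size p1 <= (size p).-1)%N by lia.
  apply/leq_sizeP => i hi.
  rewrite coefB -scalerAl coefZ coefXnM ifF; last by rewrite /k; lia.
  move: hi; rewrite leq_eqVlt => /orP[/eqP <-|hi].
    have -> : ((size p).-1 - k = (size g).-1)%N by rewrite /k; lia.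
    by rewrite -!lead_coefE /c divfK ?subrr // lead_coef_eq0.
  rewrite (nth_default _ (_ : size p <= i)%N) ?(nth_default _ (_ : size g <= i - k)%N).
  - by rewrite mulr0 subr0.
  - by rewrite /k; lia.
  - by lia.
have [|u [r [Su Sr E sr]]] := IH p1 Sp1; first by lia.
exists (u + c *: 'X^k), r; split=> //; first exact: poverD.
by rewrite mulrDl addrAC -E /p1 subrK.
Qed.

Variables (P : {poly L}) (z : L).
Hypotheses (SP : poly_over S P) (irrP : irr_over S P) (rP : root P z).

Lemma irr_neq0 : P != 0.
Proof. by case: irrP => h _; rewrite -size_poly_gt0; lia. Qed.

(** P is divided by p: a nonzero remainder is a smaller annihilator of z, and a zero remainder makes
    p a divisor of the irreducible P. *)
Lemma annihilator_size p : poly_over S p -> p != 0 -> root p z -> (size P <= size p)%N.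
Proof.
have [n] := ubnP (size p); elim: n p => // n IH p spn Sp p0 rp.
have [u [r [Su Sr E sr]]] := pdiv_over SP Sp p0.
have rr : root r z.
  move: rP; rewrite E /root hornerD hornerM; move/rootP: rp => ->.
  by rewrite mulr0 add0r.
have [r0|r0] := eqVneq r 0.
  have dv : p %| P by rewrite E r0 addr0 dvdp_mull.
  have sp : size p != 1%N.
    by apply/eqP => sp1; have := root_size_gt1 p0 rp; rewrite sp1.
  by case: irrP => _ /(_ p Sp sp dv) /eqp_size ->.
by have := IH r (leq_trans sr spn) Sr r0 rr; lia.
Qed.

Lemma annihilator_eqp p : poly_over S p -> p != 0 -> root p z ->
  (size p <= size P)%N -> p %= P.
Proof.
move=> Sp p0 rp sp.
have [u [r [Su Sr E sr]]] := pdiv_over SP Sp p0.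
have rr : root r z.
  move: rP; rewrite E /root hornerD hornerM; move/rootP: rp => ->.
  by rewrite mulr0 add0r.
have r0 : r = 0.
  apply/eqP; case: eqVneq => // r0.
  by have := annihilator_size Sr r0 rr; lia.
apply: (irrP.2) => //; last by rewrite E r0 addr0 dvdp_mull.
by apply/eqP => sp1; have := root_size_gt1 p0 rp; rewrite sp1.
Qed.

Definition adjoin (a : L) := exists p : {poly L}, poly_over S p /\ a = p.[z].

Lemma adjoin_reduce a : adjoin a -> exists p, [/\ poly_over S p, a = p.[z] & (size p < size P)%N].
Proof.
move=> [p [Sp ->]]; have [u [r [Su Sr E sr]]] := pdiv_over Sp SP irr_neq0.
by exists r; split=> //; rewrite E hornerD hornerM (rootP rP) mulr0 add0r.
Qed.

Lemma sub_adjoin a : S a -> adjoin a.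
Proof. by move=> Sa; exists a%:P; split; [apply: poverC | rewrite hornerC]. Qed.

Lemma adjoin_gen : adjoin z.
Proof. by exists 'X; split; [rewrite -['X]expr1; apply: poverXn | rewrite hornerX]. Qed.

Lemma adjoin_subfld : subfld adjoin.
Proof.
have M a b : adjoin a -> adjoin b -> adjoin (a * b).
  by move=> [p [Sp ->]] [q [Sq ->]]; exists (p * q); split; [apply: poverM | rewrite hornerM].
split=> //.
- by apply: sub_adjoin; apply: (subfld1 HS).
- move=> a b [p [Sp ->]] [q [Sq ->]]; exists (p - q).
  by split; [apply: poverD => //; apply: poverN | rewrite hornerD hornerN].
move=> a /adjoin_reduce[p [Sp -> sp]]; have [n] := ubnP (size p).
elim: n p Sp sp => // n IH p Sp sp spn.
have [p0|p0] := eqVneq p 0.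
  by rewrite p0 horner0 invr0; apply: sub_adjoin; apply: subfld0.
have [/eqP/size_poly1P[c c0 pc]|sp1] := eqVneq (size p) 1%N.
  have Sc : S c by move: (Sp 0%N); rewrite pc coefC.
  rewrite pc hornerC.
  by apply: sub_adjoin; apply: (subfldV HS).
(* Dividing P by p gives u(z) p(z) = - r(z) with r smaller than p, so the inverse of p(z) comes from
   that of r(z) by induction. *)
have [u [r [Su Sr E sr]]] := pdiv_over SP Sp p0.
have pz : u.[z] * p.[z] = - r.[z].
  by apply/eqP; rewrite -addr_eq0 -hornerM -hornerD -E; exact: rP.
have r0 : r != 0.
  apply/eqP => r0.
  have dv : p %| P by rewrite E r0 addr0 dvdp_mull.
  by case: irrP => _ /(_ p Sp sp1 dv) ep; move: sp; rewrite (eqp_size ep) ltnn.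
have rz : r.[z] != 0.
  by apply/negP => h; have := annihilator_size Sr r0 h; lia.
have p_neq0 : p.[z] != 0.
  by apply/negP => h; have := annihilator_size Sp p0 h; lia.
have -> : (p.[z])^-1 = (- u).[z] * (r.[z])^-1.
  rewrite hornerN; apply: (mulfI p_neq0); rewrite mulfV // mulrA mulrN mulrC mulrC.
  by rewrite [p.[z] * _]mulrC pz opprK mulfV.
apply: M; first by exists (- u); split=> //; apply: poverN.
by apply: IH => //; lia.
Qed.

(** * Sums over the lattice points of a line m i + q j = c *)

Section Edge.
Variables (q m t : nat) (zs : L).
Hypotheses (q_gt0 : (0 < q)%N) (cop : coprime q m) (z0 : z != 0).
Hypothesis zsq : zs ^+ q = z * z ^+ (t * m).

(** The line m i + q j = c has a lattice point of abscissa i with j >= 0, namely j = (c - m i) /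
    q. *)
Definition on_edge (c i : nat) := (m * i <= c)%N && (q %| c - m * i)%N.
(** The factor z^(t j) is what x^j acquires under x |-> z^t x^q. *)
Definition edge_term (E : nat -> L) (c i : nat) : L :=
  if on_edge c i then E i * z ^+ (t * ((c - m * i) %/ q)) else 0.

Let l := (size P).-1.

Lemma on_edge_param c i0 : on_edge c i0 ->
  exists W, c = (m * (i0 %% q) + q * W)%N.
Proof.
case/andP => h /dvdnP[w hw]; exists (w + m * (i0 %/ q))%N.
by have := divn_eq i0 q; nia.
Qed.

(** By coprimality of q and m, the abscissas on one line form a single class modulo q. *)
Lemma on_edge_residue b W i : on_edge (m * b + q * W) i -> i = b %[mod q].
Proof.
case/andP => h /dvdnP[w hw].
have E : m * i = m * b %[mod q].
  by rewrite -(modnMDl w (m * i)) -(modnMDl W (m * b)); congr (_ %% _)%N; lia.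
have key u v : (u <= v)%N -> m * v = m * u %[mod q] -> v = u %[mod q].
  move=> uv /eqP; rewrite eqn_mod_dvd ?leq_mul2l ?uv ?orbT // -mulnBr Gauss_dvdr //.
  by rewrite -eqn_mod_dvd // => /eqP.
by case: (leqP b i) => bi; [apply: key | apply/esym/key => //; apply: ltnW].
Qed.

Lemma on_edge_shift b W u : (b < q)%N ->
  on_edge (m * b + q * W) (b + q * u) = (m * u <= W)%N.
Proof.
move=> bq; rewrite /on_edge.
have -> : (m * (b + q * u) <= m * b + q * W)%N = (m * u <= W)%N.
  by rewrite mulnDr leq_add2l mulnCA leq_pmul2l.
case: leqP => //= h.
have -> : (m * b + q * W - m * (b + q * u) = q * (W - m * u))%N by nia.
by rewrite dvdn_mulr.
Qed.

(** With i = b + q u and j = W - m u, [zsq] turns z^(t j) zs^i into z^(t W) zs^b z^u: up to a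
    nonzero factor, an edge sum is a polynomial in z. The multiplier [n] will be 1 for its value and
    i for its derivative. *)
Lemma edge_sum (E : nat -> L) (n : nat -> L) b W : (b < q)%N ->
  let c := (m * b + q * W)%N in
  (forall i, (q * l < i)%N -> on_edge c i -> E i = 0) ->
  \sum_(i < (q * l).+1) n i * edge_term E c i * zs ^+ i =
  z ^+ (t * W) * zs ^+ b *
    \sum_(u < l.+1) n (b + q * u)%N * (if (m * u <= W)%N then E (b + q * u)%N else 0) * z ^+ u.
Proof.
move=> bq c hE.
pose G i := n i * edge_term E c i * zs ^+ i.
have G0 i : (q * l < i)%N -> G i = 0.
  move=> hi; rewrite /G /edge_term; case: ifP => h; last by rewrite mulr0 mul0r.
  by rewrite hE // mul0r mulr0 mul0r.
have Gr i : ~~ on_edge c i -> G i = 0.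
  by move=> /negPf h; rewrite /G /edge_term h mulr0 mul0r.
have -> : \sum_(i < (q * l).+1) n i * edge_term E c i * zs ^+ i =
   \sum_(i < b + (q * l).+1) G i.
  rewrite addnC big_split_ord /= [X in _ = _ + X]big1 ?addr0 // => i _.
  by apply: G0; rewrite /=; lia.
rewrite big_split_ord /= big1 ?add0r => [|i _]; last first.
  apply: Gr; apply/negP => /on_edge_residue; rewrite !modn_small // => [ib|].
    by have := ltn_ord i; lia.
  by apply: ltn_trans bq; apply: ltn_ord.
rewrite (sum_dvd (G := fun a => G (b + a)%N)) //; last first.
  move=> a da; apply: Gr; apply/negP => /on_edge_residue.
  rewrite -[X in _ = X %[mod _]]addn0 => /eqP; rewrite eqn_modDl mod0n => h.
  by move: da; rewrite /dvdn h.
rewrite mulr_sumr; apply: eq_bigr => u _.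
rewrite /G /edge_term on_edge_shift //; case: leqP => h; last by rewrite mulr0 !mul0r mulr0.
have -> : (c - m * (b + q * u) = q * (W - m * u))%N by rewrite /c; nia.
rewrite mulKn // exprD [zs ^+ (q * u)]exprM zsq.
have -> : z ^+ (t * W) = z ^+ (t * (W - m * u)) * z ^+ (t * m) ^+ u.
  by rewrite -exprM -exprD -mulnA -mulnDr subnK.
rewrite exprMn; ring.
Qed.

(** Up to a nonzero factor the edge sum is p(z) with p of degree at most l over S, so p is
    associated to P and has degree exactly l. The weighted sum is q z p'(z) up to the same factor;
    p' is nonzero because l is nonzero in L, and it is too small to vanish at z. *)
Lemma edge_top (E : nat -> L) c :
  (forall i, on_edge c i -> S (E i)) ->
  (forall i, (q * l < i)%N -> on_edge c i -> E i = 0) ->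
  (exists i, on_edge c i /\ E i != 0) ->
  \sum_(i < (q * l).+1) edge_term E c i * zs ^+ i = 0 ->
  on_edge c (q * l) /\ E (q * l)%N != 0 /\
  ((q%:R : L) != 0 -> (l%:R : L) != 0 ->
     \sum_(i < (q * l).+1) i%:R * edge_term E c i * zs ^+ i != 0).
Proof.
move=> SE hE [i0 [ed0 E0]] hsum.
have i0l : (i0 <= q * l)%N.
  by rewrite leqNgt; apply/negP => /hE /(_ ed0) /eqP; rewrite (negPf E0).
have [W cE] := on_edge_param ed0.
set b := (i0 %% q)%N in cE; have bq : (b < q)%N by rewrite ltn_mod.
pose cf u := if (m * u <= W)%N then E (b + q * u)%N else 0.
pose p := \poly_(u < l.+1) cf u.
have zs0 : zs != 0.
  apply/eqP => zs0; move: zsq; rewrite zs0 expr0n eqn0Ngt q_gt0 /= => /esym/eqP.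
  by rewrite mulf_eq0 (negPf z0) expf_eq0 (negPf z0) andbF.
have u0 : z ^+ (t * W) * zs ^+ b != 0 by rewrite mulf_neq0 ?expf_neq0.
have cf_top u : (q * l < b + q * u)%N -> cf u = 0.
  by move=> h; rewrite /cf; case: leqP => // hu; apply: hE => //; rewrite cE on_edge_shift.
have Sp : poly_over S p.
  apply: pover_poly => u _; rewrite /cf; case: leqP => h; last exact: subfld0.
  by apply: SE; rewrite cE on_edge_shift.
have szP : size P = l.+1 by rewrite /l prednK // size_poly_gt0 irr_neq0.
have lgt0 : (0 < l)%N by case: irrP => h _; lia.
have rp : root p z.
  rewrite /root horner_poly; move: hsum.
  under eq_bigr do rewrite -[edge_term _ _ _]mul1r.
  rewrite cE (@edge_sum E (fun _ => 1)) -?cE //; move/eqP.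
  rewrite mulf_eq0 (negPf u0) /=.
  by under eq_bigr do rewrite mul1r.
have i0E : i0 = (b + q * (i0 %/ q))%N by rewrite /b addnC mulnC -divn_eq.
have p0 : p != 0.
  apply/eqP => p0; have := coef0 L (i0 %/ q)%N; rewrite -p0 coef_poly.
  rewrite ifT; last by rewrite ltnS -(mulKn l q_gt0) leq_div2r.
  move: ed0; rewrite /cf {1}i0E cE on_edge_shift // => ->.
  by rewrite -i0E => /eqP; rewrite (negPf E0).
have sp : (size p <= size P)%N by rewrite szP; apply: size_poly.
have spE : size p = l.+1 by rewrite (eqp_size (annihilator_eqp Sp p0 rp sp)).
have pl : cf l != 0.
  have : lead_coef p != 0 by rewrite lead_coef_eq0.
  by rewrite lead_coefE spE /= coef_poly leqnn.
(* A positive residue b would put the index b + q l of the leading coefficient of p beyond q l,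
   where E vanishes. *)
have b0 : b = 0%N.
  by apply/eqP; rewrite -leqn0; apply/contraT; rewrite -ltnNge => h; move: pl; rewrite cf_top ?eqxx // -[X in (X < _)%N]add0n ltn_add2r.
have mlW : (m * l <= W)%N by apply/contraT => h; move: pl; rewrite /cf (negPf h) eqxx.
split; first by rewrite cE -[(q * l)%N]add0n -b0 on_edge_shift.
split; first by move: pl; rewrite /cf mlW b0 add0n.
move=> q0 l0.
rewrite cE (@edge_sum E (fun i => i%:R)) -?cE //; apply: mulf_neq0 => //.
have -> : \sum_(u < l.+1) (b + q * u)%:R *
    (if (m * u <= W)%N then E (b + q * u)%N else 0) * z ^+ u = q%:R * z * p^`().[z].
  rewrite big_ord_recl /= b0 muln0 !mul0r add0r.
  have sd : (size p^`() <= l)%N by have := lt_size_deriv p0; rewrite spE.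
  rewrite (horner_coef_wide _ sd) mulr_sumr; apply: eq_bigr => u _.
  rewrite coef_deriv coef_poly ltnS ltn_ord /bump /= /cf add0n.
  rewrite b0 !add0n add1n exprS -mulr_natr natrM; ring.
rewrite !mulf_neq0 //; apply/negP => rd.
have d0 : p^`() != 0.
  apply/eqP => /(congr1 (fun r : {poly L} => r`_(l.-1))); rewrite coef0 coef_deriv.
  rewrite prednK // coef_poly leqnn -mulr_natr => /eqP.
  by rewrite mulf_eq0 (negPf pl) (negPf l0).
have := annihilator_size (pover_deriv Sp) d0 rd.
by rewrite szP leqNgt -spE lt_size_deriv.
Qed.

(* This is [edge_top] for coefficients with no term at the top index q l. *)
Lemma edge_indep (E : nat -> L) c :
  (forall i, on_edge c i -> S (E i)) ->
  \sum_(i < q * l) edge_term E c i * zs ^+ i = 0 ->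
  forall i, (i < q * l)%N -> on_edge c i -> E i = 0.
Proof.
move=> SE hs i il ed; apply/eqP/contraT => Ei.
pose E' i := if (i < q * l)%N then E i else 0.
have [|||| _ [/eqP]] := @edge_top E' c; rewrite /E' ?ltnn //.
- by move=> j /SE h; case: ifP => // _; apply: subfld0.
- by move=> j h _; rewrite ltnNge ltnW.
- by exists i; rewrite il.
rewrite big_ord_recr /= {2}/edge_term ltnn; case: ifP => _; rewrite !mul0r addr0 -[RHS]hs;
by apply: eq_bigr => j _; rewrite /edge_term ltn_ord.
Qed.

End Edge.

End Subfield.

(** * Weighted leading terms and mixed-radix digits *)

Section LeadingForms.
Variables (L : fieldType) (al be : nat).
Implicit Types A B H : {poly fps L}.

Definition weight_ge (c : nat) H :=
  forall i j, fc H`_i j != 0 -> (c <= al * i + be * j)%N.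

Lemma weight_ge_le c c' H : (c' <= c)%N -> weight_ge c H -> weight_ge c' H.
Proof. by move=> h hH i j /hH; apply: leq_trans. Qed.

Lemma weight_ge0 c : weight_ge c 0.
Proof. by move=> i j; rewrite coef0 eqxx. Qed.

Lemma weight_geD c A B : weight_ge c A -> weight_ge c B -> weight_ge c (A + B).
Proof.
move=> hA hB i j; rewrite coefD fcD => h.
have [a0|a0] := eqVneq (fc A`_i j) 0; last exact: hA.
by apply: hB; move: h; rewrite a0 add0r.
Qed.

Lemma fc_mul A B i j : fc (A * B)`_i j =
  \sum_(a < i.+1) \sum_(b < j.+1) fc A`_a b * fc B`_(i - a) (j - b).
Proof. by rewrite coefM fc_sum; apply: eq_bigr => a _; rewrite fcM. Qed.

Lemma weight_geM c c' A B : weight_ge c A -> weight_ge c' B -> weight_ge (c + c') (A * B).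
Proof.
move=> hA hB i j; rewrite fc_mul; apply: contraR; rewrite -ltnNge => h.
rewrite big1 // => a _; rewrite big1 // => b _; apply/eqP; rewrite mulf_eq0.
apply: contraLR h; rewrite negb_or -leqNgt => /andP[/hA h1 /hB h2].
apply: leq_trans (leq_add h1 h2) _.
have ha : (a <= i)%N by rewrite -ltnS. have hb : (b <= j)%N by rewrite -ltnS.
by rewrite addnACA -!mulnDr !subnKC.
Qed.

Definition mon (u : L) (w i : nat) : {poly fps L} := (fpsC u * xp ^+ w) *: 'X^i.

Lemma fc_mon u w i i' j :
  fc (mon u w i)`_i' j = if (i' == i) && (j == w) then u else 0.
Proof.
rewrite coefZ coefXn; case: eqP => _; last by rewrite mulr0 fc0.
by rewrite mulr1 fcCM fcxp; case: eqP => _; rewrite ?mulr1 ?mulr0.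
Qed.

Lemma monM u w i u' w' i' : mon u w i * mon u' w' i' = mon (u * u') (w + w') (i + i').
Proof.
by rewrite /mon -scalerAl -scalerAr scalerA -exprD; congr (_ *: _); rewrite rmorphM exprD /=; ring.
Qed.

Lemma weight_ge_mon u w i : weight_ge (al * i + be * w) (mon u w i).
Proof.
by move=> i' j; rewrite fc_mon; case: ifP => [/andP[/eqP -> /eqP ->] //|_]; rewrite eqxx.
Qed.

Definition leads u w i H := weight_ge (al * i + be * w).+1 (H - mon u w i).

Lemma leads_weight_ge u w i H : leads u w i H -> weight_ge (al * i + be * w) H.
Proof.
move=> h; rewrite -[H](subrK (mon u w i)); apply: weight_geD; last exact: weight_ge_mon.
by apply: weight_ge_le h.
Qed.

Lemma leadsM u w i u' w' i' A B :
  leads u w i A -> leads u' w' i' B -> leads (u * u') (w + w') (i + i') (A * B).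
Proof.
move=> hA hB; rewrite /leads -monM.
have -> : A * B - mon u w i * mon u' w' i' =
  (A - mon u w i) * B + mon u w i * (B - mon u' w' i') by ring.
have -> : ((al * (i + i') + be * (w + w')).+1 =
  (al * i + be * w).+1 + (al * i' + be * w'))%N by rewrite !mulnDr addSn addnACA.
apply: weight_geD; first by apply: weight_geM => //; apply: leads_weight_ge hB.
by rewrite addSnnS; apply: weight_geM => //; apply: weight_ge_mon.
Qed.

Lemma mon1 : mon 1 0 0 = 1.
Proof. by rewrite /mon !expr0 rmorph1 mul1r scale1r. Qed.

Lemma leads1 : leads 1 0 0 1.
Proof. by rewrite /leads mon1 subrr; apply: weight_ge0. Qed.

Lemma leadsX u w i A n : leads u w i A -> leads (u ^+ n) (n * w) (n * i) (A ^+ n).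
Proof.
move=> h; elim: n => [|n IH]; first exact: leads1.
by rewrite !exprS !mulSn; apply: leadsM.
Qed.

Lemma leads_prod n (u : 'I_n -> L) (w i : 'I_n -> nat) (A : 'I_n -> {poly fps L}) :
  (forall l, leads (u l) (w l) (i l) (A l)) ->
  leads (\prod_l u l) (\sum_l w l)%N (\sum_l i l)%N (\prod_l A l).
Proof.
move=> h; elim: n u w i A h => [|n IH] u w i A h.
  by rewrite !big_ord0; apply: leads1.
by rewrite !big_ord_recl; apply: leadsM => //; apply: IH.
Qed.

End LeadingForms.

Section MixedRadix.
Variable D : nat -> nat.
Hypotheses (D0 : D 0 = 1%N) (D_gt0 : forall l, (0 < D l)%N)
  (D_dvd : forall l, (D l %| D l.+1)%N).

(** The digit of index k takes the whole quotient: like b_k in the index set, it is unbounded. *)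
Definition dig (k n l : nat) : nat :=
  if l == k then (n %/ D k)%N else ((n %% D l.+1) %/ D l)%N.

Lemma D_dvd_le l k : (l <= k)%N -> (D l %| D k)%N.
Proof.
elim: k => [|k IH]; first by rewrite leqn0 => /eqP ->.
by rewrite leq_eqVlt ltnS => /orP[/eqP -> //|/IH h]; apply: dvdn_trans (D_dvd _).
Qed.

Lemma mod_digits k n : (n %% D k = \sum_(l < k) ((n %% D l.+1) %/ D l) * D l)%N.
Proof.
elim: k => [|k IH]; first by rewrite D0 modn1 big_ord0.
by rewrite big_ord_recr /= -IH addnC [LHS](divn_eq _ (D k)) modn_dvdm.
Qed.

Lemma dig_sum k n : (\sum_(l < k.+1) dig k n l * D l = n)%N.
Proof.
rewrite big_ord_recr /= /dig eqxx [RHS](divn_eq n (D k)) mod_digits addnC; congr (_ + _)%N.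
by apply: eq_bigr => l _; rewrite ltn_eqF.
Qed.

Lemma dig_top k n : dig k n k = (n %/ D k)%N.
Proof. by rewrite /dig eqxx. Qed.

Lemma dig_bound k n l : (l < k)%N -> (dig k n l < D l.+1 %/ D l)%N.
Proof.
move=> h; rewrite /dig ltn_eqF // ltn_divLR // divnK //.
by rewrite ltn_mod.
Qed.

Lemma dig_add k i r l : (r < D k)%N -> (l <= k)%N ->
  dig k (i * D k + r) l = (if l == k then i else dig k r l).
Proof.
move=> rk lk; rewrite /dig; case: eqP => [_|/eqP lk'].
  by rewrite divnMDl // divn_small // addn0.
have /dvdnP[u ->] : (D l.+1 %| D k)%N by apply: D_dvd_le; rewrite ltn_neqAle lk' lk.
by rewrite mulnA modnMDl.
Qed.

Lemma dig_small k r l : (r < D k.+1)%N -> (l <= k)%N -> dig k.+1 r l = dig k r l.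
Proof.
move=> rk lk; rewrite /dig [l == k.+1]ltn_eqF ?ltnS //; case: eqP => [->|//].
by rewrite modn_small.
Qed.

(** The partial sum of the terms below j is smaller than D j, hence it is the remainder modulo D
    j. *)
Lemma dig_unique k (b : nat -> nat) : (forall l, (l < k)%N -> (b l < D l.+1 %/ D l)%N) ->
  forall l, (l <= k)%N -> dig k (\sum_(l < k.+1) b l * D l) l = b l.
Proof.
move=> hb.
have small j : (j <= k)%N -> (\sum_(l < j) b l * D l < D j)%N.
  elim: j => [|j IH] jk; first by rewrite big_ord0 D0.
  rewrite big_ord_recr /=; have := IH (ltnW jk); have := hb j jk.
  have /dvdnP[q ->] := D_dvd j; rewrite mulnK // => h1 h2.
  apply: (@leq_trans ((b j).+1 * D j)); first by rewrite mulSn ltn_add2r.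
  by rewrite leq_mul2r h1 orbT.
have step j : (j <= k)%N -> ((\sum_(l < k.+1) b l * D l) %% D j = \sum_(l < j) b l * D l)%N.
  move=> jk; have [m ->] : exists m, k.+1 = (j + m)%N by exists (k.+1 - j)%N; lia.
  rewrite big_split_ord /= addnC.
  have /dvdnP[v ->] : (D j %| \sum_(i < m) b (j + i) * D (j + i))%N.
    by apply: dvdn_sum => i _; apply: dvdn_mull; apply: D_dvd_le; exact: leq_addr.
  by rewrite modnMDl modn_small // small.
move=> l lk; rewrite /dig; case: eqP => [->|/eqP lk'].
  by rewrite big_ord_recr /= addnC divnMDl // divn_small ?addn0 // small.
have lk2 : (l < k)%N by rewrite ltn_neqAle lk' lk.
by rewrite step // big_ord_recr /= addnC divnMDl // divn_small ?addn0 // small.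
Qed.

End MixedRadix.

Lemma big_divn (V : nmodType) (D i N : nat) (G : nat -> V) : (0 < D)%N ->
  \sum_(n < N | (n %/ D == i)%N) G n =
  \sum_(r < D) (if (i * D + r < N)%N then G (i * D + r)%N else 0).
Proof.
move=> D0; pose F n := if (n %/ D == i)%N && (n < N)%N then G n else 0.
transitivity (\sum_(n < i * D + (D + N)) F n).
  rewrite addnC -addnA [in RHS]addnC -addnA big_split_ord /=.
  rewrite [X in _ = _ + X]big1 ?addr0 => [|n _]; last first.
    by rewrite /F ifF // ltnNge leq_addr andbF.
  by rewrite big_mkcond /=; apply: eq_bigr => n _; rewrite /F ltn_ord andbT.
rewrite big_split_ord /= big1 ?add0r => [|n _]; last first.
  by rewrite /F ifF // ltn_eqF // ltn_divLR.
rewrite big_split_ord /= [X in _ + X]big1 ?addr0 => [|n _]; last first.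
  rewrite /F ifF //; apply/negbTE; rewrite negb_and neq_ltn.
  by rewrite divnMDl // divnDl ?divnn ?D0 // ltnNge leq_addr /= addnA addn1 ltn_addr // ltnS leq_addr.
apply: eq_bigr => r _; rewrite /F divnMDl // divn_small ?addn0 ?eqxx //=.
Qed.

(** * Leading terms at one level *)

Definition monic_size (R : nzRingType) (p : {poly R}) (n : nat) :=
  p \is monic /\ size p = n.+1.

Lemma monic_size_prod (R : nzRingType) n (p : 'I_n -> {poly R}) (m : 'I_n -> nat) :
  (forall l, monic_size (p l) (m l)) -> monic_size (\prod_l p l) (\sum_l m l)%N.
Proof.
move=> h; elim: n p m h => [|n IH] p m h.
  by rewrite !big_ord0; split; [apply: monic1 | apply: size_poly1].
rewrite !big_ord_recl; have [m1 s1] := h ord0.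
have [//|m2 s2] := IH (fun i => p (lift ord0 i)) (fun i => m (lift ord0 i)).
by split; [rewrite monicMl | rewrite size_Mmonic ?monic_neq0 // s1 s2 addnS].
Qed.

Lemma monic_size_exp (R : nzRingType) (p : {poly R}) m n :
  monic_size p m -> monic_size (p ^+ n) (n * m).
Proof.
move=> h; have := @monic_size_prod R n (fun _ => p) (fun _ => m) (fun _ => h).
by rewrite prodr_const sum_nat_const card_ord.
Qed.

Section TriangularBasis.
Variables (R : comNzRingType) (Psi : nat -> {poly R}).
Hypothesis hPsi : forall n, monic_size (Psi n) n.

Lemma triangular_expansion N (H : {poly R}) : (size H <= N)%N ->
  exists C : nat -> R, H = \sum_(n < N) C n *: Psi n.
Proof.
elim: N H => [|N IH] H.
  by rewrite leqn0 size_poly_eq0 => /eqP ->; exists (fun _ => 0); rewrite big_ord0.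
move=> sH; have [mP sP] := hPsi N; have cP : (Psi N)`_N = 1.
  by move: mP; rewrite monicE lead_coefE sP => /eqP.
have [|C E] := IH (H - H`_N *: Psi N).
  apply/leq_sizeP => i; rewrite leq_eqVlt => /orP[/eqP <-|hi].
    by rewrite coefB coefZ cP mulr1 subrr.
  rewrite coefB coefZ (nth_default _ (leq_trans sH hi)).
  by rewrite (nth_default _ (_ : size (Psi N) <= i)%N) ?sP // mulr0 subrr.
exists (fun n => if n == N then H`_N else C n).
rewrite big_ord_recr /= eqxx -[LHS](subrK (H`_N *: Psi N)) E; congr (_ + _).
by apply: eq_bigr => n _; rewrite ltn_eqF.
Qed.

Lemma triangular_size N (C : nat -> R) : (size (\sum_(n < N) C n *: Psi n)%R <= N)%N.
Proof.
apply: (leq_trans (size_sum _ _ _)); apply/bigmax_leqP => n _.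
by apply: (leq_trans (size_scale_leq _ _)); case: (hPsi n) => _ ->.
Qed.

Lemma triangular_coef N (C : nat -> R) : (\sum_(n < N.+1) C n *: Psi n)`_N = C N.
Proof.
rewrite big_ord_recr coefD nth_default ?triangular_size // add0r coefZ.
have [mP sP] := hPsi N.
by move: mP; rewrite monicE lead_coefE sP => /eqP ->; rewrite mulr1.
Qed.

End TriangularBasis.

Section Level.
Variables (K L : fieldType) (iota : {rmorphism K -> L}).

(** This is H o pi_k for H over K: scalars are extended to L before the substitution. *)
Definition evp (f : amap L) (H : {poly fps K}) : {poly fps L} :=
  (psub f \o map_poly (fmap iota)) H.
HB.instance Definition _ f := GRing.RMorphism.copy (evp f) (psub f \o map_poly (fmap iota)).
Arguments evp : simpl never.

Lemma evpZ f c H : evp f (c *: H) = fsub (am_mu f) (am_e f) (fmap iota c) *: evp f H.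
Proof. by rewrite /evp /= map_polyZ psubZ. Qed.

Variables (D : nat -> nat) (phi : nat -> {poly fps K}).
Hypotheses (D0 : D 0 = 1%N) (D_gt0 : forall l, (0 < D l)%N)
  (D_dvd : forall l, (D l %| D l.+1)%N).

Definition Psi k n : {poly fps K} := \prod_(l < k.+1) phi l ^+ dig D k n l.
(** For B = (a, digits of n), <B,V> is e a plus this number and Lambda^B is mu^a times
    [psi_coef]. *)
Definition psi_wt k (V : nat -> nat) n : nat := (\sum_(l < k.+1) dig D k n l * V l)%N.
Definition psi_coef k (Lam : nat -> L) n : L := \prod_(l < k.+1) Lam l ^+ dig D k n l.

Definition adm e W w := (W <= w)%N && (e %| w - W)%N.

(** The coefficient of x^w in c(mu x^e) u x^W. With W, u and c taken from the index n it is f_B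
    Lambda^B for the only B of y-degree n with <B,V> = w, and 0 if there is none. *)
Definition cterm (f : amap L) (W : nat) (u : L) (w : nat) (c : fps K) : L :=
  if adm (am_e f) W w
  then iota (fc c ((w - W) %/ am_e f)) * am_mu f ^+ ((w - W) %/ am_e f) * u else 0.

Lemma fc_fsub_mon f W u w c : (0 < am_e f)%N ->
  fc (fsub (am_mu f) (am_e f) (fmap iota c) * (fpsC u * xp ^+ W)) w = cterm f W u w c.
Proof.
move=> e0; rewrite mulrCA fcCM mulrC [fsub _ _ _ * _]mulrC fcxpM /cterm /adm.
case: leqP => h; last by rewrite mul0r.
rewrite fcsub // andTb; case: ifP => _; last by rewrite mul0r.
by rewrite [fc (fmap _ _) _]/=; ring.
Qed.

(** The invariant on which leading terms rest. At level 0 the factor A of [lv_val] is constant,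
    which makes up for weights with [al] = 0. In [lv_free] a series with all coefficients equal to
    [g r] lets [cterm] read [g r] at whatever exponent w requires. *)
Record level (k : nat) (f : amap L) (S : L -> Prop) (V : nat -> nat) (Lam : nat -> L) : Prop :=
  Level {
  lv_e : (0 < am_e f)%N;
  lv_mu : am_mu f != 0;
  lv_muS : S (am_mu f);
  lv_S : subfld S;
  lv_iota : forall a, S (iota a);
  lv_phi : forall l, (l <= k)%N -> monic_size (phi l) (D l);
  lv_Lam : forall l, (l <= k)%N -> Lam l != 0 /\ S (Lam l);
  lv_val : forall l, (l <= k)%N -> exists A : {poly fps L},
    [/\ evp f (phi l) = xp ^+ V l *: ('X^(l == k) * A), fc A`_0 0 = Lam l &
        (k = 0%N -> A = (fpsC (Lam l))%:P)];
  (* Linear independence over K of the values Lambda^B with b_k = 0 and <B,V> = w. *)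
  lv_free : forall w (g : nat -> K),
    \sum_(r < D k) cterm f (psi_wt k V r) (psi_coef k Lam r) w (Fps (fun=> g r)) = 0 ->
    forall r, (r < D k)%N -> adm (am_e f) (psi_wt k V r) w -> g r = 0 }.

Variables (k : nat) (f : amap L) (S : L -> Prop) (V : nat -> nat) (Lam : nat -> L).
Hypothesis lv : level k f S V Lam.

Let e := am_e f.
Let mu := am_mu f.
Let W n := psi_wt k V n.
Let Lm n := psi_coef k Lam n.

Lemma monic_size_Psi n : monic_size (Psi k n) n.
Proof.
rewrite -[X in monic_size _ X](dig_sum D0 D_dvd k n); apply: monic_size_prod => l.
by apply: monic_size_exp; apply: (lv_phi lv); rewrite -ltnS.
Qed.

Lemma psi_wt_shift i r : (r < D k)%N -> W (i * D k + r) = (i * V k + W r)%N.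
Proof.
move=> rk; rewrite /W /psi_wt !big_ord_recr /= !dig_top divnMDl // divn_small // mul0n !addn0.
rewrite addnC; congr (_ + _)%N; apply: eq_bigr => l _.
by rewrite dig_add ?(ltnW (ltn_ord l)) // ltn_eqF.
Qed.

Lemma psi_coef_shift i r : (r < D k)%N -> Lm (i * D k + r) = Lam k ^+ i * Lm r.
Proof.
move=> rk; rewrite /Lm /psi_coef !big_ord_recr /= !dig_top divnMDl // divn_small // addn0 expr0 mulr1.
rewrite mulrC; congr (_ * _); apply: eq_bigr => l _.
by rewrite dig_add ?(ltnW (ltn_ord l)) // ltn_eqF.
Qed.

Lemma psi_coefS n : S (Lm n).
Proof.
apply: (subfld_prod (lv_S lv)) => l _; apply: (subfldX (lv_S lv)).
by have [|] := lv_Lam lv (l := l); rewrite // -ltnS.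
Qed.

Lemma ctermS n w c : S (cterm f (W n) (Lm n) w c).
Proof.
rewrite /cterm; case: ifP => _; last exact: (subfld0 (lv_S lv)).
apply: (subfldM (lv_S lv)); last exact: psi_coefS.
by apply: (subfldM (lv_S lv)); [apply: (lv_iota lv) | apply: (subfldX (lv_S lv)); apply: (lv_muS lv)].
Qed.

Lemma adm_shift i W' w : (i * V k <= w)%N ->
  adm e (i * V k + W') w = adm e W' (w - i * V k).
Proof. by move=> h; rewrite /adm leq_subRL // subnDA. Qed.

(** Writing n = i D_k + r splits off Lambda_k^i and shifts the weights by i V_k, which reduces the
    row b_k = i to the row 0 of [lv_free]. *)
Lemma free_row i w N (C : nat -> fps K) :
  \sum_(n < N | (n %/ D k == i)%N) cterm f (W n) (Lm n) w (C n) = 0 ->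
  forall n, (n < N)%N -> (n %/ D k = i)%N -> adm e (W n) w -> fc (C n) ((w - W n) %/ e) = 0.
Proof.
rewrite (big_divn i N (fun n => cterm f (W n) (Lm n) w (C n))) // => hs n nN ni ad.
have nE : n = (i * D k + n %% D k)%N by rewrite -ni -divn_eq.
have rn : (n %% D k < D k)%N by rewrite ltn_mod.
have iw : (i * V k <= w)%N.
  by case/andP: ad; rewrite nE psi_wt_shift // => h _; apply: leq_trans h; apply: leq_addr.
pose g r := if (i * D k + r < N)%N
  then fc (C (i * D k + r)%N) ((w - W (i * D k + r)) %/ e) else 0.
have hg := lv_free lv (w := (w - i * V k)%N) (g := g).
rewrite -(_ : g (n %% D k)%N = fc (C n) ((w - W n) %/ e)); last by rewrite /g -nE nN.
apply: hg => //; last by rewrite -adm_shift // -psi_wt_shift // -nE.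
have : Lam k ^+ i * \sum_(r < D k)
    cterm f (psi_wt k V r) (psi_coef k Lam r) (w - i * V k) (Fps (fun=> g r)) = 0.
  rewrite -[RHS]hs mulr_sumr; apply: eq_bigr => r _.
  rewrite /cterm -/e -/(W r) -/(Lm r) psi_wt_shift // psi_coef_shift // adm_shift // subnDA /= /g.
  case: ifP => ar; last by rewrite mulr0 if_same.
  case: ifP => _; last by rewrite rmorph0 !mul0r mulr0.
  by rewrite psi_wt_shift // subnDA; ring.
move/eqP; rewrite mulf_eq0 expf_eq0 => /orP[/andP[_ /eqP Lk]|/eqP //].
by case: (lv_Lam lv (leqnn k)) => /eqP.
Qed.

Section Weights.
Variables al be : nat.
Hypothesis hal : (0 < al)%N \/ k = 0%N.
Hypothesis be_gt0 : (0 < be)%N.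

(** When [al] and [be] are positive, every term of A other than its constant is strictly heavier; at
    level 0, A has no other term. *)
Lemma lead_phi l : (l <= k)%N -> leads al be (Lam l) (V l) (l == k) (evp f (phi l)).
Proof.
move=> lk; have [A [-> A0 Ac]] := lv_val lv lk.
have -> : xp ^+ V l *: ('X^(l == k) * A) = mon 1 (V l) (l == k) * A.
  by rewrite /mon rmorph1 mul1r scalerAl.
rewrite -[Lam l]mul1r -[V l in X in leads _ _ _ X]addn0 -[nat_of_bool _ in X in leads _ _ _ _ X]addn0.
apply: leadsM; first by rewrite /leads subrr; apply: weight_ge0.
have monE : mon (Lam l) 0 0 = (fpsC (Lam l))%:P.
  by rewrite /mon !expr0 mulr1 alg_polyC.
rewrite /leads monE; case: hal => [al0|k0]; last by rewrite (Ac k0) subrr; apply: weight_ge0.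
move=> i j; rewrite !muln0 addn0 coefB fcB coefC.
case: i => [|i] /=; last by rewrite mulnS; lia.
case: j => [|j]; last by rewrite mulnS; lia.
by rewrite A0 /= /sconst /= subrr eqxx.
Qed.

Lemma lead_Psi n : leads al be (Lm n) (W n) (n %/ D k) (evp f (Psi k n)).
Proof.
rewrite /Psi rmorph_prod.
have -> : (n %/ D k = \sum_(l < k.+1) dig D k n l * (l == k :> nat))%N.
  rewrite big_ord_recr /= eqxx muln1 dig_top big1 // => l _.
  by rewrite ltn_eqF // muln0.
apply: leads_prod => l; rewrite rmorphXn /=; apply: leadsX; apply: lead_phi.
by rewrite -ltnS.
Qed.

Let wtn n a : nat := (al * (n %/ D k) + be * (e * a + W n))%N.

(** On the line of the lower bound c only the leading terms of the Psi_n appear, and those at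
    abscissa i have b_k = i. *)
Lemma lead_coef_sum N (C : nat -> fps K) c i w :
  (forall n a, (n < N)%N -> fc (C n) a != 0 -> (c <= wtn n a)%N) ->
  (al * i + be * w = c)%N ->
  fc (evp f (\sum_(n < N) C n *: Psi k n))`_i w =
  \sum_(n < N | (n %/ D k == i)%N) cterm f (W n) (Lm n) w (C n).
Proof.
move=> hC hc; rewrite rmorph_sum coef_sum fc_sum [RHS]big_mkcond /=.
apply: eq_bigr => n _; rewrite evpZ -/e -/mu; have e0 := lv_e lv.
set s := fsub _ _ _; set c0 := (al * (n %/ D k) + be * W n)%N.
pose M := mon (Lm n) (W n) (n %/ D k).
rewrite -[evp f _](subrK M) scalerDr coefD fcD.
(* If c0 > c, the truncated difference is 0 and the weight c0 + 1 of the error in Psi_n already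
   exceeds c. *)
have sI : weight_ge al be (c - c0) s%:P.
  move=> i' j; rewrite coefC; case: (i' =P 0%N) => [->|_]; last by rewrite fc0 eqxx.
  rewrite muln0 add0n /s fcsub //; case: ifP => [/dvdnP[a ->]|]; last by rewrite eqxx.
  rewrite mulnK // mulf_eq0 negb_or => /andP[_]; rewrite /= fmorph_eq0 => h.
  by have := hC n a (ltn_ord n) h; rewrite /wtn /c0; lia.
have := weight_geM sI (@lead_Psi n); rewrite mul_polyC -/M -/c0 => hI.
have -> : fc (s *: (evp f (Psi k n) - M))`_i w = 0.
  by apply/eqP/contraT => /hI; rewrite hc; lia.
rewrite add0r coefZ coefZ coefXn; case: (i =P _) => [->|/eqP ni]; last first.
  by rewrite ifF ?mulr0 // eq_sym; apply/negbTE.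
by rewrite eqxx mulr1 fc_fsub_mon.
Qed.

(** Leading terms do not cancel. By induction on c, the terms of weight exactly c in one row sum to
    a coefficient that is 0, so [free_row] makes each of them vanish. *)
Lemma lead_bound N (C : nat -> fps K) c :
  weight_ge al be c (evp f (\sum_(n < N) C n *: Psi k n)) ->
  forall n a, (n < N)%N -> fc (C n) a != 0 -> (c <= wtn n a)%N.
Proof.
elim: c => [//|c IH] hI n a nN Ca.
have hb := IH (weight_ge_le (leqnSn c) hI).
have := hb n a nN Ca; rewrite leq_eqVlt => /orP[/eqP cE|//]; exfalso.
have h0 : fc (evp f (\sum_(n < N) C n *: Psi k n))`_(n %/ D k) (e * a + W n) = 0.
  by apply/eqP/contraT => /hI; rewrite cE ltnn.
rewrite (lead_coef_sum hb) // in h0.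
have e0 := lv_e lv.
have := free_row h0 nN (erefl _); rewrite /adm leq_addl addnK dvdn_mulr // => /(_ isT).
by rewrite mulKn // => /eqP; rewrite (negPf Ca).
Qed.

End Weights.

(** The zero polynomial satisfies every lower bound on weights, so by [lead_bound] no C_n has a
    nonzero coefficient. *)
Lemma evp_eq0 H : evp f H = 0 -> H = 0.
Proof.
have [C ->] := triangular_expansion monic_size_Psi (leqnn (size H)) => h0.
rewrite big1 // => n _; suff -> : C n = 0 by rewrite scale0r.
apply: fpsP => a; apply/eqP/contraT => Ca.
have := @lead_bound 1 1 (or_introl isT) isT (size H) C
  (1 * (n %/ D k) + 1 * (e * a + W n)).+1 _ n a (ltn_ord n) Ca.
by rewrite ltnn; apply; rewrite h0; apply: weight_ge0.
Qed.

End Level.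

(** * From one level to the next *)

Section Blowup.
Variables (L : fieldType) (q m t : nat) (z zs : L) (cs : ser L).
Hypotheses (q_gt0 : (0 < q)%N) (cs0 : cs 0%N = 0).

(** This is [sigma] with z^s abstracted to an element zs; the relation zs^q = z^(1 + t m) will stand
    in for s. *)
Definition sig : amap L := AMap (z ^+ t) q 1 m (sscale zs (sX L m)).
Definition rho (H : {poly fps L}) := psub (tau cs) (psub sig H).
(** The image of y under [rho], divided by x^m. *)
Definition Yrho : {poly fps L} := 'X + (fpsC zs + Fps cs)%:P.

Lemma rhoM A B : rho (A * B) = rho A * rho B.
Proof. by rewrite /rho (rmorphM (psub sig)) (rmorphM (psub (tau cs))). Qed.

Lemma rhoC s : rho s%:P = (fsub (z ^+ t) q s)%:P.
Proof. by rewrite /rho !psubC /= fsub1. Qed.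

Lemma rhoZ s A : rho (s *: A) = fsub (z ^+ t) q s *: rho A.
Proof. by rewrite -mul_polyC rhoM rhoC mul_polyC. Qed.

Lemma rhoX : rho 'X = xp ^+ m *: Yrho.
Proof.
rewrite /rho psubX /aff /= (rmorphD (psub (tau cs))) /= psubZ psubX psubC /= !fsub1.
rewrite /aff /= sscaleE -xpE !rmorph1 expr0 mulr1 mul1r scale1r /Yrho.
rewrite -mul_polyC -[in RHS]mul_polyC [fpsC zs * _]mulrC.
by rewrite [in RHS]polyCD [X in _ + X]polyCM; ring.
Qed.

Lemma rhoXn n : rho ('X^n) = (xp ^+ m *: Yrho) ^+ n.
Proof.
elim: n => [|n IH]; last by rewrite !exprS rhoM IH rhoX.
by rewrite /rho !expr0 (rmorph1 (psub sig)) (rmorph1 (psub (tau cs))).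
Qed.

Lemma rho_sum H :
  rho H = \sum_(i < size H) (fsub (z ^+ t) q H`_i * xp ^+ (m * i)) *: Yrho ^+ i.
Proof.
rewrite -[in LHS](coefK H) poly_def /rho (rmorph_sum (psub sig)) /=.
rewrite (rmorph_sum (psub (tau cs))) /=; apply: eq_bigr => i _.
by rewrite -/(rho _) rhoZ rhoXn exprZn scalerA exprM.
Qed.

Lemma map_ev0_Yrho : map_poly (@ev0 L) Yrho = 'X + zs%:P.
Proof.
rewrite /Yrho rmorphD /= map_polyX map_polyC /=; congr (_ + _%:P).
by rewrite /ev0 /= /sadd /sconst eqxx cs0 addr0.
Qed.

(** The monomial x^j y^i acquires x^(q j + m i), so x^c divides the image. At x = 0 only the points
    of the line m i + q j = c survive, and the shift by cs disappears. *)
Lemma rho_lead c H : weight_ge m q c H -> exists A, rho H = xp ^+ c *: A /\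
  map_poly (@ev0 L) A = \sum_(i < size H)
    edge_term z q m t (fun i => fc H`_i ((c - m * i) %/ q)) c i *: ('X + zs%:P) ^+ i.
Proof.
move=> hI; pose s i := fsub (z ^+ t) q H`_i * xp ^+ (m * i).
pose s' i := Fps (fun j => fc (s i) (c + j)).
have sE i : s i = xp ^+ c * s' i.
  apply: xp_div => j jc; rewrite /s mulrC fcxpM; case: leqP => // h.
  rewrite fcsub //; case: ifP => [/dvdnP[a ha]|//].
  rewrite ha mulnK //; apply/eqP; rewrite mulf_eq0; apply/orP; right.
  by apply/contraT => /hI; lia.
exists (\sum_(i < size H) s' i *: Yrho ^+ i); split.
  by rewrite rho_sum scaler_sumr; apply: eq_bigr => i _; rewrite -/(s i) sE scalerA.
rewrite rmorph_sum; apply: eq_bigr => i _ /=.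
rewrite map_polyZ rmorphXn /= map_ev0_Yrho; congr (_ *: _).
transitivity (fc (s i) (c + 0)); first by [].
rewrite addn0 /s mulrC fcxpM /edge_term /on_edge.
case: leqP => // h; rewrite andTb fcsub //; case: ifP => // _.
by rewrite -exprM mulrC.
Qed.

(** For m > 0 the image of y vanishes at x = 0; otherwise A is assumed free of y. *)
Lemma coef0_rho (A : {poly fps L}) : (0 < m)%N \/ A = (A`_0)%:P -> fc (rho A)`_0 0 = fc A`_0 0.
Proof.
case=> [m0|->]; last by rewrite rhoC !coefC eqxx -/(ev0 _) ev0_fsub.
rewrite rho_sum coef_sum fc_sum; case sA : (size A) => [|n].
  by rewrite big_ord0 nth_default ?sA.
rewrite big_ord_recl /= big1 ?addr0 => [|i _].
  by rewrite muln0 !expr0 mulr1 coefZ coef1 mulr1 -/(ev0 _) ev0_fsub.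
rewrite coefZ mulrAC mulrC fcxpM ifF // leqn0 muln_eq0 /bump /=.
by rewrite orbF; apply/negbTE; rewrite -lt0n.
Qed.

End Blowup.

Section Step.
Variables (K L : fieldType) (iota : {rmorphism K -> L}).
Variables (D : nat -> nat) (phi : nat -> {poly fps K}).
Hypotheses (D0 : D 0 = 1%N) (D_gt0 : forall l, (0 < D l)%N)
  (D_dvd : forall l, (D l %| D l.+1)%N).
Variables (k : nat) (f : amap L) (S : L -> Prop) (V : nat -> nat) (Lam : nat -> L).
Hypothesis lv : level iota D phi k f S V Lam.
Variables (q m t : nat) (z zs : L) (P : {poly L}) (cs : ser L).
Let l := (size P).-1.
Hypotheses (q_gt0 : (0 < q)%N) (cop : coprime q m) (z0 : z != 0)
  (zsq : zs ^+ q = z * z ^+ (t * m))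
  (SP : poly_over S P) (irrP : irr_over S P) (rP : root P z)
  (DS : D k.+1 = (D k * (q * l))%N) (hm : (0 < m)%N \/ k = 0%N)
  (cs0 : cs 0%N = 0) (q0 : (q%:R : L) != 0) (l0 : (l%:R : L) != 0).
Let S' := adjoin S z.
Hypothesis (S'zs : S' zs).

Let HS := lv_S lv.
Let HS' : subfld S' := adjoin_subfld HS SP irrP rP.
Let e0 := lv_e lv.
Let rh := rho q m t z zs cs.

Definition next_map : amap L := acomp (acomp f (sig q m t z zs)) (tau cs).

Lemma evp_next_map H : evp iota next_map H = rh (evp iota f H).
Proof.
by rewrite /evp /= /next_map !psub_acomp //= ?muln_gt0 ?e0.
Qed.

Let zs0 : zs != 0.
Proof.
apply/eqP => h; move: zsq; rewrite h expr0n eqn0Ngt q_gt0 /= => /esym/eqP.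
by rewrite mulf_eq0 (negPf z0) expf_eq0 (negPf z0) andbF.
Qed.

(** Vanishing on the new parametrization makes zs a root of the edge polynomial. By [edge_top] the
    edge then reaches abscissa q l, which forces the full degree D_(k+1), and the root is simple,
    which leaves exactly one factor y at x = 0. *)
Lemma kernel_lead (H : {poly fps K}) : H != 0 -> (size H <= (D k.+1).+1)%N ->
  (evp iota next_map H)`_0 = 0 ->
  size H = (D k.+1).+1 /\
  exists c A, evp iota next_map H = xp ^+ c *: ('X * A) /\ fc A`_0 0 != 0 /\ S' (fc A`_0 0).
Proof.
move=> H0 sH hz.
have [C HE] := triangular_expansion (monic_size_Psi D0 D_dvd lv) (leqnn (size H)).
set G := evp iota f H.
have G0 : G != 0 by apply/eqP => /(evp_eq0 D0 D_gt0 D_dvd lv)/eqP; rewrite (negPf H0).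
(* Here c is the weighted order of H o pi_k: the largest lower bound for m i + q j on its support,
   attained at (i0, w0). *)
have [c [hI [i0 [w0 [G0c c0]]]]] : exists c, weight_ge m q c G /\
   exists i w, fc G`_i w != 0 /\ (m * i + q * w = c)%N.
  have [i [j gij]] : exists i j, fc G`_i j != 0.
    apply: contrapT => h; case/eqP: G0; apply/polyP => i; apply: fpsP => j.
    by rewrite coef0 fc0; apply/eqP/contraT => gij; case: h; exists i, j.
  pose Q c := `[< weight_ge m q c G >].
  have exQ : exists c, Q c by exists 0%N; apply/asboolP.
  have bQ c : Q c -> (c <= m * i + q * j)%N by move=> /asboolP /(_ _ _ gij).
  case: (ex_maxnP exQ bQ) => c /asboolP hI hmax; exists c; split=> //.
  apply: contrapT => h; suff /hmax : Q c.+1 by rewrite ltnn.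
  apply/asboolP => i' j' g'; rewrite ltn_neqAle hI // andbT.
  by apply/eqP => E; case: h; exists i', j'.
have hb : forall n a, (n < size H)%N -> fc (C n) a != 0 ->
    (c <= m * (n %/ D k) + q * (am_e f * a + psi_wt D k V n))%N.
  by apply: (lead_bound D0 D_gt0 D_dvd lv hm q_gt0); rewrite -HE.
have hco i w : (m * i + q * w = c)%N -> fc G`_i w =
    \sum_(n < size H | (n %/ D k == i)%N) cterm iota f (psi_wt D k V n) (psi_coef D k Lam n) w (C n).
  by move=> hc; rewrite /G [in LHS]HE (lead_coef_sum D0 lv hm q_gt0 hb hc).
pose E i := fc G`_i ((c - m * i) %/ q).
have edw i : on_edge q m c i -> (m * i + q * ((c - m * i) %/ q) = c)%N.
  by case/andP => h1 h2; rewrite [(q * _)%N]mulnC divnK // subnKC.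
have SE i : on_edge q m c i -> S (E i).
  by move=> /edw h; rewrite /E hco //; apply: (subfld_sum HS) => n _; apply: (ctermS lv).
(* A nonzero coefficient at abscissa i requires some n < size H with n / D_k = i. *)
have small i : (size H <= D k * i)%N -> on_edge q m c i -> E i = 0.
  move=> hi /edw h; rewrite /E hco // big1 // => n /eqP ni.
  by have := ltn_ord n; have := leq_trunc_div n (D k); rewrite ni; lia.
have Ebig i : (q * l < i)%N -> on_edge q m c i -> E i = 0.
  move=> hi; apply: small; apply: leq_trans sH _; rewrite DS.
  by rewrite ltn_pmul2l.
have [A [rA evA]] := rho_lead t z zs q_gt0 cs0 hI.
rewrite -/E in evA.
have A00 : A`_0 = 0.
  move: hz; rewrite evp_next_map /rh rA coefZ => h; apply: fpsP => j.
  by rewrite fc0 -(fcxpMD c) h.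
pose T i := edge_term z q m t E c i.
have sumT (n : nat -> L) :
    \sum_(i < size G) T i * n i = \sum_(i < (q * l).+1) T i * n i.
  have T0 i : (size G <= i)%N -> T i = 0.
    by move=> h; rewrite /T /edge_term /E nth_default // fc0 mul0r if_same.
  have T1 i : (q * l < i)%N -> T i = 0.
    by move=> h; rewrite /T /edge_term; case: ifP => // /(Ebig _ h) ->; rewrite mul0r.
  rewrite (big_ord_widen (maxn (size G) (q * l).+1) (fun i => T i * n i)) ?leq_maxl //.
  rewrite [RHS](big_ord_widen (maxn (size G) (q * l).+1) (fun i => T i * n i)) ?leq_maxr //.
  rewrite big_mkcond [RHS]big_mkcond; apply: eq_bigr => i _.
  case: ltnP => h1; case: ltnP => h2 //; first by rewrite T1 // mul0r.
  by rewrite T0 // mul0r.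
have YE i j : (('X + zs%:P) ^+ i)`_j = 'C(i, j)%:R * zs ^+ (i - j).
  by have := coef_affX 1 zs i j; rewrite scale1r expr1n mulr1.
have c0A : \sum_(i < (q * l).+1) T i * zs ^+ i = 0.
  rewrite -(sumT (fun i => zs ^+ i)); transitivity ((map_poly (@ev0 L) A)`_0).
    by rewrite evA coef_sum; apply: eq_bigr => i _; rewrite coefZ YE bin0 mul1r subn0.
  by rewrite coef_map A00.
have exE : exists i, on_edge q m c i /\ E i != 0.
  exists i0; rewrite /on_edge /E -c0 addKn leq_addr dvdn_mulr // mulKn //.
have [ed [Eql hder]] := edge_top HS SP irrP rP q_gt0 cop z0 zsq SE Ebig exE c0A.
split.
  apply/eqP; rewrite eqn_leq sH ltnNge; apply/negP => h.
  by move/eqP: Eql; apply; apply: small; rewrite // -DS.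
pose A' : {poly fps L} := \poly_(i < size A) A`_i.+1.
have AE : A = 'X * A'.
  apply/polyP => i; rewrite coefXM; case: i => [|i] //=.
  rewrite coef_poly; case: ltnP => // h; rewrite nth_default //; exact: leq_trans h (leqnSn i).
exists c, A'; rewrite evp_next_map /rh rA -AE; split=> //.
(* The coefficient of y in a polynomial in y + zs is its derivative at zs; [edge_top] speaks of this
   derivative times zs. *)
have -> : fc A'`_0 0 = \sum_(i < (q * l).+1) T i * (i%:R * zs ^+ i.-1).
  transitivity ((map_poly (@ev0 L) A)`_1).
    by rewrite coef_map AE coefXM.
  rewrite evA coef_sum -(sumT (fun i => i%:R * zs ^+ i.-1)) //.
  by apply: eq_bigr => i _; rewrite coefZ YE bin1 subn1.
split.
  apply: contraNneq (hder q0 l0) => h; apply/eqP.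
  transitivity ((\sum_(i < (q * l).+1) T i * (i%:R * zs ^+ i.-1)) * zs); last by rewrite h mul0r.
  rewrite mulr_suml; apply: eq_bigr => i _; rewrite -/(T i); case: (nat_of_ord i) => [|j].
    by rewrite !mul0r mulr0 mul0r.
  by rewrite exprSr; ring.
apply: (subfld_sum HS') => i _; apply: (subfldM HS').
  rewrite /T /edge_term; case: ifP => h; last exact: (subfld0 HS').
  apply: (subfldM HS'); first by apply: (sub_adjoin HS); apply: SE.
  by apply: (subfldX HS'); apply: (adjoin_gen HS).
by apply: (subfldM HS'); [apply: (subfld_nat HS') | apply: (subfldX HS')].
Qed.

(** The new value of phi_i is q V_i, plus m for the factor y of phi_k. The value v of phi_(k+1) does
    not enter, its digit being 0 for r < D_(k+1). *)
Lemma psi_wt_next v r : (r < D k.+1)%N ->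
  psi_wt D k.+1 (fun i => if (i <= k)%N then (q * V i + m * (i == k))%N else v) r =
  (q * psi_wt D k V r + m * (r %/ D k))%N.
Proof.
move=> hr; rewrite /psi_wt big_ord_recr /= dig_top divn_small // mul0n addn0.
rewrite -[in RHS](dig_top D) big_distrr /=.
have -> : (m * dig D k r k = \sum_(i < k.+1) m * (dig D k r i * (i == k :> nat)))%N.
  rewrite big_ord_recr /= eqxx muln1 big1 // => i _.
  by rewrite ltn_eqF // muln0 muln0.
rewrite -big_split /=; apply: eq_bigr => i _.
have ik : (i <= k)%N by rewrite -ltnS.
by rewrite ik dig_small // mulnDr mulnCA [(_ * (m * _))%N]mulnCA.
Qed.

Lemma psi_coef_next u r : (r < D k.+1)%N ->
  psi_coef D k.+1 (fun i => if (i <= k)%N then Lam i * z ^+ (t * V i) * zs ^+ (i == k) else u) r =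
  psi_coef D k Lam r * z ^+ (t * psi_wt D k V r) * zs ^+ (r %/ D k).
Proof.
move=> hr; rewrite /psi_coef big_ord_recr /= dig_top divn_small // expr0 mulr1.
have -> : zs ^+ (r %/ D k) = \prod_(i < k.+1) zs ^+ ((i == k :> nat) * dig D k r i).
  rewrite big_ord_recr /= eqxx mul1n dig_top big1 ?mul1r // => i _.
  by rewrite ltn_eqF // mul0n expr0.
have -> : z ^+ (t * psi_wt D k V r) = \prod_(i < k.+1) z ^+ (t * V i * dig D k r i).
  rewrite /psi_wt big_distrr /= expr_sum; apply: eq_bigr => i _.
  by rewrite [(dig _ _ _ _ * _)%N]mulnC mulnA.
rewrite -!big_split /=; apply: eq_bigr => i _.
have ik : (i <= k)%N by rewrite -ltnS.
by rewrite ik dig_small // !exprMn -!exprM.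
Qed.

Lemma adm_next W0 b w : adm (am_e f * q) (q * W0 + m * b) w =
    on_edge q m w b && adm (am_e f) W0 ((w - m * b) %/ q).
Proof.
have sub : on_edge q m w b ->
    (((w - m * b) %/ q - W0) * q = w - (q * W0 + m * b))%N.
  by case/andP => h1 h2; rewrite mulnBl divnK // [(W0 * q)%N]mulnC addnC subnDA.
have le : on_edge q m w b -> (W0 <= (w - m * b) %/ q)%N = (q * W0 + m * b <= w)%N.
  by case/andP => h1 h2; rewrite leq_divRL // mulnC leq_subRL // addnC.
rewrite /adm; apply/andP/andP => [[h1 h2]|[ed /andP[h3 h4]]]; last first.
  by rewrite -le // h3 -sub // dvdn_pmul2r.
have ed : on_edge q m w b.
  have hb : (m * b <= w)%N by apply: leq_trans h1; apply: leq_addl.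
  have E : (w - m * b = q * W0 + (w - (q * W0 + m * b)))%N by lia.
  rewrite /on_edge hb E dvdn_addr ?dvdn_mulr //; apply: dvdn_trans h2; exact: dvdn_mull.
by split=> //; rewrite le // h1 -(@dvdn_pmul2r q) // sub.
Qed.

(** A term of level k+1 is a term of level k turned into an edge term of abscissa b; relations at
    level k+1 thereby become edge sums. *)
Lemma cterm_next W0 u b g w : cterm iota next_map (q * W0 + m * b)
     (u * z ^+ (t * W0) * zs ^+ b) w g =
   (if on_edge q m w b then cterm iota f W0 u ((w - m * b) %/ q) g *
        z ^+ (t * ((w - m * b) %/ q)) else 0) * zs ^+ b.
Proof.
rewrite /cterm /= muln1 expr1n mulr1 adm_next.
case: (boolP (on_edge q m w b)) => [/andP[h1 h2]|_]; last by rewrite mul0r.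
case: (boolP (adm _ _ _)) => [/andP[h3 h4]|_]; last by rewrite !mul0r.
rewrite /=.
have -> : ((w - (q * W0 + m * b)) %/ (am_e f * q) =
   ((w - m * b) %/ q - W0) %/ am_e f)%N.
  have -> : (w - (q * W0 + m * b) = ((w - m * b) %/ q - W0) * q)%N.
    by rewrite mulnBl divnK // [(W0 * q)%N]mulnC addnC subnDA.
  by rewrite divnMr.
set a := (_ %/ am_e f)%N.
have -> : z ^+ (t * ((w - m * b) %/ q)) = z ^+ (t * W0) * (z ^+ t ^+ am_e f) ^+ a.
  rewrite -!exprM -exprD; congr (_ ^+ _).
  by rewrite -mulnDr [(am_e f * a)%N]mulnC divnK // subnKC.
by rewrite exprMn; ring.
Qed.

Lemma step_level : monic_size (phi k.+1) (D k.+1) -> (evp iota next_map (phi k.+1))`_0 = 0 ->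
  exists V' Lam', level iota D phi k.+1 next_map S' V' Lam'.
Proof.
move=> mphi hz; have [mo sz] := mphi.
have [|_ [v [A [Ev [A0 SA]]]]] := kernel_lead (monic_neq0 mo) _ hz; first by rewrite sz.
set u := fc A`_0 0 in A0 SA.
exists (fun i => if (i <= k)%N then (q * V i + m * (i == k))%N else v).
exists (fun i => if (i <= k)%N then Lam i * z ^+ (t * V i) * zs ^+ (i == k) else u).
have Sz n : S' (z ^+ n) by apply: (subfldX HS'); apply: (adjoin_gen HS).
split.
- by rewrite /= muln1 muln_gt0 e0.
- by rewrite /= expr1n mulr1 mulf_neq0 ?expf_neq0 ?(lv_mu lv).
- rewrite /= expr1n mulr1; apply: (subfldM HS'); last by apply: (subfldX HS').
  by apply: (sub_adjoin HS); apply: (lv_muS lv).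
- exact: HS'.
- by move=> a; apply: (sub_adjoin HS); apply: (lv_iota lv).
- by move=> i; rewrite leq_eqVlt => /orP[/eqP -> //|]; rewrite ltnS; apply: (lv_phi lv).
- move=> i; case: (leqP i k) => ik _; last by split.
  have [L0 SL] := lv_Lam lv ik; split.
    by rewrite !mulf_neq0 ?expf_neq0.
  apply: (subfldM HS'); last by apply: (subfldX HS').
  by apply: (subfldM HS') => //; apply: (sub_adjoin HS).
- move=> i; rewrite leq_eqVlt => /orP[/eqP ->|].
    by exists A; rewrite ltnn eqxx expr1.
  rewrite ltnS => ik; rewrite ik [i == k.+1]ltn_eqF // [nat_of_bool false]/= expr0.
  have [B [EB B0 Bc]] := lv_val lv ik.
  exists (fpsC (z ^+ (t * V i)) *: (Yrho zs cs ^+ (i == k) * rh B)); split=> //.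
    rewrite evp_next_map EB /rh rhoZ rhoM rhoXn fsub_xp // mul1r exprZn scalerA.
    by rewrite -scalerAl !scalerA -exprM exprD exprM; congr (_ *: _); rewrite -!exprM; ring.
  rewrite coefZ fcCM coef0M -/(ev0 _) rmorphM /= {2}/ev0 coef0_rho //; last first.
    case: hm => [m0|k0]; [by left | right; rewrite [LHS](Bc k0) (Bc k0) coefC].
    by [].
  rewrite B0; have -> : ev0 (Yrho zs cs ^+ (i == k))`_0 = zs ^+ (i == k).
    case: (i == k); last by rewrite !expr0 coef1 rmorph1.
    rewrite !expr1 /Yrho coefD coefX coefC eqxx add0r.
    by rewrite /ev0 /= /sadd /sconst eqxx cs0 addr0.
  by ring.
move=> w g hs r hr ad.
(* Grouped by b = n / D_k, the relation is an edge sum with coefficients E b in S. [edge_indep]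
   makes the E b on the line vanish, and [free_row] at level k separates the g n. *)
pose E b := \sum_(n < D k.+1 | (n %/ D k == b)%N)
   cterm iota f (psi_wt D k V n) (psi_coef D k Lam n) ((w - m * b) %/ q) (Fps (fun=> g n)).
have sE : \sum_(b < q * l) edge_term z q m t E w b * zs ^+ b = 0.
  rewrite -[RHS]hs; symmetry.
  transitivity (\sum_(n < D k.+1) \sum_(b < q * l | (n %/ D k == b)%N)
      (if on_edge q m w b then cterm iota f (psi_wt D k V n) (psi_coef D k Lam n) ((w - m * b) %/ q)
           (Fps (fun=> g n)) * z ^+ (t * ((w - m * b) %/ q)) else 0) * zs ^+ b).
    apply: eq_bigr => n _; rewrite psi_wt_next // psi_coef_next // cterm_next.
    have nb : (n %/ D k < q * l)%N by rewrite ltn_divLR // mulnC -DS.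
    by rewrite (big_pred1 (Ordinal nb)).
  rewrite (exchange_big_dep xpredT) //=; apply: eq_bigr => b _.
  rewrite /edge_term /E; case: (on_edge q m w b); first by rewrite !mulr_suml.
  by rewrite mul0r big1 // => n _; rewrite mul0r.
have Eb b : on_edge q m w b -> S (E b).
  by move=> _; apply: (subfld_sum HS) => n _; apply: (ctermS lv).
have rb : (r %/ D k < q * l)%N by rewrite ltn_divLR // mulnC -DS.
have /andP[W1 W2] : on_edge q m w (r %/ D k) &&
    adm (am_e f) (psi_wt D k V r) ((w - m * (r %/ D k)) %/ q).
  by rewrite -adm_next -(psi_wt_next v) //; move: ad; rewrite /= muln1.
have E0 := edge_indep HS SP irrP rP q_gt0 cop z0 zsq Eb sE rb W1.
have := free_row D_gt0 D_dvd lv (N := D k.+1) (C := fun n => Fps (fun=> g n)) E0 hr (erefl _) W2.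
by [].
Qed.

End Step.

(** * Integral equations and coefficient fields *)

Lemma big_ord_mul (V : nmodType) n e (G : nat -> V) :
  \sum_(r < n * e) G r = \sum_(a < n) \sum_(j < e) G (a * e + j)%N.
Proof.
elim: n => [|n IH]; first by rewrite !big_ord0.
by rewrite big_ord_recr /= -IH mulSnr big_split_ord.
Qed.

Lemma det_kernel (R : comNzRingType) n (N : 'M[R]_n) (g : 'I_n -> R) :
  (forall r, \sum_s N r s * g s = 0) -> forall s, \det N * g s = 0.
Proof.
move=> h s; pose v : 'cV[R]_n := \col_i g i.
have Nv : N *m v = 0.
  apply/matrixP => i j; rewrite !mxE -[RHS](h i).
  by apply: eq_bigr => a _; rewrite !mxE.
have : (\det N)%:M *m v = 0 by rewrite -mul_adj_mx -mulmxA Nv mulmx0.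
by move/matrixP/(_ s 0); rewrite mul_scalar_mx !mxE.
Qed.

Section IntegralEquation.
Variables (K L : fieldType) (iota : {rmorphism K -> L}).

Definition spans (S : L -> Prop) (n : nat) (om : nat -> L) :=
  (forall a, S (om a)) /\
  forall x, S x -> exists c : nat -> K, x = \sum_(a < n) iota (c a) * om a.

Lemma spans_base : spans (fun a => exists b, a = iota b) 1 (fun=> 1).
Proof.
split=> [_|x [b ->]]; first by exists 1; rewrite rmorph1.
by exists (fun=> b); rewrite big_ord1 mulr1.
Qed.

Lemma spans_adjoin (S : L -> Prop) n om (P : {poly L}) z : subfld S ->
  poly_over S P -> irr_over S P -> root P z -> spans S n om ->
  exists om', spans (adjoin S z) (n * (size P).-1) om'.
Proof.
move=> HS SP irrP rP [Som hs]; exists (fun r => om (r %% n)%N * z ^+ (r %/ n)).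
have HS' := adjoin_subfld HS SP irrP rP.
split=> [a|x].
  by apply: (subfldM HS'); [apply: sub_adjoin | apply: (subfldX HS'); apply: adjoin_gen].
move=> /(adjoin_reduce HS SP irrP rP)[p [Sp -> sp]].
have [c hc] := choice (fun i => hs _ (Sp i)).
exists (fun r => c (r %/ n)%N (r %% n)%N).
rewrite mulnC (big_ord_mul _ _ (fun r => iota (c (r %/ n)%N (r %% n)%N) *
  (om (r %% n)%N * z ^+ (r %/ n)))).
rewrite (@horner_coef_wide _ (size P).-1); last by move: sp; case: (size P).
apply: eq_bigr => i _; rewrite hc mulr_suml; apply: eq_bigr => a _.
have n0 : (0 < n)%N by apply: leq_ltn_trans (ltn_ord a).
by rewrite divnMDl // modnMDl divn_small // modn_small // addn0 mulrA.
Qed.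

Variables (S : L -> Prop) (HS : subfld S) (nf : nat) (om : nat -> L).
Hypothesis hspan : spans S nf om.
Variables (e : nat) (mu : L).
Hypotheses (e_gt0 : (0 < e)%N) (mu0 : mu != 0) (Smu : S mu) (Sio : forall a, S (iota a)).

Let h : {rmorphism fps K -> fps L} := (fsub mu e \o fmap iota)%FUN.
Let g r : fps L := xp ^+ (r %% e) * fpsC (om (r %/ e)%N).

(** Exponents are split as i e + j with j < e. The generators are x^j om_a, and division by mu^i
    offsets the factor that x |-> mu x^e puts on x^i. *)
Lemma span_fps (T : fps L) : (forall n, S (fc T n)) ->
  exists C : nat -> fps K, T = \sum_(r < nf * e) h (C r) * g r.
Proof.
move=> ST.
have ex n : exists c : nat -> K, fc T n / mu ^+ (n %/ e) = \sum_(a < nf) iota (c a) * om a.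
  by apply: hspan.2; apply: (subfldM HS) => //; apply: (subfldV HS); apply: subfldX.
have [c hc] := choice ex.
exists (fun r => Fps (fun i => c (i * e + r %% e)%N (r %/ e)%N)).
apply: fpsP => n; rewrite fc_sum.
have -> : fc T n = mu ^+ (n %/ e) * \sum_(a < nf) iota (c n a) * om a.
  by rewrite -hc mulrCA mulfV ?mulr1 // expf_neq0.
pose C r := Fps (fun i => c (i * e + r %% e)%N (r %/ e)%N).
rewrite (big_ord_mul _ _ (fun r => fc (h (C r) * g r) n)) mulr_sumr.
apply: eq_bigr => a _.
have val (j : 'I_e) : fc (h (C (a * e + j)%N) * g (a * e + j)%N) n =
    if (j == n %% e :> nat)%N then mu ^+ (n %/ e) * (iota (c n a) * om a) else 0.
  rewrite /g divnMDl // modnMDl divn_small // modn_small // addn0.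
  rewrite mulrCA fcxpM; case: leqP => [jn|nj]; last first.
    by case: eqP => // E; have := leq_mod n e; rewrite -E leqNgt nj.
  rewrite mulrC fcCM -[h _]/(fsub mu e (fmap iota _)) fcsub //.
  case: (boolP (e %| n - j)%N) => [/dvdnP[u E]|dv].
    have nE : n = (u * e + j)%N by rewrite -E subnK.
    have h1 : (n %% e = j)%N by rewrite nE modnMDl modn_small.
    have h2 : (n %/ e = u)%N by rewrite nE divnMDl // divn_small // addn0.
    rewrite E mulnK // h1 h2 eqxx /C /=.
    by rewrite divnMDl // modnMDl divn_small // modn_small // addn0 -nE; ring.
  case: eqP => [E|_]; last by rewrite mulr0.
  by move: dv; rewrite E {1}(divn_eq n e) addnK dvdn_mull.
rewrite (eq_bigr _ (fun j _ => val j)).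
have nr : (n %% e < e)%N by rewrite ltn_mod.
rewrite (bigD1 (Ordinal nr)) //= eqxx big1 ?addr0 // => j.
by rewrite -val_eqE /= => /negPf ->.
Qed.

(* Cayley-Hamilton: S[[x]] is generated by nf * e elements as a module over
   K[[x]], embedded by x |-> mu x^e. *)
Lemma integral_equation (T : fps L) : (forall n, S (fc T n)) ->
  exists psi : {poly fps K}, monic_size psi (nf * e) /\ (map_poly h psi).[T] = 0.
Proof.
move=> ST; have Sg r n : S (fc (T * g r) n).
  rewrite /g mulrCA fcxpM; case: leqP => _; last exact: (subfld0 HS).
  by rewrite mulrC fcCM; apply: (subfldM HS) => //; apply: hspan.1.
have ex r : exists C : nat -> fps K, (r < nf * e)%N ->
    T * g r = \sum_(s < nf * e) h (C s) * g s.
  case: (ltnP r (nf * e)) => hr; last by exists (fun=> 0).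
  by have [C hC] := span_fps (fun n => Sg r n); exists C.
have [C hC] := choice ex.
pose M : 'M[fps K]_(nf * e) := \matrix_(r, s) C r s.
exists (char_poly M); split.
  by split; [apply: char_poly_monic | apply: size_char_poly].
pose ev : {rmorphism {poly fps K} -> fps L} := (horner_eval T \o map_poly h)%FUN.
have -> : (map_poly h (char_poly M)).[T] = \det (map_mx ev (char_poly_mx M)).
  exact: (esym (det_map_mx ev _)).
have ker := @det_kernel _ _ (map_mx ev (char_poly_mx M)) (fun s => g s).
(* The determinant annihilates every generator, and 1 is a combination of generators, so it is 0. *)
have [|c1 E1] := span_fps (T := 1).
  by move=> n; rewrite fc1; apply: (subfld_nat HS).
rewrite -[LHS]mulr1 E1 mulr_sumr big1 // => s _.
rewrite mulrCA ker ?mulr0 // => r.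
transitivity (\sum_s (T * (r == s)%:R - h (C r s)) * g s).
  apply: eq_bigr => a _; rewrite !mxE /ev /= /horner_eval rmorphB /= map_polyC /=.
  by rewrite rmorphMn /= map_polyX hornerD hornerN hornerC hornerMn hornerX mulr_natr.
under eq_bigr do rewrite mulrBl.
rewrite sumrB -(hC r) // (bigD1 r) //= eqxx mulr1 big1 ?addr0 ?subrr // => a.
by rewrite eq_sym => /negPf ->; rewrite mulr0 mul0r.
Qed.

End IntegralEquation.

Section IrreducibleMonic.
Variable R : comNzRingType.

(** It identifies phi_k, known only as monic and irreducible, with an explicit polynomial. The
    quotient by s is monic, and s is no unit because of its degree; so the quotient is a unit, hence
    1. *)
Lemma irreducible_monic (p s : {poly R}) n : p \is monic -> monic_size s n -> (0 < n)%N ->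
  (forall A B, p = A * B -> (exists A', A * A' = 1) \/ (exists B', B * B' = 1)) ->
  Pdiv.Ring.rmodp p s = 0 -> p = s.
Proof.
move=> mp [ms ss] n0 irr r0.
have E := Pdiv.RingMonic.rdivp_eq ms p.
rewrite r0 addr0 in E; set Q := Pdiv.Ring.rdivp p s in E.
have mQ : Q \is monic by rewrite -(monicMr Q ms) -E.
have [[Q' QQ]|[s' sQ]] := irr Q s E.
  have Q'0 : Q' != 0 by apply/eqP => h; move: QQ; rewrite h mulr0 => /eqP; rewrite eq_sym oner_eq0.
  have := size_monicM mQ Q'0; rewrite QQ size_poly1 => /esym sz.
  have Q0 := monic_neq0 mQ.
  have : size Q = 1%N.
    by move: sz; have := Q'0; have := Q0; rewrite -!size_poly_gt0; move: (size Q) (size Q') => a b; lia.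
  move/eqP/size_poly1P => [c c0 Qc]; move: mQ; rewrite E Qc monicE lead_coefC => /eqP ->.
  by rewrite mul1r.
have s'0 : s' != 0 by apply/eqP => h; move: sQ; rewrite h mulr0 => /eqP; rewrite eq_sym oner_eq0.
have := size_monicM ms s'0; rewrite sQ size_poly1 ss; move: s'0; rewrite -size_poly_gt0.
by move: n0; case: (n) => // n' _; case: (size s') => // v _; rewrite addSn addnS.
Qed.

End IrreducibleMonic.

Section OverSubfield.
Variables (L : fieldType) (S : L -> Prop).
Hypothesis HS : subfld S.

Definition fover (T : fps L) := forall j, S (fc T j).
Definition bover (H : {poly fps L}) := forall i, fover H`_i.

Lemma foverD A B : fover A -> fover B -> fover (A + B).
Proof. by move=> h1 h2 j; rewrite fcD; apply: subfldD. Qed.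
Lemma foverM A B : fover A -> fover B -> fover (A * B).
Proof. by move=> h1 h2 j; rewrite fcM; apply: subfld_sum => // a _; apply: (subfldM HS). Qed.
Lemma foverC c : S c -> fover (fpsC c).
Proof. by move=> h j; rewrite fcC; case: eqP => // _; apply: subfld0. Qed.
Lemma foverxp n : fover (xp ^+ n).
Proof. by move=> j; rewrite fcxp; apply: subfld_nat. Qed.
Lemma fover0 : fover 0.
Proof. by move=> j; apply: subfld0. Qed.
Lemma fover_sub c e A : S c -> fover A -> fover (fsub c e A).
Proof.
move=> Sc hA j; rewrite /= /ssubst; case: ifP => _; last exact: subfld0.
by apply: (subfldM HS) => //; apply: subfldX.
Qed.

Lemma boverD A B : bover A -> bover B -> bover (A + B).
Proof. by move=> h1 h2 i; rewrite coefD; apply: foverD. Qed.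
Lemma boverM A B : bover A -> bover B -> bover (A * B).
Proof.
move=> h1 h2 i; rewrite coefM; apply: big_ind => [||a _]; first exact: fover0.
  exact: foverD.
exact: foverM.
Qed.
Lemma boverC A : fover A -> bover A%:P.
Proof. by move=> h i; rewrite coefC; case: eqP => // _; apply: fover0. Qed.
Lemma boverX n : bover 'X^n.
Proof.
move=> i; rewrite coefXn; case: eqP => _; last exact: fover0.
by rewrite -(expr0 xp); apply: foverxp.
Qed.

Lemma bover_psub f H : S (am_mu f) -> S (am_al f) -> fover (Fps (am_S f)) -> bover H ->
  bover (psub f H).
Proof.
move=> hm ha hs hH; rewrite psub_sum; apply: big_ind => [||i _].
- by move=> i; rewrite coef0; apply: fover0.
- exact: boverD.
rewrite -mul_polyC; apply: boverM; first by apply: boverC; apply: fover_sub.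
elim: (nat_of_ord i) => [|n IH]; first exact: (boverX 0).
rewrite exprS; apply: boverM => //; rewrite /aff; apply: boverD; last exact: boverC.
rewrite -mul_polyC; apply: boverM; last by rewrite -['X]expr1; apply: boverX.
by apply: boverC; apply: foverM; [apply: foverC | apply: foverxp].
Qed.

(* As in the uniqueness part of Weierstrass preparation, the coefficients of G and U are
   determined recursively, for increasing powers of x. *)
Lemma weierstrass_over a (U G : {poly fps L}) N :
  bover (xp ^+ a *: (U * G)) -> fc U`_0 0 != 0 -> monic_size G N ->
  (forall i, (i < N)%N -> fc G`_i 0 = 0) -> bover G.
Proof.
move=> hH U0 [mG sG] hG.
have {}hH i j : S (fc (U * G)`_i j) by have := hH i (a + j)%N; rewrite coefZ fcxpMD.
have GN : G`_N = 1 by move: mG; rewrite monicE lead_coefE sG => /eqP.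
have Gbig i : (N < i)%N -> G`_i = 0 by move=> h; rewrite nth_default ?sG.
have G0 i : fc G`_i 0 = (i == N)%:R.
  by case: (ltngtP i N) => [/hG|/Gbig ->|->] //; rewrite GN fc1.
have SU0 i : S (fc U`_i 0).
  have := hH (i + N)%N 0%N; rewrite fc_mul; have iN : (i < (i + N).+1)%N by rewrite ltnS leq_addr.
  rewrite (bigD1 (Ordinal iN)) //= big_ord1 G0 addKn eqxx mulr1 big1 ?addr0 // => c.
  rewrite -val_eqE /= => ci; rewrite big_ord1 G0; case: eqP => [E|_]; last by rewrite mulr0.
  by case/eqP: ci; have := ltn_ord c; lia.
suff all j : (forall i, S (fc G`_i j)) /\ (forall i, S (fc U`_i j)) by move=> i j; case: (all j).
have [n] := ubnP j; elim: n j => // n IH j jn.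
have IHG b i : (b < j)%N -> S (fc G`_i b) by move=> h; case: (IH b) => //; lia.
have IHU b i : (b < j)%N -> S (fc U`_i b) by move=> h; case: (IH b) => //; lia.
have SG0 i : S (fc G`_i 0) by rewrite G0; apply: subfld_nat.
(* For i < N the coefficient of x^j y^i in U G is U(0,0) G_ij plus terms with G at a lower power of
   x or, at x^j, at a smaller i. Terms that would involve U at x^j vanish, since G is y^N at x =
   0. *)
have key : forall i, S (fc G`_i j).
  move=> i; have [m] := ubnP i; elim: m i => // m IHi i im.
  have [j0|j_gt0] := posnP j; first by rewrite j0.
  have [iN|Ni] := ltnP i N; last first.
    move: Ni; rewrite leq_eqVlt => /orP[/eqP <-|/Gbig ->]; last exact: subfld0.
    by rewrite GN fc1; apply: subfld_nat.
  have := hH i j; rewrite fc_mul big_ord_recl /= big_ord_recl /= !subn0.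
  set X := \sum_(b < j) _; set Y := \sum_(i0 < i) _ => h.
  have SX : S X.
    apply: (subfld_sum HS) => b _; rewrite /bump /= add1n.
    have bj := ltn_ord b; case: (ltnP b.+1 j) => hb.
      by apply: (subfldM HS); [apply: IHU | apply: IHG; lia].
    have -> : (j - b.+1 = 0)%N by lia.
    by rewrite hG // mulr0; apply: subfld0.
  have SY : S Y.
    apply: (subfld_sum HS) => c _; apply: (subfld_sum HS) => b _.
    have ci := ltn_ord c; have bj := ltn_ord b; rewrite /bump /= add1n.
    case: (ltnP b j) => hb.
      apply: (subfldM HS); first exact: IHU.
      have [b0|b0] := posnP b; last by apply: IHG; lia.
      by rewrite b0 subn0; apply: IHi; lia.
    have -> : (j - b = 0)%N by lia.
    by rewrite hG ?mulr0; [apply: subfld0 | lia].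
  have -> : fc G`_i j = (fc U`_0 0 * fc G`_i j + X + Y - X - Y) / fc U`_0 0 by field.
  apply: (subfldM HS); last by apply: (subfldV HS).
  by apply: (subfldB HS) => //; apply: (subfldB HS).
(* Once G is known up to x^j, the coefficient of y^(i+N) isolates U_ij, again because G is y^N at x
   = 0. *)
split=> // i; have := hH (i + N)%N j.
rewrite fc_mul; under eq_bigr do rewrite big_ord_recr /= subnn G0.
rewrite big_split /=; set X := \sum_(c < _) \sum_(b < j) _.
have iN : (i < (i + N).+1)%N by rewrite ltnS leq_addr.
rewrite (bigD1 (Ordinal iN)) //= addKn eqxx mulr1 big1 ?addr0 => [h|c]; last first.
  rewrite -val_eqE /= => ci; case: eqP => [E|_]; last by rewrite mulr0.
  by case/eqP: ci; have := ltn_ord c; lia.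
have SX : S X.
  by apply: (subfld_sum HS) => c _; apply: (subfld_sum HS) => b _; apply: (subfldM HS);
    [apply: IHU | case: (posnP b) => [->|b0]; [rewrite subn0; apply: key | apply: IHG; have := ltn_ord b; lia]].
by rewrite -[fc U`_i j](addKr X); apply: subfldD => //; apply: subfldN.
Qed.

End OverSubfield.

(** * Degenerate polygons *)

Section Degenerate.
Variables (L : fieldType) (S : L -> Prop) (HS : subfld S).
Variables (q m N : nat) (P : {poly L}).
Let l := (size P).-1.

Lemma coef_Pqm n : (Pqm P q m%:Z)`_n =
  \sum_(r < size P) (if n == (q * r)%N then P`_r *: 'X^(m * (l - r)) else 0).
Proof.
rewrite /Pqm coef_sum; apply: eq_bigr => r _.
by rewrite coefCM coefXn; case: eqP => _; rewrite ?mulr1 ?mulr0.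
Qed.

Lemma monic_size_Pqm : (0 < q)%N -> P \is monic -> monic_size (Pqm P q m%:Z) (q * l).
Proof.
move=> q0 mP; have sP : size P = l.+1.
  by rewrite /l prednK // size_poly_gt0 monic_neq0.
have ct : (Pqm P q m%:Z)`_(q * l) = 1.
  rewrite coef_Pqm sP big_ord_recr /= eqxx subnn muln0 expr0.
  move: mP; rewrite monicE lead_coefE -/l => /eqP ->; rewrite scale1r big1 ?add0r // => r _.
  by rewrite eqn_pmul2l // gtn_eqF.
have sz : (size (Pqm P q m%:Z) <= (q * l).+1)%N.
  apply/leq_sizeP => n hn; rewrite coef_Pqm big1 // => r _; case: eqP => // nr.
  have rl : (r <= l)%N by rewrite -ltnS -sP.
  by move: hn; rewrite nr ltn_pmul2l // ltnNge rl.
have sE : size (Pqm P q m%:Z) = (q * l).+1.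
  apply/eqP; rewrite eqn_leq sz ltnNge; apply/negP => /leq_sizeP /(_ _ (leqnn _))/eqP.
  by rewrite ct oner_eq0.
by split=> //; rewrite monicE lead_coefE sE /= ct.
Qed.

(** An arbitrary polygon point may have coefficient 0; the ends of a supporting segment do not. *)
Lemma on_endpoints (j : nat) (H : bpol L) u ju : polyg j H u ju ->
  exists i1 j1 i2 j2, [/\ (i1 <= u <= i2)%N, polyg j H i1 j1 /\ polyg j H i2 j2,
    bco H i1 j1 != 0 & bco H i2 j2 != 0].
Proof.
rewrite /polyg; case: (j == 0)%N => -[a [b]].
  case=> b0 [[i1 [j1 [i2 [j2 [n1 [n2 [h12 [l1 l2]]]]]]]] hmin].
  exists i1, j1, i2, j2; split=> //; [|by case: n1|by case: n2].
  split; exists a, b; split=> //; split.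
  - by exists i1, j1, i1, j1; rewrite leqnn.
  - by rewrite l1.
  - by exists i2, j2, i2, j2; rewrite leqnn.
  - by rewrite l2.
case=> a0 [b0 [[i1 [j1 [i2 [j2 [n1 [n2 [h12 [hu [l1 l2]]]]]]]]] hmin]].
exists i1, j1, i2, j2; split=> //; [|by case: n1|by case: n2].
split; exists a, b; do 2![split=> //]; split.
- by exists i1, j1, i2, j2; do 4![split=> //]; rewrite ?leqnn ?(ltnW h12) ?l1 ?l2.
- by rewrite l1.
- by exists i1, j1, i2, j2; do 4![split=> //]; rewrite ?leqnn ?(ltnW h12) ?l1 ?l2.
- by rewrite l2.
Qed.

(** The leading monomial c y^(N q l) of the boundary polynomial puts (N q l, 0) on the polygon, and
    this has to be the point (N_j, 0). *)
Lemma degen_facts (j : nat) (H : bpol L) (Nj : nat) :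
  bmonic_deg H Nj -> ((0 < j)%N -> forall i, (i < Nj)%N -> bco H i 0 = 0) ->
  degen (polyg j H) S H q m%:Z P N ->
  P`_0 != 0 /\ Nj = (N * (q * l))%N /\ ((0 < m)%N \/ j = 0%N) /\ (0 < Nj)%N.
Proof.
move=> [hN hbig] hw [q0 [cop [[[c0 hst] [u [ju [v [jv [onu [onv uv]]]]]]] [mP [SP [irrP [c [cn0 hb]]]]]]]].
have [i1 [j1 [_ [_ [/andP[h1 _] [on1 _] b1 _]]]]] := on_endpoints onu.
have [_ [_ [i2 [j2 [/andP[_ h2] [_ on2] _ b2]]]]] := on_endpoints onv.
have i12 : (i1 < i2)%N by apply: leq_ltn_trans h1 _; apply: leq_trans uv h2.
pose Hb := c%:P%:P * Pqm P q m%:Z ^+ N.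
have nz i j' : polyg j H i j' -> bco H i j' != 0 -> Hb`_i != 0.
  by move=> on b; apply/eqP => h; have [/(_ on)] := hb i j'; rewrite -/Hb h coef0 => E; rewrite -E eqxx in b.
have i2N : (i2 <= Nj)%N by rewrite leqNgt; apply/negP => /hbig h; rewrite h eqxx in b2.
have Nj0 : (0 < Nj)%N by apply: leq_trans i2N; apply: leq_ltn_trans i12.
have [mPq sPq] := monic_size_exp N (monic_size_Pqm q0 mP).
split.
  (* An irreducible P with P(0) = 0 is the variable itself, and the boundary polynomial is then a
     monomial, whereas a straight polygon has nonzero coefficients at two abscissas. *)
  apply/eqP => P0.
  have XP : 'X %| P by rewrite -['X]subr0 -[0]/(0%:P) dvdp_XsubCl /root horner_coef0 P0.
  have := irrP.2 'X; rewrite size_polyX => /(_ _ isT XP) eqX.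
  have {eqX} XE : 'X = P.
    apply/eqP; rewrite -eqp_monic ?monicX //; apply: eqX => i.
    by rewrite coefX; apply: (subfld_nat HS).
  have HbE : Hb = c%:P%:P * 'X^(q * N).
    rewrite /Hb /Pqm -XE size_polyX big_ord_recl big_ord1 /= !coefX /=.
    by rewrite scale0r mul0r add0r scale1r subnn muln0 expr0 mul1r muln1 -exprM.
  have one i j' : polyg j H i j' -> bco H i j' != 0 -> i = (q * N)%N.
    move=> on b; apply/eqP; have := nz i j' on b; rewrite HbE coefCM coefXn.
    by case: (i == _) => //; rewrite mulr0 eqxx.
  by move: i12; rewrite (one _ _ on1 b1) (one _ _ on2 b2) ltnn.
have HbT : Hb`_(N * (q * l)) = c%:P.
  by rewrite coefCM; move: mPq; rewrite monicE lead_coefE sPq /= => /eqP ->; rewrite mulr1.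
have sHb : (size Hb <= (N * (q * l)).+1)%N.
  rewrite /Hb mul_polyC -sPq; exact: size_scale_leq.
have onT : polyg j H (N * (q * l))%N 0%N.
  apply: contrapT => h; have [_ /(_ h)] := hb (N * (q * l))%N 0%N.
  by rewrite -/Hb HbT coefC eqxx; move/eqP; rewrite (negPf cn0).
have bT : bco H (N * (q * l)) 0 = c.
  by have [/(_ onT) <- _] := hb (N * (q * l))%N 0%N; rewrite -/Hb HbT coefC eqxx.
have TN : (N * (q * l) <= Nj)%N.
  by rewrite leqNgt; apply/negP => /hbig h; move: bT; rewrite h => /esym/eqP; rewrite (negPf cn0).
split.
  (* For j > 0 no point (i, 0) with i < N_j has a nonzero coefficient. For j = 0 the point (N_j, 0)
     lies on the polygon, beyond the degree N q l of the boundary polynomial. *)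
  apply/eqP; rewrite eqn_leq TN andbT leqNgt; apply/negP => lt.
  have [j0|jp] := posnP j; last first.
    by move: bT; rewrite hw // => /esym/eqP; rewrite (negPf cn0).
  have onN : polyg j H Nj 0.
    rewrite /polyg j0 /=; exists 0, 1; split=> //.
    have nN : npts H Nj 0 by split; rewrite // hN eqxx oner_neq0.
    split; first by exists Nj, 0%N, Nj, 0%N; rewrite leqnn.
    by move=> i' j' _; rewrite /lin; lia.
  have := nz _ _ onN; rewrite hN eqxx oner_neq0 => /(_ isT).
  by rewrite nth_default ?eqxx //; apply: leq_trans sHb lt.
split=> //.
have [j0|jp] := posnP j; [by right | left].
move: on1; rewrite {1}/polyg; case: eqP => [j0|_]; first by rewrite j0 in jp.
case=> a [b [a0 [b0 [[x1 [y1 [x2 [y2 [n1 [n2 [x12 [_ [l1 l2]]]]]]]]] hmin]]]].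
have on' x y : npts H x y -> lin a b x y = lin a b i1 j1 -> (x1 <= x <= x2)%N -> polyg j H x y.
  move=> nx lx hx; rewrite /polyg ifF; last by apply/negbTE; rewrite -lt0n.
  exists a, b; do 2![split=> //]; split; last by rewrite lx.
  by exists x1, y1, x2, y2; rewrite lx.
have e1 := hst _ _ (on' _ _ n1 l1 _); rewrite leqnn ltnW // in e1.
have e2 := hst _ _ (on' _ _ n2 l2 _); rewrite leqnn ltnW // in e2.
(* With m = 0 the edge would be horizontal, against its negative slope. *)
rewrite lt0n; apply/eqP => m0.
have := e1 isT; have := e2 isT; rewrite m0 !mul0r !add0r => <- /eqP.
rewrite -[_ == _]/(q%:Z * y1%:Z == q%:Z * y2%:Z).
move: l1 l2; rewrite /lin => l1 l2 E.
have yy : y1 = y2 by apply/eqP; move: E; rewrite -!PoszM eqz_nat eqn_pmul2l.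
by subst y2; move: l1; rewrite -l2; nia.
Qed.

End Degenerate.

(** * Initial level and degree of phi *)

Section Tau.
Variables (L : fieldType) (cs : ser L).

Lemma aff_tau : aff (tau cs) = 'X + (Fps cs)%:P.
Proof. by rewrite /aff /= rmorph1 expr0 mulr1 scale1r. Qed.

Lemma psub_tau_sum G : psub (tau cs) G = \sum_(i < size G) G`_i *: ('X + (Fps cs)%:P) ^+ i.
Proof. by rewrite psub_sum aff_tau; apply: eq_bigr => i _; rewrite /= fsub1. Qed.

Lemma monic_size_XaddC_exp (c : fps L) i : monic_size (('X + c%:P) ^+ i) i.
Proof.
have h : monic_size ('X + c%:P) 1.
  by rewrite -[c%:P]opprK -polyCN; split; [apply: monicXsubC | apply: size_XsubC].
by have := monic_size_exp i h; rewrite muln1.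
Qed.

Lemma monic_size_tau G n : monic_size G n -> monic_size (psub (tau cs) G) n.
Proof.
move=> [mG sG]; rewrite psub_tau_sum sG.
have hP := monic_size_XaddC_exp (Fps cs).
have ct := triangular_coef hP n (fun i => G`_i).
have st := triangular_size hP n.+1 (fun i => G`_i).
move: mG; rewrite monicE lead_coefE sG /= => /eqP Gn; rewrite /= Gn in ct.
have sE : size (\sum_(i < n.+1) G`_i *: ('X + (Fps cs)%:P) ^+ i) = n.+1.
  apply/eqP; rewrite eqn_leq st ltnNge; apply/negP => /leq_sizeP /(_ _ (leqnn _))/eqP.
  by rewrite ct oner_eq0.
by split=> //; rewrite monicE lead_coefE sE ct.
Qed.

Lemma coef_tau_0 G i : cs 0%N = 0 -> fc (psub (tau cs) G)`_i 0 = fc G`_i 0.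
Proof.
move=> c0; transitivity ((map_poly (@ev0 L) (psub (tau cs) G))`_i); first by rewrite coef_map.
transitivity ((map_poly (@ev0 L) G)`_i); last by rewrite coef_map.
suff -> : map_poly (@ev0 L) (psub (tau cs) G) = map_poly (@ev0 L) G by [].
rewrite psub_tau_sum rmorph_sum [RHS]/map_poly poly_def.
apply: eq_bigr => n _; rewrite /= map_polyZ rmorphXn /= rmorphD /= map_polyX map_polyC.
by rewrite /= {2}/ev0 /= c0 polyC0 addr0.
Qed.
End Tau.

Section Acomp.
Variables (L : fieldType) (S : L -> Prop).
Hypothesis HS : subfld S.

Lemma fover_acomp (f g : amap L) : (0 < am_e g)%N -> S (am_al f) -> S (am_mu g) ->
  fover S (Fps (am_S f)) -> fover S (Fps (am_S g)) -> fover S (Fps (am_S (acomp f g))).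
Proof.
move=> e0 ha hm hf hg; rewrite /= saddE sscaleE smulE -xpE ssubstE //.
apply: foverD => //; last exact: fover_sub.
apply: foverM => //; first by apply: foverC => //; apply: (subfldM HS) => //; apply: subfldX.
by apply: foverM => //; apply: foverxp.
Qed.
End Acomp.

Section EvalKernel.
Variables (K L : fieldType) (iota : {rmorphism K -> L}).

Lemma evpX f : evp iota f 'X = aff f.
Proof. by rewrite /evp /= map_polyX psubX. Qed.

Lemma evpC f c : evp iota f c%:P = (fsub (am_mu f) (am_e f) (fmap iota c))%:P.
Proof. by rewrite /evp /= map_polyC psubC. Qed.

Lemma evp_coef0 f (p : {poly fps K}) : (evp iota f p)`_0 =
  (map_poly (fsub (am_mu f) (am_e f) \o fmap iota) p).[Fps (am_S f)].
Proof. by rewrite /evp /= psub_eval map_poly_comp. Qed.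

Lemma evp_coef0M f (p s : {poly fps K}) :
  (evp iota f (p * s))`_0 = (evp iota f p)`_0 * (evp iota f s)`_0.
Proof. by rewrite (rmorphM (evp iota f)) coef0M. Qed.

Definition poly_irreducible (p : {poly fps K}) :=
  forall A B, p = A * B -> (exists A', A * A' = 1) \/ (exists B', B * B' = 1).

(** By division phi_0 is y - c with c over K, and tau_0 carries it to y; hence value 0 and leading
    coefficient 1. *)
Lemma level_base (D : nat -> nat) (phi : nat -> {poly fps K}) (cs : ser L) (cK : fps K) :
  D 0 = 1%N -> Fps cs = fmap iota cK ->
  phi 0%N \is monic -> poly_irreducible (phi 0%N) -> (evp iota (tau cs) (phi 0%N))`_0 = 0 ->
  level iota D phi 0 (tau cs) (fun a => exists b, a = iota b) (fun=> 0%N) (fun=> 1).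
Proof.
move=> D0 cE mphi irr hz.
have HS : subfld (fun a => exists b, a = iota b).
  split; first by exists 1; rewrite rmorph1.
  - by move=> _ _ [a ->] [b ->]; exists (a - b); rewrite rmorphB.
  - by move=> _ _ [a ->] [b ->]; exists (a * b); rewrite rmorphM.
  - by move=> _ [a ->]; exists a^-1; rewrite fmorphV.
have evX (c : fps K) : evp iota (tau cs) ('X + c%:P) = 'X + (Fps cs + fmap iota c)%:P.
  rewrite (rmorphD (evp iota (tau cs))) /= evpX evpC /= fsub1.
  by rewrite aff_tau polyCD addrA.
have evX0 : evp iota (tau cs) ('X + (- cK)%:P) = 'X.
  by rewrite evX cE -rmorphD subrr rmorph0 addr0.
have msX : monic_size ('X + (- cK)%:P) 1.
  by rewrite polyCN; split; [apply: monicXsubC | apply: size_XsubC].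
have phiE : phi 0%N = 'X + (- cK)%:P.
  apply: (irreducible_monic mphi msX _ irr) => //.
  set r := Pdiv.Ring.rmodp _ _.
  have E := Pdiv.RingMonic.rdivp_eq msX.1 (phi 0%N); rewrite -/r in E.
  have sr : (size r < 2)%N.
    by rewrite -(msX.2) Pdiv.Ring.ltn_rmodp monic_neq0 //; apply: msX.1.
  move: hz; rewrite E (rmorphD (evp iota (tau cs))) coefD evp_coef0M evX0.
  rewrite coefX mulr0 add0r.
  move: sr; rewrite ltnS => /size1_polyC ->; rewrite /= evpC coefC /= fsub1 => h.
  rewrite -polyC0; congr _%:P; apply: fpsP => j.
  have /(congr1 (fun T : fps L => fc T j)) /= /eqP := h.
  by rewrite fmorph_eq0 => /eqP.
have dig0 r : dig D 0 r 0 = r by rewrite /dig eqxx D0 divn1.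
split=> //.
- by rewrite oner_neq0.
- by exists 1; rewrite rmorph1.
- by move=> a; exists a.
- by move=> l; rewrite leqn0 => /eqP ->; rewrite D0 phiE.
- by move=> l _; split; [apply: oner_neq0 | exists 1; rewrite rmorph1].
- move=> l; rewrite leqn0 => /eqP ->; exists 1; split=> //.
  + by rewrite expr0 scale1r expr1 mulr1 phiE evX0.
  + by rewrite coef1 fc1.
move=> w g; rewrite D0 big_ord1 => hs [|//] _.
rewrite /adm /psi_wt big_ord1 muln0 subn0 /= => dv.
move: hs; rewrite /cterm /adm /psi_wt /psi_coef big_ord1 big_ord1 muln0 subn0 /= dv expr1n expr1n.
by rewrite !mulr1 => /eqP; rewrite fmorph_eq0 => /eqP.
Qed.
End EvalKernel.

Section StepPhi.
Variables (K L : fieldType) (iota : {rmorphism K -> L}).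
Variables (D : nat -> nat) (phi : nat -> {poly fps K}).
Hypotheses (D0 : D 0 = 1%N) (D_gt0 : forall l, (0 < D l)%N)
  (D_dvd : forall l, (D l %| D l.+1)%N).
Variables (k : nat) (f : amap L) (S : L -> Prop) (V : nat -> nat) (Lam : nat -> L).
Hypothesis lv : level iota D phi k f S V Lam.
Variables (q m t : nat) (z zs : L) (P : {poly L}) (cs : ser L).
Let l := (size P).-1.
Hypotheses (q_gt0 : (0 < q)%N) (cop : coprime q m) (z0 : z != 0)
  (zsq : zs ^+ q = z * z ^+ (t * m))
  (SP : poly_over S P) (irrP : irr_over S P) (rP : root P z)
  (DS : D k.+1 = (D k * (q * l))%N) (hm : (0 < m)%N \/ k = 0%N)
  (cs0 : cs 0%N = 0) (q0 : (q%:R : L) != 0) (l0 : (l%:R : L) != 0).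
Let S' := adjoin S z.
Hypothesis (S'zs : S' zs).
Variables (nf : nat) (om : nat -> L).
Hypotheses (hsp : spans iota S nf om) (hnf : (nf * am_e f = D k)%N).
Let f' := next_map f q m t z zs cs.
Hypothesis (Sf' : fover S' (Fps (am_S f'))).

(** The remainder of phi_(k+1) modulo the Cayley-Hamilton polynomial also vanishes on the
    parametrization, but is too small for [kernel_lead] unless it is 0. *)
Lemma step_phi_size : phi k.+1 \is monic -> poly_irreducible (phi k.+1) ->
  (evp iota f' (phi k.+1))`_0 = 0 -> monic_size (phi k.+1) (D k.+1).
Proof.
move=> mphi irr hz.
have HS := lv_S lv; have HS' : subfld S' := adjoin_subfld HS SP irrP rP.
have [om' hsp'] := spans_adjoin HS SP irrP rP hsp.
have e0 : (0 < am_e f')%N by rewrite /= muln1 muln_gt0 (lv_e lv).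
have mu0 : am_mu f' != 0 by rewrite /= expr1n mulr1 mulf_neq0 ?expf_neq0 ?(lv_mu lv).
have Smu : S' (am_mu f').
  rewrite /= expr1n mulr1; apply: (subfldM HS'); first by apply: (sub_adjoin HS); apply: (lv_muS lv).
  by apply: (subfldX HS'); apply: (subfldX HS'); apply: (adjoin_gen HS).
have Sio a : S' (iota a) by apply: (sub_adjoin HS); apply: (lv_iota lv).
have [psi [mpsi hpsi]] := integral_equation HS' hsp' e0 mu0 Smu Sf'.
have DE : (nf * (size P).-1 * am_e f' = D k.+1)%N.
  by rewrite /= muln1 DS -hnf -/l; ring.
rewrite DE in mpsi.
suff -> : phi k.+1 = psi by [].
apply: (irreducible_monic mphi mpsi _ irr) => //.
set r := Pdiv.Ring.rmodp _ _; apply/eqP/contraT => r0.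
have E := Pdiv.RingMonic.rdivp_eq mpsi.1 (phi k.+1); rewrite -/r in E.
have sr : (size r < (D k.+1).+1)%N.
  by rewrite -(mpsi.2) Pdiv.Ring.ltn_rmodp monic_neq0 //; apply: mpsi.1.
have rz : (evp iota f' r)`_0 = 0.
  move: hz; rewrite E (rmorphD (evp iota f')) coefD evp_coef0M [X in _ * X]evp_coef0 /=.
  by rewrite hpsi mulr0 add0r.
have [] := kernel_lead D0 D_gt0 D_dvd lv q_gt0 cop z0 zsq SP irrP rP DS hm cs0 q0 l0 S'zs r0 (ltnW sr) rz.
by move=> szr; move: sr; rewrite szr ltnn.
Qed.
End StepPhi.

(** * The levels of a run *)

Lemma natr_neq0_small (K L : fieldType) (iota : {rmorphism K -> L}) d n :
  ([pchar K] =i pred0 \/ exists2 p, p \in [pchar K] & (d < p)%N) ->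
  (0 < n)%N -> (n <= d)%N -> (n%:R : L) != 0.
Proof.
move=> hc n0 nd; rewrite -(rmorph_nat iota) fmorph_eq0.
case: hc => [hc|[p pp dp]].
  apply/negP => h; have [p pp] := natf0_pchar n0 h.
  by rewrite hc in pp.
rewrite -(dvdn_pcharf pp); apply/negP => /(dvdn_leq n0); lia.
Qed.

Section Run.
Variables (K L : fieldType) (iota : {rmorphism K -> L}) (d : nat) (F : bpol K).
Hypothesis hchar : [pchar K] =i pred0 \/ exists2 p, p \in [pchar K] & (d < p)%N.
Hypothesis hF : bmonic_deg F d.
Variables (dat : rdata L) (k : nat) (phi : nat -> bpol K).
Hypotheses (hrun : is_run iota F d dat) (hk : (k <= r_g dat)%N).
Hypothesis hphi : forall i, (i <= k)%N -> is_phi iota F d dat i (phi i).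

Definition radix i := (r_q dat i * (size (r_P dat i)).-1)%N.
(* The degree of phi_l for l <= k; the radices beyond level k, on which nothing is known, are
   replaced by 1. *)
Definition phi_deg l := (\prod_(i < l) (if (i < k)%N then radix i.+1 else 1))%N.
Definition phi_poly l : {poly fps K} := toP (phi l).
Definition pi_map j := pimap iota F d dat j.
Definition Kfield j := Kfld iota (r_z dat) j.

Lemma phi_deg0 : phi_deg 0 = 1%N. Proof. by rewrite /phi_deg big_ord0. Qed.
Lemma phi_degS l : phi_deg l.+1 = (phi_deg l * (if (l < k)%N then radix l.+1 else 1))%N.
Proof. by rewrite /phi_deg big_ord_recr. Qed.

Lemma radix_gt0 j : (j < k)%N -> (0 < radix j.+1)%N.
Proof.
move=> jk; have [_ [_ [hst _]]] := hrun.
have [_ [[q0 [_ [_ [_ [_ [[sP _] _]]]]]] _]] := hst j (leq_trans jk hk).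
by rewrite /radix muln_gt0 q0 /=; case: (size _) sP => [|[|]].
Qed.

Lemma phi_deg_gt0 l : (0 < phi_deg l)%N.
Proof. by apply: prodn_gt0 => i; case: ifP => // /radix_gt0. Qed.

Lemma phi_deg_dvd l : (phi_deg l %| phi_deg l.+1)%N.
Proof. by rewrite phi_degS dvdn_mulr. Qed.

Lemma phi_poly_monic j : (j <= k)%N -> phi_poly j \is monic.
Proof. by move=> /hphi[[n /bmonic_degE[]]]. Qed.

Lemma phi_poly_irr j : (j <= k)%N -> poly_irreducible (phi_poly j).
Proof.
move=> /hphi[_ [[_ [_ irr]] _]] A B E.
have [|[A' hA]|[B' hB]] := irr (ofP A) (ofP B).
- by apply/beqE; rewrite toP_bmul !ofPK.
- by left; exists (toP A'); move/beqE: hA; rewrite toP_bmul ofPK toP_bone.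
- by right; exists (toP B'); move/beqE: hB; rewrite toP_bmul ofPK toP_bone.
Qed.

Lemma phi_poly_kernel j : (j <= k)%N -> (0 < am_e (pi_map j))%N -> (evp iota (pi_map j) (phi_poly j))`_0 = 0.
Proof.
move=> /hphi[_ [_ h]] e0; move/beqE: h; rewrite toP_bsubst // toP_bmapK toP_nil => h.
by rewrite /evp /= psub_eval -[RHS](coef0 _ 0%N) -h psub_eval.
Qed.

(** [i_S] and [i_over] keep S_j and H_j over K_j, as the next use of Cayley-Hamilton demands, and
    [i_nf] matches the number of generators of K_j[[x]] with the degree of phi_j. *)
Record run_inv (j : nat) V Lam nf om v (U : {poly fps L}) : Prop := RunInv {
  i_lev : level iota phi_deg phi_poly j (pi_map j) (Kfield j) V Lam;
  i_span : spans iota (Kfield j) nf om;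
  i_nf : (nf * am_e (pi_map j) = phi_deg j)%N;
  i_al : Kfield j (am_al (pi_map j));
  i_S : fover (Kfield j) (Fps (am_S (pi_map j)));
  i_H : bmonic_deg (r_H dat j) (r_N dat j);
  i_w : (0 < j)%N -> forall i, (i < r_N dat j)%N -> bco (r_H dat j) i 0 = 0;
  i_over : bover (Kfield j) (toP (r_H dat j));
  i_N : (r_N dat j * phi_deg j = d)%N;
  i_F : evp iota (pi_map j) (toP F) = xp ^+ v *: (U * toP (r_H dat j));
  i_U : fc U`_0 0 != 0;
  i_0 : j = 0%N -> U = 1 }.

Lemma tau0_series : Fps (am_S (tau0 iota F d)) =
  fmap iota (fpsC (- (d%:R)^-1) * Fps (nth (s0 K) F d.-1)).
Proof.
apply: fpsP => n; transitivity (- (d%:R)^-1 * iota (nth (s0 K) F d.-1 n)); first by [].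
transitivity (iota (fc (fpsC (- (d%:R)^-1) * Fps (nth (s0 K) F d.-1)) n)); last by [].
by rewrite fcCM rmorphM rmorphN fmorphV rmorph_nat.
Qed.

Lemma run_inv_base : exists V Lam nf om v U, run_inv 0 V Lam nf om v U.
Proof.
have [hN [hH _]] := hrun.
have lev := level_base (cs := am_S (tau0 iota F d)) phi_deg0 tau0_series
  (phi_poly_monic (leq0n k)) (phi_poly_irr (leq0n k)) (phi_poly_kernel (leq0n k) isT).
have HE : toP (r_H dat 0) = evp iota (pi_map 0) (toP F).
  by rewrite hH toP_bsubst // toP_bmapK.
have Sio a : Kfield 0 (iota a) by exists a.
exists (fun=> 0%N), (fun=> 1), 1%N, (fun=> 1), 0%N, 1; split=> //.
- by apply: spans_base.
- by rewrite phi_deg0.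
- by exists 1; rewrite rmorph1.
- by move=> n; rewrite -[pi_map 0]/(tau0 iota F d) tau0_series; apply: Sio.
- have [mF sF] := (bmonic_degE F d).1 hF.
  rewrite hN; apply/bmonic_degE; rewrite HE; apply: monic_size_tau; split.
    by apply: monic_map.
  by rewrite size_map_poly_id0 // (monicP mF) rmorph1 oner_neq0.
- rewrite HE; apply: (bover_psub (lv_S lev)).
  + by exists 1; rewrite rmorph1.
  + by exists 1; rewrite rmorph1.
  + by move=> n; rewrite -[pi_map 0]/(tau0 iota F d) tau0_series; apply: Sio.
  + by move=> i n; rewrite coef_map; apply: Sio.
- by rewrite hN phi_deg0 muln1.
- by rewrite expr0 scale1r mul1r HE.
- by rewrite coef1 fc1 oner_neq0.
Qed.

Lemma run_inv_step j V Lam nf om v U : (j < k)%N -> run_inv j V Lam nf om v U ->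
  exists V' Lam' nf' om' v' U', run_inv j.+1 V' Lam' nf' om' v' U'.
Proof.
move=> jk I; have [_ [_ [hst _]]] := hrun.
have := hst j (leq_trans jk hk); rewrite /run_step.
set q := r_q dat j.+1; set m := r_m dat j.+1; set P := r_P dat j.+1.
set N := r_N dat j.+1; set z := r_z dat j.+1; set s := r_s dat j.+1.
set t := r_t dat j.+1; set G := r_G dat j.+1; set cs := r_c dat j.+1.
case=> [_ [dg [rP [bez [tq [[mG wG] [[a [U' [U'0 hfac]]] [csE HE]]]]]]]].
have lv := i_lev I; have HS := lv_S lv.
have [P0 [NE [hm Nj0]]] := degen_facts HS (i_H I) (i_w I) dg.
have [q0 [cop [_ [mP [SP [irrP _]]]]]] := dg.
set l := (size P).-1 in NE.
have z0 : z != 0.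
  apply: contra P0 => /eqP zz; move: rP; rewrite /root zz horner_coef0 //.
pose zs := z ^ s.
have zsq : zs ^+ q = z * z ^+ (t * m).
  rewrite /zs -[_ ^+ q]/((z ^ s) ^ q%:Z) exprz_exp mulrC.
  have -> : q%:Z * s = 1 + (t * m)%:Z by move: bez; rewrite PoszM; lia.
  by rewrite expfzDr // expr1z.
have HS' := adjoin_subfld HS SP irrP rP.
have Szs : adjoin (Kfield j) z zs by apply: (subfldXz HS'); apply: (adjoin_gen HS).
have DS : phi_deg j.+1 = (phi_deg j * (q * l))%N by rewrite phi_degS jk.
have N0 : (0 < N)%N by move: Nj0; rewrite NE muln_gt0 => /andP[].
have ql0 : (0 < q * l)%N by move: Nj0; rewrite NE muln_gt0 => /andP[].
have dE : (N * phi_deg j.+1 = d)%N by rewrite -(i_N I) NE DS; ring.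
(* Both q and l divide d = N D_(j+1), so the assumption on the characteristic keeps them nonzero in
   L. *)
have qd : (q <= d)%N.
  rewrite -dE DS mulnA mulnCA leq_pmulr // !muln_gt0 N0 phi_deg_gt0 /=.
  by move: ql0; rewrite muln_gt0 => /andP[].
have ld' : (l <= d)%N.
  rewrite -dE DS !mulnA leq_pmull // !muln_gt0 N0 phi_deg_gt0 q0 //.
have qn := natr_neq0_small iota hchar q0 qd.
have ln : (l%:R : L) != 0.
  by apply: (natr_neq0_small iota hchar) => //; move: ql0; rewrite muln_gt0 => /andP[].
have csF : Fps cs = fpsC (- (N%:R)^-1) * (toP G)`_N.-1.
  by rewrite csE sscaleE coef_toP.
have cs0 : cs 0%N = 0.
  by rewrite -[cs 0%N]/(fc (Fps cs) 0) csF fcCM fc_toP wG ?mulr0 // prednK.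
have fE : pi_map j.+1 = next_map (pi_map j) q m t z zs cs by [].
have e0 := lv_e lv.
have KfieldS x : Kfield j x -> Kfield j.+1 x by apply: (sub_adjoin HS).
have zS n : adjoin (Kfield j) z (z ^+ n) by apply: (subfldX HS'); apply: (adjoin_gen HS).
have fac : psub (sig q m t z zs) (toP (r_H dat j)) = xp ^+ a *: (toP U' * toP G).
  rewrite -toP_bsubst //; move/beqE: hfac => ->.
  by rewrite !toP_bmul toP_bxpow mul_polyC.
have sigS : fover (adjoin (Kfield j) z) (Fps (am_S (sig q m t z zs))).
  by rewrite /= sscaleE -xpE; apply: (foverM HS'); [apply: (foverC HS') | apply: (foverxp HS')].
have msG := (bmonic_degE G N).1 mG.
(* This places c_(j+1), and with it S_(j+1), over K_(j+1). *)
have Gover : bover (adjoin (Kfield j) z) (toP G).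
  apply: (weierstrass_over HS' (a := a) (U := toP U') (N := N)) => //.
  - rewrite -fac; apply: (bover_psub HS') => //=; first by apply: (subfld1 HS').
    by move=> i n; apply: KfieldS; apply: (i_over I).
  - by rewrite fc_toP.
  - by move=> i iN; rewrite fc_toP wG.
have csS : fover (adjoin (Kfield j) z) (Fps cs).
  rewrite csF; apply: (foverM HS'); last exact: Gover.
  by apply: (foverC HS'); apply: (subfldN HS'); apply: (subfldV HS'); apply: (subfld_nat HS').
have S1 : adjoin (Kfield j) z (am_al (acomp (pi_map j) (sig q m t z zs))).
  rewrite /= mulr1; apply: (subfldM HS'); last by apply: (subfldX HS').
  by apply: KfieldS; apply: (i_al I).
have Spi : fover (adjoin (Kfield j) z) (Fps (am_S (pi_map j.+1))).
  rewrite fE /next_map; apply: (fover_acomp HS') => //; first by apply: (subfld1 HS').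
  apply: (fover_acomp HS') => //=; first by apply: KfieldS; apply: (i_al I).
  by move=> n; apply: KfieldS; apply: (i_S I).
have ms := step_phi_size phi_deg0 phi_deg_gt0 phi_deg_dvd lv q0 cop z0 zsq SP irrP rP DS hm cs0 qn ln Szs
  (i_span I) (i_nf I) Spi (phi_poly_monic jk) (phi_poly_irr jk).
have e0' : (0 < am_e (pi_map j.+1))%N by rewrite fE /= muln1 muln_gt0 e0.
have hker := phi_poly_kernel jk e0'.
have {}ms := ms hker.
have [V' [Lam' lev']] := step_level phi_deg0 phi_deg_gt0 phi_deg_dvd lv q0 cop z0 zsq SP irrP rP DS hm cs0 qn ln
  Szs ms hker.
have [om' sp'] := spans_adjoin HS SP irrP rP (i_span I).
have H'E : toP (r_H dat j.+1) = psub (tau cs) (toP G) by rewrite HE toP_bsubst.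
(* The factor z^(t v) comes from x^v; the new unit collects the images of U and of the Weierstrass
   unit U'. *)
exists V', Lam', (nf * l)%N, om', (q * v + a)%N,
  (fpsC (z ^+ (t * v)) *: (rho q m t z zs cs U * psub (tau cs) (toP U'))).
split=> //.
- by rewrite fE /= muln1 DS -(i_nf I); ring.
- rewrite fE /= !expr1n !mulr1; apply: (subfldM HS'); last by apply: (subfldX HS').
  by apply: KfieldS; apply: (i_al I).
- by apply/bmonic_degE; rewrite H'E; apply: monic_size_tau.
- by move=> _ i iN; rewrite -fc_toP H'E coef_tau_0 // fc_toP wG.
- rewrite H'E; apply: (bover_psub HS') => //=; exact: (subfld1 HS').
- rewrite fE (evp_next_map lv) // (i_F I) rhoZ rhoM.
  have -> : rho q m t z zs cs (toP (r_H dat j)) =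
      xp ^+ a *: (psub (tau cs) (toP U') * toP (r_H dat j.+1)).
    by rewrite /rho fac psubZ (rmorphM (psub (tau cs))) /= fsub1 H'E.
  rewrite fsub_xp // -exprM -scalerAr -!scalerAl !scalerA mulrA exprD.
  by congr (_ *: _); ring.
- rewrite coefZ fcCM coef0M -/(ev0 _) rmorphM /= {1}/ev0 coef0_rho //; last first.
    by case: hm => [|j0]; [left | right; rewrite (i_0 I j0) coef1 polyC1].
  rewrite /ev0 coef_tau_0 // fc_toP !mulf_neq0 ?expf_neq0 //; exact: (i_U I).
Qed.

Lemma run_inv_all j : (j <= k)%N -> exists V Lam nf om v U, run_inv j V Lam nf om v U.
Proof.
elim: j => [_|j IH jk]; first exact: run_inv_base.
by have [V [Lam [nf [om [v [U I]]]]]] := IH (ltnW jk); apply: run_inv_step I.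
Qed.

End Run.

(** * Newton polygons and expansions *)

(** It identifies the values given in the theorem with those built by the induction. *)
Lemma vlam_unique (L : fieldType) (H : bpol L) c i0 (A : {poly fps L}) v lam :
  toP H = xp ^+ c *: ('X^i0 * A) -> fc A`_0 0 != 0 -> vlam H v lam ->
  v = c /\ lam = fc A`_0 0.
Proof.
move=> HE A0 [[[i1 nz] low] [i [<- [l0 first]]]].
have co i' j : bco H i' j = if (c <= j)%N then fc (if (i' < i0)%N then 0 else A`_(i' - i0)) (j - c) else 0.
  by rewrite -fc_toP HE coefZ fcxpM coefXnM.
have top : bco H i0 c != 0 by rewrite co leqnn ltnn !subnn.
have vc : v = c.
  apply/eqP; rewrite eqn_leq; apply/andP; split; rewrite leqNgt; apply/negP => h.
    by move: top; rewrite low // eqxx.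
  by move: nz; rewrite co leqNgt h eqxx.
rewrite vc in l0 first *; split=> //.
suff -> : i = i0 by rewrite co leqnn ltnn !subnn.
apply/eqP; rewrite eqn_leq; apply/andP; split; rewrite leqNgt; apply/negP => h.
  by move: top; rewrite first // eqxx.
by move: l0; rewrite co leqnn h fc0 eqxx.
Qed.

(** A supporting line of negative slope gives the weights directly. Any other one touches, for k >
    0, only the point (N, 0); for k = 0 it forces j = 0, and the weight of y may be 0. *)
Lemma onNP_weights (L : fieldType) (H : bpol L) k N i j :
  bmonic_deg H N -> ((0 < k)%N -> forall i, (i < N)%N -> bco H i 0 = 0) ->
  onNP H i j -> exists al be, [/\ (0 < al)%N \/ k = 0%N, (0 < be)%N &
    weight_ge al be (al * i + be * j) (toP H)].
Proof.
move=> [hN hbig] hw [a [b [b0 [[i1 [j1 [i2 [j2 [n1 [n2 [h12 [l1 l2]]]]]]]] hmin]]]].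
have nN : npts H N 0 by split; rewrite // hN eqxx oner_neq0.
have i2N : (i2 <= N)%N.
  by rewrite leqNgt; apply/negP => h; case: n2; rewrite hbig // eqxx.
have hc i' j' : bco H i' j' != 0 -> (lin a b i j <= lin a b i' j').
  move=> nz; have ex : exists j'', bco H i' j'' != 0 by exists j'.
  case: (ex_minnP ex) => j0 nz0 min0; have := min0 _ nz => jj.
  have : npts H i' j0.
    split=> // j'' h; apply/eqP/contraT => /min0; by rewrite leqNgt h.
  move/hmin; rewrite /lin; nia.
have [a0|a_le0] := boolP (0 < a).
  exists (absz a), (absz b); split; [by left; lia | by lia |].
  by move=> i' j'; rewrite fc_toP => /hc; rewrite /lin; nia.
have top : i = N /\ j = 0%N ->
    exists al be, [/\ (0 < al)%N \/ k = 0%N, (0 < be)%N & weight_ge al be (al * i + be * j) (toP H)].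
  case=> -> ->; have [k0|k0] := posnP k.
    by exists 0%N, 1%N; split; [by right | by [] | by move=> i' j' _; lia].
  (* These weights are steep enough for (N, 0): points with j > 0 weigh more than N, and on j = 0
     nothing lies to the left of N. *)
  exists 1%N, N.+1; split; [by left | by [] |].
  move=> i' [|j']; rewrite fc_toP; last by move=> _; nia.
  move=> nz; case: (ltnP i' N) => h; last by lia.
  by move: nz; rewrite hw // eqxx.
have hNN := hmin _ _ nN; rewrite /lin in l1 l2 hNN; case/andP: h12 => h1 h2.
have [az|an] := eqVneq a 0; last first.
  have an' : a < 0 by lia.
  apply: top; have e2 : i2 = N /\ j2 = 0%N by nia.
  case: e2 => e2 e3; subst i2 j2.
  have e1 : i1 = N by nia.
  by subst i1; split; nia.
rewrite az in l1 l2 hNN hc.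
have [k0|k0] := posnP k.
  exists 0%N, 1%N; split; [by right | by [] |].
  by move=> i' j'; rewrite fc_toP => /hc; rewrite /lin; nia.
have jz : j = 0%N by nia.
have j1z : j1 = 0%N by nia.
apply: top; split=> //; apply/eqP; rewrite eqn_leq (leq_trans h2 i2N) /=.
rewrite leqNgt; apply/negP => iN; case: n1 => nz _; move: nz.
by rewrite j1z hw ?eqxx // (leq_ltn_trans h1 iN).
Qed.

Section Expansion.
Variables (K : fieldType) (k : nat) (D : nat -> nat) (rad : nat -> nat).
Hypotheses (D0 : D 0 = 1%N) (D_gt0 : forall l, (0 < D l)%N)
  (D_dvd : forall l, (D l %| D l.+1)%N)
  (D_rad : forall l, (l < k)%N -> (D l.+1 = D l * rad l.+1)%N).
Variable phi : nat -> bpol K.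
Hypothesis mphi : forall l, (l <= k)%N -> monic_size (toP (phi l)) (D l).

Local Notation idx := {ffun 'I_k.+2 -> nat}.

Definition PhiK : 'I_k.+2 -> bpol K := fun l => if l == ord0 then bxpow K 1 else phi l.-1.
Definition inBK (B : idx) : bool :=
  [forall l : 'I_k.+2, ((1 <= l) && (l <= k))%N ==> (B l < rad l)%N].

(* B = (a, b_0, ..., b_k) corresponds to (a, n), where n = deg_y Phi^B has mixed-radix
   digits b_0, ..., b_k. *)
Definition idx_of (a n : nat) : idx :=
  [ffun l : 'I_k.+2 => if l == ord0 then a else dig D k n l.-1].
Definition ydeg (B : idx) : nat := (\sum_(l < k.+1) B (lift ord0 l) * D l)%N.

Lemma idx_of0 a n : idx_of a n ord0 = a.
Proof. by rewrite ffunE eqxx. Qed.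

Lemma idx_ofS a n l : idx_of a n (lift ord0 l) = dig D k n l.
Proof. by rewrite ffunE. Qed.

Lemma idx_of_max a n : idx_of a n ord_max = (n %/ D k)%N.
Proof. by rewrite ffunE /= dig_top. Qed.

Lemma inBK_idx_of a n : inBK (idx_of a n).
Proof.
apply/forallP => l; apply/implyP => /andP[l1 lk]; rewrite ffunE ifF; last first.
  by apply/negbTE; rewrite -val_eqE /= -lt0n.
have h : (l.-1 < k)%N by rewrite prednK.
have := dig_bound D_gt0 D_dvd n h.
by rewrite D_rad // mulKn // prednK.
Qed.

Lemma inBK_digit (B : idx) (l : 'I_k.+1) : inBK B -> (l < k)%N ->
  (B (lift ord0 l) < D l.+1 %/ D l)%N.
Proof.
move=> /forallP/(_ (lift ord0 l)) /implyP h lk; rewrite D_rad // mulKn //.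
by apply: h; rewrite /= /bump /= add1n.
Qed.

Let bfun (B : idx) (l : nat) : nat := if insub l is Some l' then B (lift ord0 (l' : 'I_k.+1)) else 0%N.

Lemma ydeg_digits (B : idx) (l : 'I_k.+1) : inBK B -> dig D k (ydeg B) l = B (lift ord0 l).
Proof.
move=> hB; have bE (l' : 'I_k.+1) : bfun B l' = B (lift ord0 l').
  by rewrite /bfun valK.
have -> : ydeg B = (\sum_(i < k.+1) bfun B i * D i)%N.
  by apply: eq_bigr => i _; rewrite bE.
rewrite (dig_unique D0 D_gt0 D_dvd) ?bE // => [i ik|]; last by rewrite -ltnS.
have ik' : (i < k.+1)%N by apply: ltnW.
by rewrite (bE (Ordinal ik')); apply: (inBK_digit (l := Ordinal ik')).
Qed.

Lemma idx_ofK (B : idx) : inBK B -> idx_of (B ord0) (ydeg B) = B.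
Proof.
move=> hB; apply/ffunP => l; have [j ->|->] := unliftP ord0 l; last exact: idx_of0.
by rewrite idx_ofS ydeg_digits.
Qed.

Lemma ydeg_idx_of a n : ydeg (idx_of a n) = n.
Proof.
rewrite -[RHS](dig_sum D0 D_dvd k n); apply: eq_bigr => l _.
by rewrite idx_ofS.
Qed.

Lemma idx_of_inj a n a' n' : idx_of a n = idx_of a' n' -> a = a' /\ n = n'.
Proof.
move=> E; split; first by rewrite -(idx_of0 a n) E idx_of0.
by rewrite -(ydeg_idx_of a n) E ydeg_idx_of.
Qed.

Lemma ydeg_max (B : idx) : inBK B -> (ydeg B %/ D k)%N = B ord_max.
Proof. by move=> hB; rewrite -{2}(idx_ofK hB) idx_of_max. Qed.

(** The box of side M is replaced by a rectangle of pairs (a, n) covering it; outside the box g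
    vanishes by assumption. *)
Lemma sum_idx (V : nmodType) (M A NN : nat) (g : idx -> V) :
  (forall a n, (a < A)%N -> (n < NN)%N -> ~ (forall l, (idx_of a n l < M)%N) -> g (idx_of a n) = 0) ->
  (M <= A)%N -> (M * D k <= NN)%N ->
  \sum_(Bb : {ffun 'I_k.+2 -> 'I_M} | inBK (ffnat Bb)) g (ffnat Bb) =
  \sum_(a < A) \sum_(n < NN) g (idx_of a n).
Proof.
move=> h0 MA MN.
have step1 (Bb : {ffun 'I_k.+2 -> 'I_M}) : inBK (ffnat Bb) ->
   g (ffnat Bb) = \sum_(x : 'I_A * 'I_NN | idx_of x.1 x.2 == ffnat Bb) g (ffnat Bb).
  move=> hB; have a1 : (ffnat Bb ord0 < A)%N by rewrite ffunE (leq_trans _ MA).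
  have n1 : (ydeg (ffnat Bb) < NN)%N.
    apply: leq_trans MN; rewrite -ltn_divLR // ydeg_max // ffunE.
    exact: ltn_ord.
  rewrite (big_pred1 (Ordinal a1, Ordinal n1)) // => -[a n] /=.
  apply/eqP/eqP => [E|[-> ->]] /=; last by rewrite idx_ofK.
  rewrite -(idx_ofK hB) in E; have [e1 e2] := idx_of_inj E.
  by congr (_, _); apply: val_inj.
rewrite (eq_bigr _ step1) (exchange_big_dep xpredT) //= pair_bigA /=.
apply: eq_bigr => -[a n] _ /=.
have [hM|hM] := pselect (forall l, (idx_of a n l < M)%N).
  pose Bb : {ffun 'I_k.+2 -> 'I_M} := [ffun l => Ordinal (hM l)].
  have BE : ffnat Bb = idx_of a n by apply/ffunP => l; rewrite !ffunE /= ffunE.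
  rewrite (big_pred1 Bb) ?BE // => B' /=.
  apply/andP/eqP => [[_ /eqP E]|->]; last by rewrite BE inBK_idx_of.
  apply/ffunP => l; apply: val_inj.
  have h : idx_of a n l = B' l by rewrite E ffunE.
  by rewrite ffunE /= h.
rewrite h0 // big1 // => B' /andP[_ /eqP E]; case: hM => l.
by rewrite E ffunE.
Qed.

Lemma toP_PhiB (B : idx) : toP (PhiB PhiK B) =
  (xp ^+ B ord0)%:P * \prod_(l < k.+1) toP (phi l) ^+ B (lift ord0 l).
Proof.
have -> : toP (PhiB PhiK B) = \prod_(l < k.+2) toP (PhiK l) ^+ B l.
  rewrite /PhiB -big_enum /=; elim: (enum _) => [|l s IH] /=.
    by rewrite big_nil toP_bone.
  by rewrite big_cons toP_bmul toP_bpow IH.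
by rewrite big_ord_recl /PhiK /= toP_bxpow expr1 polyC_exp.
Qed.

Let Ps n := Psi D (fun l => toP (phi l)) k n.

Lemma toP_PhiB_idx a n : toP (PhiB PhiK (idx_of a n)) = (xp ^+ a)%:P * Ps n.
Proof.
rewrite toP_PhiB idx_of0; congr (_ * _); apply: eq_bigr => l _.
by rewrite idx_ofS.
Qed.

Variables (f : idx -> K) (F : bpol K) (d : nat).
Hypotheses (hf : expands PhiK inBK f F) (hF : bmonic_deg F d).

Definition x_coef n : fps K := Fps (fun a => f (idx_of a n)).

Let msPs n : monic_size (Ps n) n.
Proof.
rewrite -[X in monic_size _ X](dig_sum D0 D_dvd k n); apply: monic_size_prod => l.
by apply: monic_size_exp; apply: mphi; rewrite -ltnS.
Qed.

Lemma bounded_le M M' n : (M <= M')%N -> bounded_by inBK f M n -> bounded_by inBK f M' n.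
Proof. by move=> h hb B hB fB Bn l; apply: leq_trans (hb B hB fB Bn l) h. Qed.

Lemma bounded_le_n M n n' : (n' <= n)%N -> bounded_by inBK f M n -> bounded_by inBK f M n'.
Proof. by move=> h hb B hB fB Bn; apply: hb => //; apply: leq_trans Bn h. Qed.

Lemma partial_expansion M j i : bounded_by inBK f M j ->
  bco F i j = fc (\sum_(n < M * D k) x_coef n *: Ps n)`_i j.
Proof.
move=> hb; rewrite (hf.2 i j M hb).
pose A := maxn M j.+1.
rewrite (sum_idx (A := A) (NN := (M * D k)%N)
   (g := fun B => f B * bco (PhiB PhiK B) i j)) ?leq_maxl //; last first.
  move=> a n _ _ hM; have [f0|f0] := eqVneq (f (idx_of a n)) 0; first by rewrite f0 mul0r.
  case: (leqP a j) => aj.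
    by case: hM => l; apply: hb => //; [apply: inBK_idx_of | rewrite idx_of0].
  by rewrite -fc_toP toP_PhiB_idx coefCM fcxpM leqNgt aj mulr0.
rewrite exchange_big coef_sum fc_sum; apply: eq_bigr => n _ /=.
rewrite coefZ fcM (big_ord_widen A (fun a => fc (x_coef n) a * fc (Ps n)`_i (j - a)));
  last exact: leq_maxr.
rewrite [RHS]big_mkcond; apply: eq_bigr => a _.
rewrite -fc_toP toP_PhiB_idx coefCM fcxpM ltnS.
by case: ifP => _ //; rewrite mulr0.
Qed.

(** Modulo x^(J+1) the coefficients are peeled off from the top, each Psi_n being monic of degree
    n. *)
Lemma triangular_vanish NN J :
  (forall i j, (d < i)%N -> (j <= J)%N -> fc (\sum_(n < NN) x_coef n *: Ps n)`_i j = 0) ->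
  forall n j, (d < n)%N -> (n < NN)%N -> (j <= J)%N -> fc (x_coef n) j = 0.
Proof.
elim: NN => [//|N IH] h n j dn; rewrite ltnS leq_eqVlt => /orP[/eqP nE|nN] jJ.
  by rewrite nE in dn *; have := h N j dn jJ; rewrite (triangular_coef msPs).
apply: (IH _ n j) => // i j' di jJ'.
have dN : (d < N)%N by apply: ltn_trans dn nN.
have CN a : (a <= J)%N -> fc (x_coef N) a = 0.
  by move=> aJ; have := h N a dN aJ; rewrite (triangular_coef msPs).
have z : fc (x_coef N * (Ps N)`_i) j' = 0.
  rewrite fcM big1 // => a _; rewrite CN ?mul0r // (leq_trans _ jJ') //.
  by rewrite -ltnS.
by have := h i j' di jJ'; rewrite big_ord_recr /= coefD fcD coefZ z addr0.
Qed.

(** The bound on the indices depends on the power of x, so C_n is shown to vanish one coefficient at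
    a time. *)
Lemma x_coef_vanish n : (d < n)%N -> x_coef n = 0.
Proof.
move=> dn; apply: fpsP => j; rewrite fc0.
have [M0 hM0] := hf.1 j; pose M := maxn M0 n.+1.
have hM : bounded_by inBK f M j by apply: bounded_le hM0; apply: leq_maxl.
have nN : (n < M * D k)%N.
  by apply: (@leq_trans (n.+1 * D k)); [rewrite leq_pmulr | rewrite leq_mul2r leq_maxr orbT].
apply: (triangular_vanish (NN := (M * D k)%N) (J := j) _ dn nN (leqnn _)).
move=> i j' di jj; rewrite -partial_expansion; last by apply: bounded_le_n hM.
by rewrite hF.2.
Qed.

Lemma finite_expansion : toP F = \sum_(n < d.+1) x_coef n *: Ps n.
Proof.
apply/polyP => i; apply: fpsP => j; rewrite fc_toP.
have [M0 hM0] := hf.1 j; pose M := maxn M0 d.+1.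
have hM : bounded_by inBK f M j by apply: bounded_le hM0; apply: leq_maxl.
have dN : (d.+1 <= M * D k)%N.
  by apply: (@leq_trans (d.+1 * D k)); [rewrite leq_pmulr | rewrite leq_mul2r leq_maxr orbT].
rewrite (partial_expansion i hM); congr (fc _ j).
rewrite (big_ord_widen (M * D k) (fun n => x_coef n *: Ps n) dN) [in RHS]big_mkcond /=.
suff -> : \sum_(n < M * D k) x_coef n *: Ps n =
   \sum_(n < M * D k) (if (n < d.+1)%N then x_coef n *: Ps n else 0) by [].
by apply: eq_bigr => n _; case: ltnP => // h; rewrite x_coef_vanish // scale0r.
Qed.

Lemma x_coef_top : x_coef d = 1.
Proof.
have := triangular_coef msPs d x_coef; rewrite -finite_expansion => <-.
by apply: fpsP => j; rewrite fc_toP hF.1 fc1.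
Qed.

End Expansion.

(** * Reading the boundary polynomial off the expansion *)

Theorem theorem6 (K : fieldType) (L : closedFieldType) (iota : {rmorphism K -> L})
  (d : nat) (F : bpol K)
  (hperf : perfect_field K)
  (hchar : [pchar K] =i pred0 \/ exists2 p, p \in [pchar K] & (d < p)%N)
  (hF : bmonic_deg F d)
  (D : rdata L) (hrun : is_run iota F d D)
  (k : nat) (hk : (k <= r_g D)%N) (hNk : (1 < r_N D k)%N)
  (phi : nat -> bpol K)
  (hphi : forall i, (i <= k)%N -> is_phi iota F d D i (phi i))
  (f : {ffun 'I_k.+2 -> nat} -> K)
  (hf : let Phi := fun l : 'I_k.+2 => if l == ord0 then bxpow K 1 else phi l.-1 in
        let inB := fun B : {ffun 'I_k.+2 -> nat} =>
          [forall l : 'I_k.+2, ((1 <= l) && (l <= k))%N ==>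
                               (B l < r_q D l * (size (r_P D l)).-1)%N] in
        expands Phi inB f F)
  (V : 'I_k.+2 -> nat) (Lam : 'I_k.+2 -> L)
  (hVL : forall l : 'I_k.+2,
     vlam (bsubst (bmapK iota (if l == ord0 then bxpow K 1 else phi l.-1))
                  (pimap iota F d D k)) (V l) (Lam l))
  (vF : nat) (hvF : bval_is (bsubst (bmapK iota F) (pimap iota F d D k)) vF)
  (Hb : {poly {poly L}}) (hHb : is_bnd (onNP (r_H D k)) (r_H D k) Hb) :
  let inB := fun B : {ffun 'I_k.+2 -> nat} =>
     [forall l : 'I_k.+2, ((1 <= l) && (l <= k))%N ==>
                          (B l < r_q D l * (size (r_P D l)).-1)%N] in
  (* w_i = w *)
  let w_is := fun (i : nat) (w : int) =>
     (exists B, inB B /\ B ord_max = i /\ f B != 0 /\ (dotBV B V)%:Z = w + vF%:Z) /\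
     (forall B, inB B -> B ord_max = i -> f B != 0 -> w + vF%:Z <= (dotBV B V)%:Z) in
  (* sum over B in B(i, w) of f_B Lambda^(B - B_0) *)
  let sumB := fun (i w : nat) =>
     let M := (w + i + \sum_(l < k.+2) r_q D l * (size (r_P D l)).-1).+1%N in
     \sum_(Bb : {ffun 'I_k.+2 -> 'I_M} |
             inB (ffnat Bb) && (ffnat Bb ord_max == i) && (dotBV (ffnat Bb) V == w))
        iota (f (ffnat Bb)) *
        \prod_(l < k.+2) Lam l ^ ((ffnat Bb l)%:Z
                                  - (if l == ord_max then r_N D k else 0%N)%:Z) in
  forall i j : nat,
    (onNP (r_H D k) i j /\ w_is i j%:Z -> Hb`_i`_j = sumB i (j + vF)%N) /\
    (~ (onNP (r_H D k) i j /\ w_is i j%:Z) -> Hb`_i`_j = 0).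
Proof.
move=> inB w_is sumB.
have [V' [Lam' [nf [om [v [U I]]]]]] := run_inv_all hchar hF hrun hk hphi (leqnn k).
set Dk := phi_deg D k in I *; set p := pi_map iota d F D k in I *; set N := r_N D k in I *.
set H := r_H D k in I *.
have lv := i_lev I; have e0 := lv_e lv; rewrite -/p in lv e0.
have D0 : Dk 0 = 1%N := phi_deg0 D k.
have D_gt0 : forall l, (0 < Dk l)%N := phi_deg_gt0 hrun hk.
have D_dvd : forall l, (Dk l %| Dk l.+1)%N := phi_deg_dvd D k.
have D_rad l : (l < k)%N -> (Dk l.+1 = Dk l * radix D l.+1)%N.
  by move=> lk; rewrite /Dk phi_degS lk.
have hdeg := i_N I; rewrite -/N -/Dk in hdeg.
have mph l : (l <= k)%N -> monic_size (toP (phi l)) (Dk l) := lv_phi lv (l := l).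
pose C n := x_coef Dk f n.
have FE := finite_expansion (rad := radix D) D0 D_gt0 D_dvd D_rad mph hf hF; rewrite -/(phi_poly phi) -/C in FE.
have C0 n : (d < n)%N -> C n = 0 := x_coef_vanish (rad := radix D) D0 D_gt0 D_dvd D_rad mph hf hF (n := n).
have Cd : C d = 1 := x_coef_top (rad := radix D) D0 D_gt0 D_dvd D_rad mph hf hF.
(* This is x o pi_k = mu x^e; with [VLS] it matches the given [V] and [Lam] with those of the
   induction. *)
have VL0 : V ord0 = am_e p /\ Lam ord0 = am_mu p.
  have := hVL ord0; rewrite eqxx => hv.
  have [||-> ->] := vlam_unique (c := am_e p) (i0 := 0) (A := (fpsC (am_mu p))%:P) _ _ hv.
  - rewrite toP_bsubst // toP_bmapK toP_bxpow map_polyC /= psubC expr0 mul1r.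
    rewrite -mul_polyC -polyCM mulrC; congr _%:P.
    have -> : fmap iota (xp ^+ 1) = xp ^+ 1 :> fps L.
      by apply: fpsP => n; rewrite !xpE /= /sX; case: eqP => _; rewrite ?rmorph1 ?rmorph0.
    by rewrite fsub_xp // expr1 muln1.
  - by rewrite coefC eqxx (lv_mu lv).
  - by rewrite coefC.
have VLS (l : 'I_k.+1) : V (lift ord0 l) = V' l /\ Lam (lift ord0 l) = Lam' l.
  have lk : (l <= k)%N by rewrite -ltnS.
  have := hVL (lift ord0 l); rewrite /= => hv.
  have [A [EA A0 _]] := lv_val lv lk.
  have [L0 _] := lv_Lam lv lk.
  have [||-> ->] := vlam_unique (c := V' l) (i0 := (l == k :> nat)) (A := A) _ _ hv.
  - by rewrite toP_bsubst // toP_bmapK; exact: EA.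
  - by rewrite A0.
  - by rewrite A0.
have LamN0 l : Lam l != 0.
  have [j ->|->] := unliftP ord0 l; last by rewrite VL0.2 (lv_mu lv).
  by rewrite (VLS j).2; have [|] := lv_Lam lv (l := j); rewrite // -ltnS.
have dotE a n : dotBV (idx_of k Dk a n) V = (am_e p * a + psi_wt Dk k V' n)%N.
  rewrite /dotBV big_ord_recl idx_of0 VL0.1 mulnC; congr (_ + _)%N.
  by apply: eq_bigr => l _; rewrite idx_ofS (VLS l).1.
have FU := i_F I; rewrite -/H -/p in FU.
(* At x = 0 the coefficient of y^N in U H_k is U(0,0), which is nonzero. *)
have vE : vF = v.
  have co i j : bco (bsubst (bmapK iota F) (pimap iota F d D k)) i j =
      if (v <= j)%N then fc (U * toP H)`_i (j - v) else 0.
    rewrite -fc_toP toP_bsubst // toP_bmapK.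
    by have := congr1 (fun G : {poly fps L} => fc G`_i j) FU; rewrite coefZ fcxpM.
  have [[i0 nz] low] := hvF.
  apply/eqP; rewrite eqn_leq; apply/andP; split; rewrite leqNgt; apply/negP => h.
    have := low N v h; rewrite co leqnn subnn fc_mul => E.
    have /eqP[] := i_U I; rewrite -[RHS]E big_ord_recl /= big_ord1 subn0 fc_toP.
    rewrite (i_H I).1 mulr1 big1 ?addr0 // => c _; rewrite big_ord1 fc_toP.
    have [k0|k0] := posnP k; first by rewrite (i_0 I k0) coef1 mul0r.
    by rewrite (i_w I) ?mulr0 // /bump /=; have := ltn_ord c; lia.
  by move: nz; rewrite co leqNgt h eqxx.
pose ct n w := cterm iota p (psi_wt Dk k V' n) (psi_coef Dk k Lam' n) w (C n).
(* The supporting line at (i, j) yields the coefficient as a sum of leading terms and, for the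
   minimality of w_i, a lower bound on the weights of all B with f_B nonzero. *)
have main i j : onNP H i j ->
   fc U`_0 0 * bco H i j = \sum_(n < d.+1 | (n %/ Dk k == i)%N) ct n (j + v)%N /\
   exists al be, (0 < be)%N /\ forall n a, fc (C n) a != 0 ->
      (al * i + be * (j + v) <= al * (n %/ Dk k) + be * (am_e p * a + psi_wt Dk k V' n))%N.
  move=> hon; have [al [be [hal hbe hI]]] := onNP_weights (i_H I) (i_w I) hon.
  have UI0 : weight_ge al be 0 U by [].
  have xI : weight_ge al be (be * v) ((xp ^+ v)%:P : {poly fps L}).
    move=> i' j'; rewrite coefC; case: (i' =P 0%N) => [->|_]; last by rewrite fc0 eqxx.
    rewrite fcxp; case: (j' =P v) => [->|_]; last by rewrite eqxx.
    by rewrite muln0.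
  have FI : weight_ge al be (al * i + be * (j + v)) (evp iota p (toP F)).
    rewrite FU -mul_polyC; have := weight_geM xI (weight_geM UI0 hI); apply: weight_ge_le.
    by rewrite mulnDr; lia.
  have hb : forall n a, (n < d.+1)%N -> fc (C n) a != 0 ->
      (al * i + be * (j + v) <= al * (n %/ Dk k) + be * (am_e p * a + psi_wt Dk k V' n))%N.
    by apply: (lead_bound D0 D_gt0 D_dvd lv hal hbe); rewrite -FE.
  split; last first.
    exists al, be; split=> // n a Ca; apply: hb => //.
    by rewrite ltnS leqNgt; apply/negP => /C0 E; rewrite E fc0 eqxx in Ca.
  rewrite -(lead_coef_sum D0 lv hal hbe hb (erefl _)) -FE FU coefZ fcxpM leq_addl addnK.
  (* The rest of U raises the weight, so it contributes nothing on the minimal line; at level 0 it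
     is 0. *)
  pose R := U - (fpsC (fc U`_0 0))%:P.
  have -> : U * toP H = (fpsC (fc U`_0 0))%:P * toP H + R * toP H.
    by rewrite /R mulrBl addrC subrK.
  rewrite coefD fcD coefCM fcCM fc_toP.
  have R0 : fc R`_0 0 = 0 by rewrite /R coefB coefC fcB fcC subrr.
  have -> : fc (R * toP H)`_i j = 0.
    case: hal => [al0|k0].
      have RI : weight_ge al be 1 R.
        move=> [|i'] [|j']; rewrite ?R0 ?eqxx //; lia.
      by apply/eqP/contraT => /(weight_geM RI hI); lia.
    by rewrite /R (i_0 I k0) coef1 fc1 rmorph1 subrr mul0r coef0.
  by rewrite addr0.
have onN : onNP H N 0.
  exists 0, 1; split=> //.
  have nN : npts H N 0 by split; rewrite // (i_H I).1 eqxx oner_neq0.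
  split; first by exists N, 0%N, N, 0%N; rewrite leqnn.
  by move=> i' j' _; rewrite /lin; lia.
have tcd : psi_coef Dk k Lam' d = Lam' k ^+ N.
  have := psi_coef_shift D_gt0 D_dvd Lam' N (D_gt0 k); rewrite addn0 hdeg => ->.
  by rewrite [psi_coef _ _ _ 0]big1 ?mulr1 // => l _; rewrite /dig mod0n !div0n if_same expr0.
(* In the row b_k = N only n = d occurs, since n <= d = N D_k. There C_d = 1, and the term, being
   nonzero, must use its coefficient at x^0. *)
have U0 : fc U`_0 0 = Lam' k ^+ N.
  have [E _] := main N 0%N onN; rewrite (i_H I).1 mulr1 add0n in E.
  have U0 := i_U I; rewrite E in U0.
  rewrite E; move: U0; rewrite (bigD1 ord_max) /=; last first.
    by rewrite -hdeg mulnK.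
  rewrite big1 ?addr0 => [|n /andP[/eqP h1 h2]]; last first.
    exfalso; move/eqP: h2; apply; apply: val_inj; apply/eqP; rewrite eqn_leq /=.
    by rewrite -ltnS ltn_ord /= -{1}hdeg -h1 leq_trunc_div.
  rewrite /ct /cterm Cd fc1; case: ifP => ad; last by rewrite eqxx.
  have [->|a0] := eqVneq ((v - psi_wt Dk k V' d) %/ am_e p)%N 0%N; last first.
    by rewrite mulr0n rmorph0 !mul0r eqxx.
  by rewrite rmorph1 expr0 !mul1r tcd.
have Lk0 : Lam' k != 0 by have [] := lv_Lam lv (leqnn k).
have prodE a n : \prod_(l < k.+2) Lam l ^ ((idx_of k Dk a n l)%:Z -
    (if l == ord_max then N else 0%N)%:Z) = am_mu p ^+ a * psi_coef Dk k Lam' n / Lam' k ^+ N.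
  under eq_bigr do rewrite expfzDr //.
  rewrite big_split /=; congr (_ * _).
    rewrite big_ord_recl VL0.2 idx_of0; congr (_ * _).
    by apply: eq_bigr => l _; rewrite (VLS l).2 idx_ofS.
  rewrite (bigD1 ord_max) //= eqxx big1 ?mulr1 => [|l /negPf ->]; last by rewrite oppr0 expr0z.
  have -> : ord_max = lift ord0 (ord_max : 'I_k.+1) by apply: val_inj.
  by rewrite (VLS ord_max).2 -exprnN.
(* The bound M admits every B with b_k = i and <B,V> = w: the exponent a of x satisfies a <= e a <=
   w, and the remaining entries stay below their radices. *)
have sumE i w : sumB i w * Lam' k ^+ N = \sum_(n < d.+1 | (n %/ Dk k == i)%N) ct n w.
  rewrite /sumB; set M := (w + i + _).+1.
  pose g (B : {ffun 'I_k.+2 -> nat}) := if (B ord_max == i) && (dotBV B V == w) then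
    iota (f B) * \prod_(l < k.+2) Lam l ^ ((B l)%:Z - (if l == ord_max then N else 0%N)%:Z) else 0.
  have -> : \sum_(Bb : {ffun 'I_k.+2 -> 'I_M} |
             inB (ffnat Bb) && (ffnat Bb ord_max == i) && (dotBV (ffnat Bb) V == w))
        iota (f (ffnat Bb)) *
        \prod_(l < k.+2) Lam l ^ ((ffnat Bb l)%:Z
                                  - (if l == ord_max then r_N D k else 0%N)%:Z) =
     \sum_(Bb : {ffun 'I_k.+2 -> 'I_M} | inBK (radix D) (ffnat Bb)) g (ffnat Bb).
    by rewrite -big_mkcondr; apply: eq_bigl => Bb; rewrite -andbA.
  have gE a n : g (idx_of k Dk a n) * Lam' k ^+ N =
     if ((n %/ Dk k)%N == i) && (am_e p * a + psi_wt Dk k V' n == w)%N then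
       iota (fc (C n) a) * am_mu p ^+ a * psi_coef Dk k Lam' n else 0.
    rewrite /g idx_of_max dotE; case: ifP => _; last by rewrite mul0r.
    by rewrite prodE mulrA mulfVK ?expf_neq0 // mulrA.
  rewrite (sum_idx (k := k) (D := Dk) (rad := radix D) D0 D_gt0 D_dvd D_rad (A := M)
     (NN := (M * Dk k)%N) (g := g)) //; last first.
    move=> a n aM nM hM; rewrite /g; case: ifP => // /andP[/eqP bi /eqP bw]; case: hM => l.
    rewrite dotE in bw; rewrite idx_of_max in bi.
    have [j ->|->] := unliftP ord0 l; last first.
      by rewrite idx_of0 /M; have : (a <= am_e p * a)%N by [rewrite leq_pmull]; lia.
    rewrite idx_ofS; have [jk|jk] := ltnP j k; last first.
      have -> : j = k :> nat by apply/eqP; rewrite eqn_leq jk -ltnS ltn_ord.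
      by rewrite dig_top bi /M; lia.
    have h1 := dig_bound D_gt0 D_dvd n jk; rewrite D_rad // mulKn // in h1.
    apply: leq_trans h1 _; rewrite /M.
    have : (radix D j.+1 <= \sum_(l < k.+2) r_q D l * (size (r_P D l)).-1)%N.
      have jk2 : (j.+1 < k.+2)%N by lia.
      by rewrite (bigD1 (Ordinal jk2)) //= leq_addr.
    by lia.
  rewrite mulr_suml; under eq_bigr do rewrite mulr_suml.
  rewrite exchange_big /=.
  transitivity (\sum_(n < M * Dk k | (n %/ Dk k == i)%N) ct n w).
    rewrite [RHS]big_mkcond; apply: eq_bigr => n _; under eq_bigr do rewrite gE.
    case: eqP => _ /=; last by rewrite big1.
    rewrite /ct /cterm; case: ifP => [/andP[h1 h2]|ad]; last first.
      rewrite big1 // => a _; case: eqP => // E; move: ad; rewrite /adm -E.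
      by rewrite leq_addl addnK dvdn_mulr.
    set a0 := ((w - _) %/ _)%N.
    have a0M : (a0 < M)%N by rewrite /M /a0 ltnS; apply: leq_trans (leq_div _ _) _; lia.
    rewrite (bigD1 (Ordinal a0M)) //= big1 ?addr0 => [|a]; last first.
      rewrite -val_eqE /= => na; case: eqP => // E; case/eqP: na.
      by rewrite /a0 -E addnK mulKn.
    by rewrite ifT // /a0 [(am_e p * _)%N]mulnC divnK // subnK.
  rewrite (big_divn i _ (fun n => ct n w)) // (big_divn i _ (fun n => ct n w)) //.
  apply: eq_bigr => r _.
  have rM : (i * Dk k + r < M * Dk k)%N.
    apply: (@leq_trans (i.+1 * Dk k)); first by rewrite mulSn addnC ltn_add2r.
    by rewrite leq_mul2r /M; apply/orP; right; lia.
  rewrite rM; case: ltnP => // h; rewrite /ct C0 // /cterm fc0 rmorph0 !mul0r if_same //.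
have key i j : onNP H i j -> bco H i j = sumB i (j + vF)%N.
  move=> on; have [E _] := main i j on.
  by apply: (mulIf (expf_neq0 N Lk0)); rewrite sumE vE -E U0 mulrC.
move=> i j; have [hb1 hb2] := hHb i j; split=> [[on _]|nw].
  by rewrite hb1 // key.
have [on|/hb2 //] := pselect (onNP (r_H D k) i j).
(* A nonzero coefficient at a polygon point forces w_i = j: some term of the sum is nonzero and
   gives a B of weight j + v_k(F), and [hlow] excludes smaller weights with b_k = i. *)
rewrite hb1 //; apply/eqP/contraT => nz; case: nw; split=> //.
have [E [al [be [be0 hlow]]]] := main i j on.
have S0 : \sum_(n < d.+1 | (n %/ Dk k == i)%N) ct n (j + v)%N != 0.
  by rewrite -E U0 mulf_neq0 ?expf_neq0.
have [n [/eqP ni]] : exists n : 'I_d.+1, (n %/ Dk k == i)%N /\ ct n (j + v)%N != 0.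
  apply: contrapT => h; case/eqP: S0; apply: big1 => n ni; apply/eqP/contraT => nzn.
  by case: h; exists n.
rewrite /ct /cterm; case: ifP => [/andP[h1 h2]|]; last by rewrite eqxx.
set a := ((_ - _) %/ _)%N => hn; split.
  exists (idx_of k Dk a n); split; first by apply: (inBK_idx_of (rad := radix D)).
  rewrite idx_of_max ni; split=> //; split.
    by apply: contraNneq hn => f0; rewrite /C /x_coef /= f0 rmorph0 !mul0r.
  by rewrite dotE /a [(am_e p * _)%N]mulnC divnK // subnK // vE PoszD.
move=> B BB Bi fB.
have BE := idx_ofK D0 D_gt0 D_dvd D_rad BB.
have Cn : fc (C (ydeg Dk B)) (B ord0) != 0 by rewrite /C /x_coef /= BE.
have := hlow _ _ Cn; rewrite (ydeg_max D0 D_gt0 D_dvd D_rad BB) Bi leq_add2l leq_pmul2l //.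
by rewrite -dotE BE vE -PoszD lez_nat.
Qed.
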